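(* Let $(M,c,\sigma)$ be Poincar\'e--Einstein, $w_0\neq -k,\ k-d,\ k-n$ a weight, $h_0:=d+2w_0$, and let $A_0\in\Gamma\mathcal E^kM[w_0+k]$ be an extension of $A_\Sigma\in\Gamma\mathcal E^k\Sigma[w_0+k]$. Then the tractor Proca problem with boundary data $q_W^\Sigma(A_\Sigma)$ has a solution to order $$\ell=\begin{cases}\infty,& h_0\neq 2,3,\dots\\ h_0-2,& h_0=2,3,\dots\end{cases}$$ given by $\mathcal A^{(\ell)}=q_W(A^{(\ell)})$, with $$A^{(\ell)}=\frac{\tilde\iota\,\tilde\varepsilon}{(w_0+k)(n+w_0-k)}\Big[\prod_{j=1}^{\ell}\frac{\tilde\iota\,\tilde\varepsilon-(w_0+k-j)(n+w_0-k-j)}{j(n+2w_0-j)}\Big]A_0 .$$ That is, for each such $\ell$ (each finite $\ell$ when the order is $\infty$), $\mathcal A^{(\ell)}\in\Gamma\mathcal T^kM[w_0]$ satisfies $\mathcal A^{(\ell)}|_\Sigma=q^\Sigma_W(A_\Sigma)$, $y\mathcal A^{(\ell)}=O(\sigma^\ell)$ and $\mathscr I^\star\mathcal A^{(\ell)}=\widehat{\mathscr D}^\star\mathcal A^{(\ell)}=\mathscr X^\star\mathcal A^{(\ell)}=0$.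
   Context: Conformal conventions. $M$ is a smooth manifold of dimension $d=n+1\ge3$ with boundary $\Sigma$ and conformal class $c$; $c_\Sigma$ is the induced class on $\Sigma$. $\mathcal EM[w]$: conformal densities of weight $w$ (families $\mu_g$, $g\in c$, with $\mu_{\Omega^2g}=\Omega^w\mu_g$); each scale $g\in c$ trivialises them; indices are moved with the conformal metric $\boldsymbol g$. $\mathcal E^kM[w]=\Lambda^kT^*M\otimes\mathcal EM[w]$. In a scale $g$: $\varepsilon,\iota$ are exterior/interior multiplication, $\mathbf d=\varepsilon(\nabla)$, $\boldsymbol\delta=\iota(\nabla)$, $\boldsymbol\Delta=\mathbf d\boldsymbol\delta+\boldsymbol\delta\mathbf d$; $\mathrm{Ric}=(d-2)P+Jg$, $J=P^a{}_a$, and $\mathbb P$ is the endomorphism $P^a{}_b$ extended to forms as a derivation. Forms on $\Sigma$ are identified with forms along $\Sigma$ annihilated by $\iota(\nu)$. Poincar\'e--Einstein: $\sigma\in\Gamma\mathcal EM[1]$ is positive in the interior, vanishes exactly on $\Sigma$ with $\nabla\sigma\ne0$ there, and $g^o=\sigma^{-2}\boldsymbol g$ satisfies $\mathrm{Ric}(g^o)=-n g^o$. In a scale $g$: $\nu=\nabla\sigma$, $\rho=-\frac1d(\nabla^a\nabla_a\sigma+J\sigma)$. $O(\sigma^\alpha)$ means $\sigma^\alpha$ times a smooth section. The invariant operators $\tilde\varepsilon,\tilde\iota$ on $A\in\Gamma\mathcal E^kM[w']$ are $\tilde\varepsilon A=[w'\varepsilon(\nu)-\sigma\mathbf d]A\in\Gamma\mathcal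 E^{k+1}M[w'+1]$, $\tilde\iota A=[(d+w'-2k)\iota(\nu)-\sigma\boldsymbol\delta]A\in\Gamma\mathcal E^{k-1}M[w'-1]$. Tractor forms. For $g\in c$, $\mathcal T^kM[w]\cong\mathcal E^{k-1}M[w+k]\oplus\mathcal E^kM[w+k]\oplus\mathcal E^{k-2}M[w+k-2]\oplus\mathcal E^{k-1}M[w+k-2]$; sections are $\mathcal F=(F^+,F,F^{+-},F^-)$ (north, west, east, south slots). Under $\hat g=\Omega^2g$, $\Upsilon=\mathbf d\log\Omega$: $\hat F^+=F^+$, $\hat F=F+\varepsilon(\Upsilon)F^+$, $\hat F^{+-}=F^{+-}-\iota(\Upsilon)F^+$, $\hat F^-=F^-+\frac12(\varepsilon(\Upsilon)\iota(\Upsilon)-\iota(\Upsilon)\varepsilon(\Upsilon))F^+-\iota(\Upsilon)F-\varepsilon(\Upsilon)F^{+-}$. Invariant operators on $\mathcal T^kM[w]$: $\mathscr X^\star\mathcal F=(0,F^+,0,F^{+-})$; $\mathscr I^\star\mathcal F=(-\iota(\nu)F^+-\sigma F^{+-},\ \rho F^++\iota(\nu)F+\sigma F^-,\ \iota(\nu)F^{+-},\ \rho F^{+-}-\iota(\nu)F^-)$; $\mathscr D:\Gamma\mathcal T^kM[w]\to\Gamma\mathcal T^{k+1}M[w-1]$ with slots north: $(d+2w-2)\big((w+k)F-\mathbf dF^+\big)$; west: $(d+2w-2)\mathbf dF$; east: $\big(\boldsymbol\Delta+(w+k-2)(J-2\mathbb P)\big)F^+-2\boldsymbol\delta F+(d+2w)\big(\mathbf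 dF^{+-}+(w+k-2)F^-\big)$; south: $[J-2\mathbb P,\mathbf d]F^+-\big(\boldsymbol\Delta+(w+k)(J-2\mathbb P)\big)F-(d+2w)\mathbf dF^-$. $y:=-(\mathscr I^\star\mathscr D+\mathscr D\mathscr I^\star):\Gamma\mathcal T^kM[w]\to\Gamma\mathcal T^kM[w-1]$. On $\ker\mathscr X^\star$, $\widehat{\mathscr D}^\star(0,A,0,\phi)=(0,\ \boldsymbol\delta A+(d+w-k)\phi,\ 0,\ -\boldsymbol\delta\phi)$. Western insertions: $q_W(A)=(0,A,0,-\frac1{d+w-k}\boldsymbol\delta A)\in\Gamma\mathcal T^kM[w]$ for $A\in\Gamma\mathcal E^kM[w+k]$, $w\neq k-d$; $q_W^\Sigma(A_\Sigma)=(0,A_\Sigma,0,-\frac1{n+w-k}\boldsymbol\delta_\Sigma A_\Sigma)\in\Gamma\mathcal T^k\Sigma[w]$, $w\ne k-n$. Along $\Sigma$ a tractor $(0,A,0,\phi)$ of $\mathcal T^kM[w]|_\Sigma$ with $\iota(\nu)A=0=\iota(\nu)\phi$ is identified with the boundary tractor with the same slots. *)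

(* Defs.v *)
From HB Require Import structures.
From mathcomp Require Export all_boot all_order all_algebra.
From mathcomp Require Export all_classical all_reals all_analysis.
Export numFieldNormedType.Exports.
Export Order.TTheory GRing.Theory Num.Theory.

Set Implicit Arguments.
Unset Strict Implicit.
Unset Printing Implicit Defensive.

Local Open Scope classical_set_scope.
Local Open Scope ring_scope.

(* Raw charts; the axioms are in [manifold_with_boundary].  All fields below
   are families of functions on the points of M, one for each chart; their
   values outside the domain of the chart are irrelevant and every condition
   on them is restricted to the domains. *)
Record chart_space (R : realType) (m : nat) := ChartSpace {
  pt :> topologicalType;
  chart : Type;
  dom : chart -> set pt;
  crd : chart -> pt -> 'rV[R]_m;
  par : chart -> 'rV[R]_m -> pt
}.

Section Smoothness.
Context {R : realType} {m : nat}.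

(* C^oo on an open set: all iterated partial derivatives are differentiable *)
Definition smooth_open (V : set 'rV[R]_m) (F : 'rV[R]_m -> R) : Prop :=
  forall (s : seq 'I_m) (x : 'rV[R]_m), V x ->
    differentiable
      (foldr (fun i (G : 'rV[R]_m -> R) => 'D_(delta_mx ord0 i) G) F s) x.

Variable X : chart_space R m.

(* [f], read in the chart [a], is smooth on [D]: near each point it extends to
   a smooth function on an open subset of R^m *)
Definition smooth_on (a : chart X) (D : set X) (f : X -> R) : Prop :=
  forall p, D p -> exists (V : set 'rV[R]_m) (F : 'rV[R]_m -> R),
    [/\ open V, V (crd a p), smooth_open V F &
        forall q, D q -> V (crd a q) -> F (crd a q) = f q].

Definition smooth (f : X -> R) : Prop := forall a, smooth_on a (dom a) f.

(* Partial derivative in the chart [a].  The difference quotients are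
   one-sided, so that the definition makes sense also at the boundary points
   of a half-space chart; for smooth functions and interior points this is the
   usual partial derivative. *)
Definition pd (a : chart X) (i : 'I_m) (f : X -> R) (p : X) : R :=
  lim ((h^-1 * (f (par a (crd a p + h *: delta_mx ord0 i)) - f p))
         @[h --> (0 : R)^'+]).

(* entry (i, j) is the derivative of the i-th coordinate of [b] with respect to
   the j-th coordinate of [a] *)
Definition jacobian (a b : chart X) (p : X) : 'M[R]_m :=
  \matrix_(i, j) pd a j (fun q => crd b q ord0 i) p.

End Smoothness.

Section Manifold.
Context {R : realType} {n : nat}.

Definition half_space : set 'rV[R]_n.+1 := [set x | 0 <= x ord0 ord0].

Record manifold_with_boundary (M : chart_space R n.+1) : Prop := {
  mfd_hausdorff : hausdorff_space M;
  mfd_second_countable : second_countable (T := M);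
  mfd_open : forall a : chart M, open (dom a);
  mfd_cover : forall p : M, exists a : chart M, dom a p;
  mfd_half_space : forall (a : chart M) p, dom a p -> half_space (crd a p);
  mfd_parK : forall (a : chart M) p, dom a p -> par a (crd a p) = p;
  mfd_image : forall a : chart M, exists O : set 'rV[R]_n.+1,
    open O /\ crd a @` dom a = O `&` half_space;
  mfd_crd_continuous : forall a : chart M, {within dom a, continuous (crd a)};
  mfd_par_continuous : forall a : chart M,
    {within crd a @` dom a, continuous (par a)};
  mfd_transition : forall (a b : chart M) (i : 'I_n.+1),
    smooth_on a (dom a `&` dom b) (fun q => crd b q ord0 i)
}.

(* The boundary, with the atlas of the restricted charts; the underlying
   type is still that of M, so only the points of the domains are meaningful. *)
Definition boundary_space (M : chart_space R n.+1) : chart_space R n :=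
  @ChartSpace R n (pt M) (chart M)
    (fun a => dom a `&` [set p | crd a p ord0 ord0 = 0])
    (fun a p => \row_j crd a p ord0 (lift ord0 j))
    (fun a y => par a (\row_i if unlift ord0 i is Some j then y ord0 j else 0)).

Definition boundary (M : chart_space R n.+1) : set M :=
  [set p | exists a : chart M, dom (c := boundary_space M) a p].

End Manifold.

Arguments boundary {R n} M _.

(* [A S] is the coefficient of dx^s1 /\ ... /\ dx^sk for S = {s1 < ... < sk} *)
Notation exterior R m := {ffun {set 'I_m} -> R^o}.

Section Exterior.
Context {R : realType} {m : nat}.
Implicit Types (A : exterior R m) (i : 'I_m) (S : {set 'I_m}).

Definition ext_sign i S : R := (-1) ^+ #|[pred j in S | (j < i)%N]|.

Definition ext_basis i A : exterior R m :=
  [ffun S : {set 'I_m} => if i \in S then ext_sign i S * A (S :\ i) else 0].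

(* interior multiplication by d/dx^i *)
Definition int_basis i A : exterior R m :=
  [ffun S : {set 'I_m} => if i \in S then 0 else ext_sign i S * A (i |: S)].

Definition ext_mul (v : 'I_m -> R) A : exterior R m :=
  \sum_i v i *: ext_basis i A.

(* interior multiplication by the vector metrically dual to the covector [v] *)
Definition int_mul (g : 'M[R]_m) (v : 'I_m -> R) A : exterior R m :=
  \sum_i \sum_j (invmx g i j * v j) *: int_basis i A.

Definition ext_one : exterior R m := [ffun S : {set 'I_m} => (S == finset.set0)%:R].

(* substitution of dy^i = \sum_j Jac i j dx^j in [A] *)
Definition ext_pullback (Jac : 'M[R]_m) A : exterior R m :=
  \sum_(S : {set 'I_m}) A S *: foldr (fun i B => ext_mul (Jac i) B) ext_one (enum S).

Definition homogeneous (k : int) A : Prop :=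
  forall S, A S != 0 -> (#|S|%:Z = k).

End Exterior.

Section Fields.
Context {R : realType} {m : nat} (X : chart_space R m).

Definition metric := chart X -> X -> 'M[R]_m.

Record riemannian (g : metric) : Prop := {
  riem_smooth : forall a i j, smooth_on a (dom a) (fun p => g a p i j);
  riem_sym : forall a p, dom a p -> (g a p)^T = g a p;
  riem_pos : forall a p (v : 'rV[R]_m), dom a p -> v != 0 ->
    0 < (v *m g a p *m v^T) ord0 ord0;
  riem_tensor : forall a b p, dom a p -> dom b p ->
    g a p = (jacobian a b p)^T *m g b p *m jacobian a b p
}.

(* g' = Omega^2 g *)
Definition rescaled (Omega : X -> R) (g g' : metric) : Prop :=
  [/\ smooth Omega, forall p, (exists a, dom a p) -> 0 < Omega p &
      forall a p, dom a p -> g' a p = Omega p ^+ 2 *: g a p].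

Definition conformal_class (c : set metric) : Prop :=
  exists2 g0, riemannian g0 &
    forall g, c g <-> exists Omega, rescaled Omega g0 g.

Definition form := chart X -> X -> exterior R m.

Record form_section (k : int) (A : form) : Prop := {
  form_smooth : forall a S, smooth_on a (dom a) (fun p => A a p S);
  form_degree : forall a p, dom a p -> homogeneous k (A a p);
  form_tensor : forall a b p, dom a p -> dom b p ->
    A a p = ext_pullback (jacobian a b p) (A b p)
}.

(* density-valued forms: families indexed by the metrics of the class *)
Definition dform := metric -> form.

(* Gamma E^k[w] *)
Definition density_form (c : set metric) (k : int) (w : R) (A : dform) : Prop :=
  (forall g, c g -> form_section k (A g)) /\
  (forall g g' Omega, c g -> c g' -> rescaled Omega g g' ->
     forall a p, dom a p -> A g' a p = Omega p `^ w *: A g a p).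

(* Gamma E[w] *)
Definition density (c : set metric) (w : R) (f : metric -> X -> R) : Prop :=
  (forall g, c g -> smooth (f g)) /\
  (forall g g' Omega, c g -> c g' -> rescaled Omega g g' ->
     forall a p, dom a p -> f g' p = Omega p `^ w * f g p).

Record tractor := Tractor {
  north : dform; west : dform; east : dform; south : dform }.

(* Gamma T^k[w] *)
Record tractor_section (c : set metric) (k : int) (w : R) (F : tractor) :
    Prop := {
  tractor_slots : forall g, c g ->
    [/\ form_section (k - 1) (north F g), form_section k (west F g),
        form_section (k - 2) (east F g) & form_section (k - 1) (south F g)];
  tractor_change : forall g g' Omega, c g -> c g' -> rescaled Omega g g' ->
    forall a p, dom a p ->
    let u i := pd a i (fun q => ln (Omega q)) p in
    let eps := ext_mul u in
    let iot := int_mul (g a p) u in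
    let Fn := north F g a p in let Fw := west F g a p in
    let Fe := east F g a p in let Fs := south F g a p in
    let hi := Omega p `^ (w + k%:~R) in
    let lo := Omega p `^ (w + k%:~R - 2) in
    [/\ north F g' a p = hi *: Fn,
        west F g' a p = hi *: (Fw + eps Fn),
        east F g' a p = lo *: (Fe - iot Fn) &
        south F g' a p =
          lo *: (Fs + 2^-1 *: (eps (iot Fn) - iot (eps Fn)) - iot Fw - eps Fe)]
}.

Definition form_eq (c : set metric) (A B : dform) : Prop :=
  forall g a p, c g -> dom a p -> A g a p = B g a p.

Definition tractor_eq (c : set metric) (F G : tractor) : Prop :=
  [/\ form_eq c (north F) (north G), form_eq c (west F) (west G),
      form_eq c (east F) (east G) & form_eq c (south F) (south G)].

Definition tractor0 : tractor := Tractor 0 0 0 0.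

Definition tractor_add (F G : tractor) : tractor :=
  Tractor (north F + north G) (west F + west G)
          (east F + east G) (south F + south G).

Definition tractor_opp (F : tractor) : tractor :=
  Tractor (- north F) (- west F) (- east F) (- south F).

End Fields.

Section Calculus.
Context {R : realType} {m : nat} {X : chart_space R m}.
Implicit Types (g : metric X) (A : dform X) (a : chart X) (p : X).

Definition christoffel g a (k i j : 'I_m) p : R :=
  2^-1 * \sum_l invmx (g a p) k l *
    (pd a i (fun q => g a q l j) p + pd a j (fun q => g a q l i) p
     - pd a l (fun q => g a q i j) p).

Definition ricci g a p : 'M[R]_m := \matrix_(i, j) \sum_k
  (pd a k (christoffel g a k i j) p - pd a j (christoffel g a k i k) p
   + \sum_l (christoffel g a k k l p * christoffel g a l i j p
             - christoffel g a k j l p * christoffel g a l i k p)).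

(* Taking the trace of Ric = (m - 2) P + J g, with J = tr P, gives
   tr Ric = 2 (m - 1) J. *)
Definition schouten_trace g a p : R :=
  \tr (invmx (g a p) *m ricci g a p) / (2 * (m%:R - 1)).

Definition schouten g a p : 'M[R]_m :=
  (m%:R - 2)^-1 *: (ricci g a p - schouten_trace g a p *: g a p).

(* multiplication by a scalar depending on the scale *)
Definition fscale (f : metric X -> chart X -> X -> R) A : dform X :=
  fun g a p => f g a p *: A g a p.

(* Levi-Civita derivative of forms, acting on dx^c by
   - \sum_e Gamma^c_{ie} dx^e; densities are trivialised by the scale g. *)
Definition nabla A g a (i : 'I_m) p : exterior R m :=
  [ffun S : {set 'I_m} => pd a i (fun q => A g a q S) p]
  - \sum_e \sum_c christoffel g a c i e p *: ext_basis e (int_basis c (A g a p)).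

(* d = epsilon(nabla) *)
Definition ext_d A : dform X :=
  fun g a p => \sum_i ext_basis i (nabla A g a i p).

(* delta = iota(nabla); with this sign it is the divergence on 1-forms *)
Definition codiff A : dform X :=
  fun g a p => \sum_i \sum_j invmx (g a p) i j *: int_basis i (nabla A g a j p).

Definition form_laplacian A : dform X := ext_d (codiff A) + codiff (ext_d A).

(* P^i_j acting on forms as a derivation *)
Definition schouten_action A : dform X := fun g a p =>
  \sum_i \sum_j (invmx (g a p) *m schouten g a p) i j *:
    ext_basis j (int_basis i (A g a p)).

Definition J2P A : dform X :=
  fscale schouten_trace A - 2 *: schouten_action A.

(* the invariant operator D on sections of T^k[w] *)
Definition tractor_D (k : int) (w : R) (F : tractor X) : tractor X :=
  let d : R := m%:R in let kr : R := k%:~R in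
  Tractor
    ((d + 2 * w - 2) *: ((w + kr) *: west F - ext_d (north F)))
    ((d + 2 * w - 2) *: ext_d (west F))
    (form_laplacian (north F) + (w + kr - 2) *: J2P (north F)
     - 2 *: codiff (west F)
     + (d + 2 * w) *: (ext_d (east F) + (w + kr - 2) *: south F))
    (J2P (ext_d (north F)) - ext_d (J2P (north F))
     - (form_laplacian (west F) + (w + kr) *: J2P (west F))
     - (d + 2 * w) *: ext_d (south F)).

Definition tractor_Xstar (F : tractor X) : tractor X :=
  Tractor 0 (north F) 0 (east F).

(* hat D^* on the kernel of X^* in T^k[w] *)
Definition tractor_hatDstar (k : int) (w : R) (F : tractor X) : tractor X :=
  Tractor 0 (codiff (west F) + (m%:R + w - k%:~R) *: south F)
          0 (- codiff (south F)).

(* western insertion q_W into T^k[w]; with m the dimension of the boundary it is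
   also the insertion q_W^Sigma *)
Definition western (k : int) (w : R) (A : dform X) : tractor X :=
  Tractor 0 A 0 (- (m%:R + w - k%:~R)^-1 *: codiff A).

Variable sigma : metric X -> X -> R.

Definition sigma_at (g : metric X) (a : chart X) (p : X) : R := sigma g p.

Definition nu g a p (i : 'I_m) : R := pd a i (sigma g) p.

Definition rho g a p : R :=
  - (m%:R)^-1 *
    (\sum_i \sum_j invmx (g a p) i j *
        (pd a i (pd a j (sigma g)) p
         - \sum_k christoffel g a k i j p * nu g a p k)
     + schouten_trace g a p * sigma g p).

Definition ext_nu A : dform X := fun g a p => ext_mul (nu g a p) (A g a p).
Definition int_nu A : dform X :=
  fun g a p => int_mul (g a p) (nu g a p) (A g a p).

(* on E^k[w'] (tilde epsilon does not depend on k) *)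
Definition tilde_eps (w' : R) A : dform X :=
  w' *: ext_nu A - fscale sigma_at (ext_d A).
Definition tilde_iota (k : int) (w' : R) A : dform X :=
  (m%:R + w' - 2 * k%:~R) *: int_nu A - fscale sigma_at (codiff A).

Definition tilde_iota_eps (k : int) (w' : R) A : dform X :=
  tilde_iota (k + 1) (w' + 1) (tilde_eps w' A).

Definition tractor_Istar (F : tractor X) : tractor X :=
  Tractor
    (- int_nu (north F) - fscale sigma_at (east F))
    (fscale rho (north F) + int_nu (west F) + fscale sigma_at (south F))
    (int_nu (east F))
    (fscale rho (east F) - int_nu (south F)).

(* y on T^k[w]; note that I^* maps T^k[w] to T^(k-1)[w] *)
Definition tractor_y (k : int) (w : R) (F : tractor X) : tractor X :=
  tractor_opp (tractor_add (tractor_Istar (tractor_D k w F))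
                           (tractor_D (k - 1) w (tractor_Istar F))).

(* F = sigma^l B for a smooth section B, where F has type T^k[w] *)
Definition tractor_bigO (c : set (metric X)) (k : int) (w : R) (l : nat)
    (F : tractor X) : Prop :=
  exists B : tractor X, tractor_section c k (w - l%:R) B /\
    let s g a p := sigma_at g a p ^+ l in
    tractor_eq c F (Tractor (fscale s (north B)) (fscale s (west B))
                            (fscale s (east B)) (fscale s (south B))).

End Calculus.

Section PoincareEinstein.
Context {R : realType} {n : nat} {M : chart_space R n.+1}.

Record poincare_einstein (c : set (metric M)) (sigma : metric M -> M -> R) :
    Prop := {
  pe_density : density c 1 sigma;
  pe_pos : forall g p, c g -> ~ boundary M p -> 0 < sigma g p;
  pe_zero : forall g p, c g -> boundary M p -> sigma g p = 0;
  pe_nabla : forall g a p, c g -> boundary M p -> dom a p ->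
    exists i, nu sigma g a p i != 0;
  pe_einstein : forall g a p, c g -> ~ boundary M p -> dom a p ->
    let go : metric M := fun b q => (sigma g q) ^- 2 *: g b q in
    ricci go a p = - n%:R *: go a p
}.

Definition restrict_metric (g : metric M) : metric (boundary_space M) :=
  fun a p => \matrix_(i, j) g a p (lift ord0 i) (lift ord0 j).

Definition boundary_class (c : set (metric M)) :
    set (metric (boundary_space M)) := restrict_metric @` c.

(* pullback to the boundary, in an adapted chart *)
Definition pullback (A : exterior R n.+1) : exterior R n :=
  [ffun S : {set 'I_n} => A (imset (lift ord0) (mem S))].

(* A|_Sigma = B, where forms on Sigma are identified with the forms along Sigma
   annihilated by iota(nu) (on which the pullback is injective) *)
Definition restricts_to (c : set (metric M)) (sigma : metric M -> M -> R)
    (A : dform M) (B : dform (boundary_space M)) : Prop :=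
  forall g a p, c g -> dom (c := boundary_space M) a p ->
    int_nu sigma A g a p = 0 /\
    pullback (A g a p) = B (restrict_metric g) a p.

(* F|_Sigma = G, for F along Sigma of the form (0, A, 0, phi) with A and phi
   annihilated by iota(nu) *)
Definition tractor_restricts_to (c : set (metric M))
    (sigma : metric M -> M -> R) (F : tractor M)
    (G : tractor (boundary_space M)) : Prop :=
  [/\ forall g a p, c g -> dom (c := boundary_space M) a p ->
        north F g a p = 0 /\ east F g a p = 0,
      forall g a p, boundary_class c g -> dom (c := boundary_space M) a p ->
        north G g a p = 0 /\ east G g a p = 0,
      restricts_to c sigma (west F) (west G) &
      restricts_to c sigma (south F) (south G)].

Definition proca_form (sigma : metric M -> M -> R) (k : nat) (w0 : R) (l : nat)
    (A0 : dform M) : dform M :=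
  let kr : R := k%:R in let nr : R := n%:R in
  let T := tilde_iota_eps sigma k%:Z (w0 + kr) in
  let factor (j : nat) (A : dform M) : dform M :=
    (j%:R * (nr + 2 * w0 - j%:R))^-1 *:
      (T A - ((w0 + kr - j%:R) * (nr + w0 - kr - j%:R)) *: A) in
  ((w0 + kr) * (nr + w0 - kr))^-1 *: T (foldr factor A0 (iota 1 l)).

(* the finite orders l covered: l = h0 - 2 if h0 is one of 2, 3, ..., and every
   l otherwise (order oo) *)
Definition proca_order (h0 : R) (l : nat) : Prop :=
  h0 = l.+2%:R \/ (forall j : nat, h0 <> j.+2%:R).

End PoincareEinstein.

(* Main.v *)
(* Put T = iota~ eps~.  Multiplication by sigma intertwines the operators T of
   consecutive weights, and iota~ iota~ = 0.  Let C be a form with iota~ C = 0,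
   let phi be the multiple of delta C that makes (0, C, 0, phi) a western
   insertion, and let w and X be the two factors of the boundary eigenvalue of T
   (in the theorem w = w0 + k and X = n + w0 - k).  By the Einstein equation,
   y (0, C, 0, phi) = (0, C', 0, phi') with sigma C' = (T - w X) C, and C', phi'
   are again of this kind, with w and X lowered by one.  Starting from T A0 and
   iterating, one gets smooth C_j with
     sigma^(l+1) C_(l+1) = prod_(j = 0..l) (T - (w - j) (X - j)) T A0.
   Since (w X - (w - j) (X - j)) = j (n + 2 w0 - j), the product defining the
   solution A consists, up to a constant, of the factors with j >= 1, and the
   factor with j = 0 is what y contributes: sigma y A = const sigma^(l+1) C_(l+1).
   Identities may be divided by sigma because its zero set is nowhere dense.

   Along the boundary T is multiplication by w X on forms annihilated by
   iota(nu), so every normalised factor acts as the identity there, and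
   delta_Sigma (A|Sigma) = (delta A + phi)|Sigma because the boundary is totally
   umbilic with iota(nu) A = - sigma phi; this identifies the southern slots. *)

From HB Require Import structures.
From mathcomp Require Import ring lra.
Require Import Defs.

Set Implicit Arguments.
Unset Strict Implicit.
Unset Printing Implicit Defensive.

Local Open Scope classical_set_scope.
Local Open Scope ring_scope.

(** * Germs of smooth functions in a chart *)

(** The weights fall at every step, and the number dividing delta C in a western insertion may reach
    zero, so the southern slot cannot always be recovered from C by division. It is therefore
    carried along as a second field phi, tied to C by two equations: iota(nu) C + sigma phi = 0, and
    delta C plus a weight-dependent multiple of phi equal to 0. Together they imply iota~ C = 0 and
    they make sense for every weight. The quotient C' is not obtained by dividing either: the slots
    of y are explicit smooth expressions, and cancelling sigma only transfers properties (degree,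
    change of chart, weight, the two equations) from sigma C' to C'. The Einstein equation, given in
    the interior, reaches the boundary in the same way. The computations take place in one scale and
    one chart, where tractors are just slots; invariance under change of chart and scale is proved
    separately. Near the boundary charts are half-spaces, so derivatives are one-sided there and are
    computed from extensions to open sets of R^m. *)

Lemma near_eq_differentiable {R : numFieldType} {V W : normedModType R}
    (F G : V -> W) (x : V) :
  {near x, F =1 G} -> differentiable F x -> differentiable G x.
Proof.
move=> FG dF; have Fx : F x = G x by apply: nbhs_singleton FG.
have dc : continuous ('d F x) by apply: diff_continuous.
suff GE : G \o shift x = cst (G x) + 'd F x +o_ 0 id.
  apply/diff_locallyP; rewrite (diff_unique dc GE); split => //.
apply/eqaddoP => e e0.
have /eqaddoP /(_ e e0) H := diff_locally dF.
have : \forall y \near (0 : V), F (y + x) = G (y + x).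
  by have := FG; rewrite (near_shift 0 x) /= subr0.
apply: filterS2 H => y; rewrite -Fx /= => H FGy.
by move: H; rewrite !fctE /= -FGy.
Qed.

(** * Smooth functions on open sets of R^m, up to the symmetry of second derivatives *)

Section SmoothOpen.
Context {R : realType} {m : nat}.
Implicit Types (V U : set 'rV[R]_m) (F G : 'rV[R]_m -> R) (x : 'rV[R]_m).

Local Notation e_ i := (delta_mx ord0 i : 'rV[R]_m).

Lemma eq_open_near V F G x : open V -> V x -> (forall y, V y -> F y = G y) ->
  {near x, F =1 G}.
Proof. by move=> oV Vx FG; apply: filterS (open_nbhs_nbhs (conj oV Vx)). Qed.

(** Differentiability of finite order, peeled one derivative at a time. The Leibniz rule and the
    rule for reciprocals go through by induction on [N], which the quantification over words of
    directions in [smooth_open] does not offer. *)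
Fixpoint C_n (N : nat) V F : Prop :=
  (forall x, V x -> differentiable F x) /\
  if N is N'.+1 then forall i, C_n N' V ('D_(e_ i) F) else True.

(** [foldr] differentiates first in the last direction of a word, so the words are built and peeled
    from the right. *)
Lemma smooth_openP V F : smooth_open V F <-> forall N, C_n N V F.
Proof.
split=> [H N|H s x Vx].
  have : forall s : seq 'I_m, (size s <= N)%N -> forall x, V x -> differentiable
      (foldr (fun i (G : 'rV[R]_m -> R) => 'D_(e_ i) G) F s) x.
    by move=> s _ x Vx; exact: H.
  elim: N F {H} => [|N IH] F H /=; split => //; first exact: (H [::]).
  - exact: (H [::]).
  - move=> i; apply: IH => s sN x Vx.
    by have := H (rcons s i); rewrite size_rcons foldr_rcons; apply.
move: (H (size s)); elim/last_ind: s F {H} => [|s i IH] F /=.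
  by case=> H _; exact: H.
by rewrite size_rcons foldr_rcons => -[_ /(_ i)] /IH.
Qed.

Lemma eq_C_n N V F G : open V -> (forall y, V y -> F y = G y) ->
  C_n N V F -> C_n N V G.
Proof.
move=> oV; elim: N F G => [|N IH] F G FG /= [dF H]; split => //.
- move=> x Vx; apply: near_eq_differentiable (dF x Vx); exact: eq_open_near FG.
- move=> x Vx; apply: near_eq_differentiable (dF x Vx); exact: eq_open_near FG.
- move=> i; apply: IH (H i) => y Vy.
  apply: near_eq_derive; exact: eq_open_near FG.
Qed.

Lemma C_n_sub N V U F : (forall x, U x -> V x) -> C_n N V F -> C_n N U F.
Proof.
move=> UV; elim: N F => [|N IH] F /= [dF H]; split => //.
- by move=> x /UV /dF.
- by move=> x /UV /dF.
- by move=> i; exact: IH.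
Qed.

Lemma C_nW N V F : C_n N.+1 V F -> C_n N V F.
Proof.
by elim: N F => [|N IH] F /= [dF H]; split => // i; exact: IH (H i).
Qed.

Lemma C_n_cst N V (k : R) : open V -> C_n N V (cst k).
Proof.
move=> oV; elim: N k => [|N IH] k /=; split => // i.
by apply: eq_C_n (IH 0) => // y Vy; rewrite derive_cst.
Qed.

Lemma C_nD N V F G : open V -> C_n N V F -> C_n N V G -> C_n N V (F \+ G).
Proof.
move=> oV; elim: N F G => [|N IH] F G /= [dF HF] [dG HG]; split => //.
- by move=> x Vx; apply: differentiableD; [exact: dF|exact: dG].
- by move=> x Vx; apply: differentiableD; [exact: dF|exact: dG].
- move=> i; apply: eq_C_n (IH _ _ (HF i) (HG i)) => // y Vy.
  by rewrite deriveD//; apply: diff_derivable; [exact: dF|exact: dG].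
Qed.

Lemma C_nM N V F G : open V -> C_n N V F -> C_n N V G -> C_n N V (F \* G).
Proof.
move=> oV; elim: N F G => [|N IH] F G.
  by move=> [dF _] [dG _]; split=> // x Vx; apply: differentiableM; [exact: dF|exact: dG].
move=> hF hG; have [dF HF] := hF; have [dG HG] := hG; split.
  by move=> x Vx; apply: differentiableM; [exact: dF|exact: dG].
move=> i; apply: (@eq_C_n _ _ ((F \* 'D_(e_ i) G) \+ (G \* 'D_(e_ i) F))) => //.
  move=> y Vy; rewrite deriveM//; apply: diff_derivable; [exact: dF|exact: dG].
by apply: C_nD => //; apply: IH => //; (exact: C_nW || exact: HF || exact: HG).
Qed.

Lemma C_nV N V F : open V -> (forall x, V x -> F x != 0) ->
  C_n N V F -> C_n N V (fun x => (F x)^-1).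
Proof.
move=> oV F0; elim: N F F0 => [|N IH] F F0.
  by move=> [dF _]; split=> // x Vx; apply: differentiableV; [exact: dF|exact: F0].
move=> hF; have [dF HF] := hF; split.
  by move=> x Vx; apply: differentiableV; [exact: dF|exact: F0].
move=> i; have HV := IH _ F0 (C_nW hF).
apply: (@eq_C_n _ _ (cst (- 1) \* (((fun x => (F x)^-1) \* (fun x => (F x)^-1)) \* 'D_(e_ i) F))) => //.
  move=> y Vy; rewrite (deriveV (F0 _ Vy))/=; last exact/diff_derivable/dF.
  by rewrite mulN1r scaleNr expr2 invfM.
apply: C_nM => //; first exact: C_n_cst.
by apply: C_nM => //; [exact: C_nM | exact: HF].
Qed.

Lemma smooth_open_differentiable V F x : smooth_open V F -> V x -> differentiable F x.
Proof. by move=> /(_ [::]); apply. Qed.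

Lemma smooth_open_derive V F i : smooth_open V F -> smooth_open V ('D_(e_ i) F).
Proof. by move=> /smooth_openP H; apply/smooth_openP => N; exact: (H N.+1).2. Qed.

Lemma normr_delta_mx i : `|e_ i| <= 1.
Proof.
rewrite [leLHS]/Num.Def.normr/= mx_normrE.
by apply: bigmax_le => // -[a b] _ /=; rewrite mxE; case: (_ && _); rewrite ?normr1 ?normr0.
Qed.

(** The mean value theorem in direction [e_ i] turns the second difference into a difference of
    first derivatives at two points, and the differentiability of ['D_(e_ i) F] at [x] evaluates
    that. The second difference is symmetric in [i] and [j] while the derivative approximated is not
    visibly so: this is the source of Schwarz's theorem. *)
Lemma second_difference V F i j x (e : R) : open V -> smooth_open V F -> V x -> 0 < e ->
  \forall h \near (0 : R)^'+,
  `|F (x + h *: e_ i + h *: e_ j) - F (x + h *: e_ i)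
      - (F (x + h *: e_ j) - F x) - h ^+ 2 * 'D_(e_ j) ('D_(e_ i) F) x|
   <= e * h ^+ 2.
Proof.
move=> oV sF Vx e0.
have sG := smooth_open_derive i sF.
have dG := smooth_open_differentiable sG Vx.
(* One third, because the two remainders are controlled by vectors of norm at most [h + h] and
   [h]. *)
have e3 : 0 < e / 3 by apply: divr_gt0.
have := diff_locally dG => /eqaddoP /(_ _ e3).
rewrite nearE => /nbhs_normP -[/= r r0 Hr].
have := open_nbhs_nbhs (conj oV Vx) => /nbhs_normP -[/= r' r'0 Hr'].
have HG (v : 'rV[R]_m) : `|v| < r -> 
   `|'D_(e_ i) F (v + x) - ('D_(e_ i) F x + 'd ('D_(e_ i) F) x v)| <= e / 3 * `|v|.
  move=> vr; apply: (Hr v); rewrite /ball_/= sub0r normrN //.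
have HV (v : 'rV[R]_m) : `|v| < r' -> V (x + v).
  by move=> vr; apply: Hr'; rewrite /ball_ /= opprD addrA subrr sub0r normrN.
near=> h.
have h0 : 0 < h by near: h; exact: nbhs_right_gt.
have hr : h + h < Num.min r r'.
  have : h < (Num.min r r') / 2.
    near: h; apply: nbhs_right_lt; apply: divr_gt0 => //.
    by rewrite lt_min r0 r'0.
  by rewrite ltr_pdivlMr // mulr_natr mulr2n.
move: hr; rewrite lt_min => /andP[hr hr'].
have nrm (s t : R) : 0 <= s <= h -> 0 <= t <= h ->
    `|s *: e_ i + t *: e_ j| <= s + t.
  move=> /andP[s0 sh] /andP[t0 th]; apply: (le_trans (ler_normD _ _)).
  rewrite !normrZ !ger0_norm //; apply: lerD; rewrite ler_piMr //; exact: normr_delta_mx.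
have nrm' (s t : R) : 0 <= s <= h -> 0 <= t <= h ->
    `|s *: e_ i + t *: e_ j| <= h + h.
  move=> s0 t0; apply: (le_trans (nrm _ _ s0 t0)).
  by case/andP: s0 => _ s0; case/andP: t0 => _ t0; exact: lerD.
pose line t s : 'rV[R]_m := s *: e_ i + (x + t *: e_ j).
have hh : 0 <= h <= h by apply/andP; split; [exact: ltW|].
have h00 : 0 <= (0 : R) <= h by apply/andP; split; [|exact: ltW].
(* The increment of [F] between two parallel lines in direction [e_ i], at distance [h] in direction
   [e_ j]; its own increment over [[0, h]] is the second difference. *)
pose phi s := F (line h s) - F (line 0 s).
have Vline t s : 0 <= s <= h -> 0 <= t <= h -> V (line t s).
  move=> s0 t0; rewrite /line addrCA; apply: HV.
  exact: le_lt_trans (nrm' _ _ s0 t0) hr'.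
have dline t s : 0 <= s <= h -> 0 <= t <= h ->
    is_derive s 1 (F \o line t) ('D_(e_ i) F (line t s)).
  move=> s0 t0; have dF := smooth_open_differentiable sF (Vline _ _ s0 t0).
  have dl : is_diff s (line t) ( *:%R^~ (e_ i)).
    have : is_diff s (( *:%R^~ (e_ i)) + cst (x + t *: e_ j)) ( *:%R^~ (e_ i) + 0 ).
      exact: is_diffD.
    by rewrite addr0.
  have dc : differentiable (F \o line t) s by apply: differentiable_comp.
  apply: DeriveDef; first exact: diff_derivable.
  rewrite deriveE // diff_comp //= diff_val /= scale1r deriveE //.
have dphi s : 0 <= s <= h ->
    is_derive s 1 phi ('D_(e_ i) F (line h s) - 'D_(e_ i) F (line 0 s)).
  by move=> s0; have := is_deriveB (dline h s s0 hh) (dline 0 s s0 h00); apply.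
have [| |c] := @MVT R phi (fun s => 'D_(e_ i) F (line h s) - 'D_(e_ i) F (line 0 s)) 0 h h0.
  by move=> s; rewrite in_itv /= => /andP[s0 sh]; apply: dphi; rewrite !ltW.
  apply: derivable_within_continuous => s; rewrite in_itv /= => sh.
  by have [] := dphi s sh.
rewrite in_itv /= => /andP[c0 ch].
have chh : 0 <= c <= h by rewrite !ltW.
rewrite /phi /line !scale0r !add0r !addr0 subr0.
rewrite [h *: e_ i + (x + h *: e_ j)]addrCA [x + (_ + _)]addrA [h *: e_ i + x]addrC => ->.
rewrite [c *: e_ i + (x + _)]addrCA addrC [c *: e_ i + x]addrC.
have cr (t : R) : 0 <= t <= h -> `|c *: e_ i + t *: e_ j| < r.
  move=> t0; exact: le_lt_trans (nrm' _ _ chh t0) hr.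
have := HG _ (cr _ hh); have := HG _ (cr 0 h00).
rewrite scale0r addr0 ![_ + x]addrC.
set g1 := 'D_(e_ i) F _; set g0 := 'D_(e_ i) F x; set d1 := 'd _ x _.
set g2 := 'D_(e_ i) F _; set d2 := 'd _ x _ => H1 H2.
have -> : 'D_(e_ j) ('D_(e_ i) F) x = h^-1 * (d2 - d1).
  have -> : d2 - d1 = h * 'd ('D_(e_ i) F) x (e_ j).
    rewrite /d2 /d1 linearD /= addrAC subrr add0r. by rewrite [X in X = _]linearZ.
  by rewrite deriveE // mulrA mulVf ?mul1r// gt_eqF.
rewrite addrC.
have -> : - (h ^+ 2 * (h^-1 * (d2 - d1))) + (g2 - g1) * h =
  h * ((g2 - (g0 + d2)) - (g1 - (g0 + d1))).
  have h0' : h != 0 by rewrite gt_eqF.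
  by field.
rewrite normrM (gtr0_norm h0) expr2 mulrCA ler_pM2l //.
apply: (le_trans (ler_normB _ _)); apply: (le_trans (lerD H2 H1)).
rewrite -mulrDr.
have : `|c *: e_ i + h *: e_ j| <= h + h by exact: nrm'.
have : `|c *: e_ i| <= h.
  have := nrm _ _ chh h00; rewrite scale0r !addr0 => /le_trans; apply; exact: ltW.
set u := `|_|; set v := `|_| => Hu Hv.
have : v + u <= h *+ 3 by rewrite addrC !mulrS addrA; lra.
move=> /(ler_wpM2l (ltW e3)) /le_trans; apply.
by rewrite -[h *+ 3]mulr_natl mulrA divfK.
Unshelve. all: by end_near. Qed.

(** Both mixed derivatives times [h ^+ 2] approximate the same second difference. With errors of
    [d / 3] each, their distance [d] would be at most [2 d / 3]. *)
Lemma smooth_open_schwarz V F i j x : open V -> smooth_open V F -> V x ->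
  'D_(e_ j) ('D_(e_ i) F) x = 'D_(e_ i) ('D_(e_ j) F) x.
Proof.
move=> oV sF Vx; apply/eqP; rewrite -subr_eq0 -normr_eq0; apply/negP => /negP n0.
set d := `|_| in n0.
have d0 : 0 < d by rewrite lt_def n0 /d normr_ge0.
have d3 : 0 < d / 3 by apply: divr_gt0.
have H1 := second_difference i j oV sF Vx d3.
have H2 := second_difference j i oV sF Vx d3.
have [h /= [h0 [{}H1 {}H2]]] := filter_ex (filterI (nbhs_right_gt (0 : R)) (filterI H1 H2)).
have h2 : 0 < h ^+ 2 by rewrite exprn_gt0.
have : h ^+ 2 * d <= d / 3 * h ^+ 2 + d / 3 * h ^+ 2.
  apply: le_trans (lerD H1 H2).
  rewrite /d -{1}[h ^+ 2]gtr0_norm // -normrM.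
  apply: le_trans (ler_normB _ _).
  rewrite [x + _ + h *: e_ i]addrAC; set A := F _; set B := F _; set C := F _.
  rewrite le_eqVlt; apply/orP; left; apply/eqP.
  rewrite -normrN; congr `|_|.
  move: A B C (F x) ('D_(e_ j) _ x) ('D_(e_ i) _ x) => A B C Z P Q; ring.
rewrite -mulrDl mulrC ler_pM2r // => H.
by move: H d0; clear; move: d => d; lra.
Qed.

End SmoothOpen.

(** * Functions on the manifold near a point of a chart *)

Section Germs.
Context {R : realType} {m : nat} {X : chart_space R m}.
Implicit Types (a b : chart X) (p q : X) (f g : X -> R) (i j : 'I_m).

(* [P] holds on a neighbourhood of [p] in [dom a], expressed by coordinates since
   one-sided neighbourhoods are needed at the boundary. *)
Definition near_pt a p (P : X -> Prop) : Prop :=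
  \forall y \near crd a p, forall q, dom a q -> crd a q = y -> P q.

Lemma near_ptT a p (P : X -> Prop) : (forall q, dom a q -> P q) -> near_pt a p P.
Proof. by move=> H; apply: (@filterE _ (nbhs (crd a p))) => y q /H. Qed.

Lemma near_ptS a p (P Q : X -> Prop) : (forall q, dom a q -> P q -> Q q) ->
  near_pt a p P -> near_pt a p Q.
Proof.
by move=> PQ; apply: (@filterS _ (nbhs (crd a p))) => y H q dq yq; apply: PQ => //; exact: H.
Qed.

Lemma near_pt_open a p (V : set 'rV[R]_m) (P : X -> Prop) : open V -> V (crd a p) ->
  (forall q, dom a q -> V (crd a q) -> P q) -> near_pt a p P.
Proof.
move=> oV Vp H; apply: (@filterS _ (nbhs (crd a p)) _ _ _ _ (open_nbhs_nbhs (conj oV Vp))).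
by move=> y Vy q dq yq; apply: H => //; rewrite yq.
Qed.

Lemma near_ptS2 a p (P Q S : X -> Prop) : (forall q, dom a q -> P q -> Q q -> S q) ->
  near_pt a p P -> near_pt a p Q -> near_pt a p S.
Proof.
by move=> PQ; apply: (@filterS2 _ (nbhs (crd a p))) => y H H' q dq yq; apply: PQ => //; [exact: H|exact: H'].
Qed.

Lemma near_pt_at a p (P : X -> Prop) : dom a p -> near_pt a p P -> P p.
Proof. by move=> dp /nbhs_singleton; apply. Qed.

Lemma near_pt_join a p (P : X -> Prop) : near_pt a p P ->
  near_pt a p (fun q => near_pt a q P).
Proof. by move=> /nbhs_interior; apply: (@filterS _ (nbhs (crd a p))) => y H q dq yq; rewrite /near_pt yq. Qed.

(* [f] extends in the chart to a function differentiable at, resp. smooth near, [p]. *)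
Definition dfr a p f : Prop := exists2 F : 'rV[R]_m -> R,
  differentiable F (crd a p) & near_pt a p (fun q => F (crd a q) = f q).

Definition sm a p f : Prop := exists (V : set 'rV[R]_m) (F : 'rV[R]_m -> R),
  [/\ open V, V (crd a p), smooth_open V F &
      forall q, dom a q -> V (crd a q) -> F (crd a q) = f q].

Lemma sm_dfr a p f : sm a p f -> dfr a p f.
Proof.
move=> [V [F [oV Vp sF Ff]]]; exists F; first exact: smooth_open_differentiable sF Vp.
exact: near_pt_open Ff.
Qed.

Lemma sm_near a p f : sm a p f -> near_pt a p (fun q => sm a q f).
Proof.
move=> [V [F [oV Vp sF Ff]]].
by apply: (near_pt_open oV Vp) => q dq Vq; exists V, F.
Qed.

Lemma dfr_near_eq a p f g : near_pt a p (fun q => f q = g q) -> dfr a p f -> dfr a p g.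
Proof.
by move=> fg [F dF Ff]; exists F => //; apply: near_ptS2 fg Ff => q _ -> .
Qed.

Lemma sm_near_eq a p f g : near_pt a p (fun q => f q = g q) -> sm a p f -> sm a p g.
Proof.
rewrite /near_pt -[X in X -> _]/(nbhs _ _) nbhsE => -[U [oU Up] HU] [V [F [oV Vp sF Ff]]].
exists (U `&` V), F; split => //; first exact: openI.
  by move=> s x [_ Vx]; exact: sF.
by move=> q dq [Uq Vq]; rewrite Ff //; apply: (HU (crd a q)).
Qed.

Lemma sm_eq a p f g : (forall q, dom a q -> f q = g q) -> sm a p f -> sm a p g.
Proof. by move=> fg; apply: sm_near_eq; exact: near_ptT. Qed.

Lemma sm_cst a p (k : R) : sm a p (fun=> k).
Proof.
exists setT, (cst k); split => //; first exact: openT.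
by apply/smooth_openP => N; apply: C_n_cst; exact: openT.
Qed.

Lemma sm_op2 (op : R -> R -> R) a p f g :
  (forall (V : set 'rV[R]_m) F G N, open V -> C_n N V F -> C_n N V G ->
     C_n N V (fun x => op (F x) (G x))) ->
  sm a p f -> sm a p g -> sm a p (fun q => op (f q) (g q)).
Proof.
move=> H [V [F [oV Vp sF Ff]]] [U [G [oU Up sG Gg]]].
exists (V `&` U), (fun x => op (F x) (G x)); split => //; first exact: openI.
  apply/smooth_openP => N; apply: H; first exact: openI.
    by move/smooth_openP: sF => /(_ N); apply: C_n_sub => x [].
  by move/smooth_openP: sG => /(_ N); apply: C_n_sub => x [].
by move=> q dq [Vq Uq]; rewrite Ff // Gg.
Qed.

Lemma smD a p f g : sm a p f -> sm a p g -> sm a p (fun q => f q + g q).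
Proof. by apply: sm_op2 => V F G N; exact: C_nD. Qed.

Lemma smM a p f g : sm a p f -> sm a p g -> sm a p (fun q => f q * g q).
Proof. by apply: sm_op2 => V F G N; exact: C_nM. Qed.

Lemma smN a p f : sm a p f -> sm a p (fun q => - f q).
Proof.
move=> sf; apply: (@sm_eq a p (fun q => -1 * f q)); first by move=> q _; rewrite mulN1r.
by apply: smM => //; exact: sm_cst.
Qed.

Lemma smB a p f g : sm a p f -> sm a p g -> sm a p (fun q => f q - g q).
Proof. by move=> sf sg; apply: smD => //; exact: smN. Qed.

Lemma smV a p f : dom a p -> f p != 0 -> sm a p f -> sm a p (fun q => (f q)^-1).
Proof.
move=> dp f0 [V [F [oV Vp sF Ff]]].
have Fp : F (crd a p) != 0 by rewrite Ff.
(* The reciprocal is taken where the extension itself is nonzero, a smaller open set that still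
   contains the point. *)
have oU : open (V `&` [set y | F y != 0]).
  rewrite openE => y [Vy Fy] /=.
  have Fc : {for y, continuous F}.
    by apply: differentiable_continuous; exact: smooth_open_differentiable sF Vy.
  apply: filterI; first exact: (open_nbhs_nbhs (conj oV Vy)).
  have F0 : nbhs (F y) [set z : R | z != 0].
    by apply: open_nbhs_nbhs; split => //; exact: open_neq.
  exact: (Fc _ F0).
exists (V `&` [set y | F y != 0]), (fun y => (F y)^-1); split => //.
  apply/smooth_openP => N; apply: C_nV => //; first by move=> x [].
  by move/smooth_openP: sF => /(_ N); apply: C_n_sub => x [].
by move=> q dq [Vq _]; rewrite Ff.
Qed.

Lemma sm_sum (I : Type) (r : seq I) (P : pred I) (f : I -> X -> R) a p :
  (forall k, P k -> sm a p (f k)) -> sm a p (fun q => \sum_(k <- r | P k) f k q).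
Proof.
move=> H; elim: r => [|k r IH].
  by apply: sm_eq (sm_cst a p 0) => q _; rewrite big_nil.
have [Pi|Pi] := boolP (P k); last first.
  by apply: sm_eq IH => q _; rewrite big_cons (negbTE Pi).
by apply: sm_eq (smD (H _ Pi) IH) => q _; rewrite big_cons Pi.
Qed.

Lemma sm_prod (I : Type) (r : seq I) (P : pred I) (f : I -> X -> R) a p :
  (forall k, P k -> sm a p (f k)) -> sm a p (fun q => \prod_(k <- r | P k) f k q).
Proof.
move=> H; elim: r => [|k r IH].
  by apply: sm_eq (sm_cst a p 1) => q _; rewrite big_nil.
have [Pi|Pi] := boolP (P k); last first.
  by apply: sm_eq IH => q _; rewrite big_cons (negbTE Pi).
by apply: sm_eq (smM (H _ Pi) IH) => q _; rewrite big_cons Pi.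
Qed.

Lemma smX a p f N : sm a p f -> sm a p (fun q => f q ^+ N).
Proof.
move=> sf; elim: N => [|N IH]; first by apply: sm_eq (sm_cst a p 1) => q _; rewrite expr0.
by apply: sm_eq (smM sf IH) => q _; rewrite exprS.
Qed.

Lemma sm_det (k : nat) a p (A : X -> 'M[R]_k) : (forall s t, sm a p (fun q => A q s t)) ->
  sm a p (fun q => \det (A q)).
Proof.
move=> H; apply: sm_sum => s _; apply: smM; first exact: sm_cst.
by apply: sm_prod.
Qed.

Lemma dfr_cst a p (k : R) : dfr a p (fun=> k).
Proof. exact/sm_dfr/sm_cst. Qed.

Lemma dfrD a p f g : dfr a p f -> dfr a p g -> dfr a p (fun q => f q + g q).
Proof.
move=> [F dF Ff] [G dG Gg]; exists (F \+ G); first exact: differentiableD.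
by apply: near_ptS2 Ff Gg => q _ /= -> ->.
Qed.

Lemma dfrM a p f g : dfr a p f -> dfr a p g -> dfr a p (fun q => f q * g q).
Proof.
move=> [F dF Ff] [G dG Gg]; exists (F \* G); first exact: differentiableM.
by apply: near_ptS2 Ff Gg => q _ /= -> ->.
Qed.

Lemma dfrN a p f : dfr a p f -> dfr a p (fun q => - f q).
Proof.
move=> [F dF Ff]; exists (\- F); first exact: differentiableN.
by apply: near_ptS Ff => q _ /= ->.
Qed.

Lemma dfr_sum (I : Type) (r : seq I) (P : pred I) (f : I -> X -> R) a p :
  (forall k, P k -> dfr a p (f k)) -> dfr a p (fun q => \sum_(k <- r | P k) f k q).
Proof.
move=> H; elim: r => [|k r IH].
  by apply: dfr_near_eq (dfr_cst a p 0); apply: near_ptT => q _; rewrite big_nil.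
have [Pi|Pi] := boolP (P k); last first.
  by apply: dfr_near_eq IH; apply: near_ptT => q _; rewrite big_cons (negbTE Pi).
by apply: dfr_near_eq (dfrD (H _ Pi) IH); apply: near_ptT => q _; rewrite big_cons Pi.
Qed.

End Germs.

(** * Partial derivatives at points of a half-space chart, and the chain rule *)

Section Pd.
Context {R : realType} {n : nat} {M : chart_space R n.+1}.
Hypothesis hM : manifold_with_boundary M.
Implicit Types (a b : chart M) (p q : M) (f g : M -> R) (i j : 'I_n.+1).
Local Notation e_ i := (delta_mx ord0 i : 'rV[R]_n.+1).

(** Increasing a coordinate never leaves the half-space, not even from a boundary point, and the
    image of a chart is open in the half-space. Hence the points occurring in the one-sided
    quotients of [pd] lie in the chart for small [h]. *)
Lemma near_par a p i (P : M -> Prop) : dom a p -> near_pt a p P ->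
  \forall h \near (0 : R)^'+, let q := par a (crd a p + h *: e_ i) in
    [/\ dom a q, crd a q = crd a p + h *: e_ i & P q].
Proof.
move=> dp nP; have [U [oU UE]] := mfd_image hM a.
have Up : U (crd a p).
  have : (crd a @` dom a) (crd a p) by exists p.
  by rewrite UE => -[].
have lc : {for 0, continuous (fun h : R => crd a p + h *: e_ i)}.
  apply: continuousD; first exact: cst_continuous.
  exact: scalel_continuous.
have l0 : crd a p + 0 *: e_ i = crd a p by rewrite scale0r addr0.
have H1 : \forall h \near (0 : R), U (crd a p + h *: e_ i).
  by apply: lc; rewrite l0; exact: (open_nbhs_nbhs (conj oU Up)).
have H2 : \forall h \near (0 : R), forall q, dom a q -> crd a q = crd a p + h *: e_ i -> P q.
  by have := lc [set y | forall q, dom a q -> crd a q = y -> P q]; rewrite /= l0; apply.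
near=> h; move=> /=; set q := par a _.
have h0 : 0 < h by near: h; exact: nbhs_right_gt.
have Uh : U (crd a p + h *: e_ i) by near: h; exact: cvg_within H1.
have hs : half_space (crd a p + h *: e_ i).
  rewrite /half_space /= !mxE; apply: addr_ge0; first exact: (mfd_half_space hM).
  by apply: mulr_ge0; [exact: ltW|case: (_ && _)].
have [q' dq' q'E] : (crd a @` dom a) (crd a p + h *: e_ i) by rewrite UE.
have qE : q = q' by rewrite /q -q'E (mfd_parK hM).
rewrite qE; split => //.
have : forall q, dom a q -> crd a q = crd a p + h *: e_ i -> P q.
  by near: h; exact: cvg_within H2.
by apply.
Unshelve. all: by end_near. Qed.

Lemma pd_cvg a p i f F : dom a p -> differentiable F (crd a p) ->
  near_pt a p (fun q => F (crd a q) = f q) ->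
  (h^-1 * (f (par a (crd a p + h *: e_ i)) - f p)) @[h --> (0 : R)^'+] -->
    'D_(e_ i) F (crd a p).
Proof.
move=> dp dF Ff.
have /derivableP[/cvg_ex[l /= Hl] _] : derivable F (crd a p) (e_ i) by exact: diff_derivable.
have -> : 'D_(e_ i) F (crd a p) = l by apply: cvg_lim.
have : (h^-1 *: (F (h *: e_ i + crd a p) - F (crd a p))) @[h --> (0 : R)^'+] --> l.
  exact: cvg_dnbhs_at_right Hl.
apply: cvg_trans; apply: near_eq_cvg.
have := near_par i dp Ff; apply: filterS => h [_ qE Fq].
by rewrite -(near_pt_at dp Ff) -Fq qE [crd a p + _]addrC.
Qed.

Lemma pd_val a p i f F : dom a p -> differentiable F (crd a p) ->
  near_pt a p (fun q => F (crd a q) = f q) -> pd a i f p = 'D_(e_ i) F (crd a p).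
Proof. by move=> dp dF Ff; apply: cvg_lim => //; exact: pd_cvg. Qed.

Lemma pd_near_eq a p i f g : dom a p -> near_pt a p (fun q => f q = g q) ->
  pd a i f p = pd a i g p.
Proof.
move=> dp fg; rewrite /pd; congr (lim _).
rewrite eqEsubset; split; apply: near_eq_cvg; have := near_par i dp fg;
  apply: filterS => h [_ _ ->]; by rewrite (near_pt_at dp fg).
Qed.

Lemma pd_eq a p i f g : dom a p -> (forall q, dom a q -> f q = g q) ->
  pd a i f p = pd a i g p.
Proof. by move=> dp fg; apply: pd_near_eq => //; exact: near_ptT. Qed.

Lemma pd_cst a p i (k : R) : dom a p -> pd a i (fun=> k) p = 0.
Proof.
move=> dp; rewrite (@pd_val _ _ _ _ (cst k)) ?derive_cst //.
by apply: near_ptT.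
Qed.

Lemma pdD a p i f g : dom a p -> dfr a p f -> dfr a p g ->
  pd a i (fun q => f q + g q) p = pd a i f p + pd a i g p.
Proof.
move=> dp [F dF Ff] [G dG Gg]; rewrite (pd_val i dp dF Ff) (pd_val i dp dG Gg).
rewrite (@pd_val _ _ _ _ (F \+ G)) ?deriveD //; try exact: diff_derivable.
  exact: differentiableD.
by apply: near_ptS2 Ff Gg => q _ /= -> ->.
Qed.

Lemma pdM a p i f g : dom a p -> dfr a p f -> dfr a p g ->
  pd a i (fun q => f q * g q) p = pd a i f p * g p + f p * pd a i g p.
Proof.
move=> dp [F dF Ff] [G dG Gg]; rewrite (pd_val i dp dF Ff) (pd_val i dp dG Gg).
rewrite (@pd_val _ _ _ _ (F \* G)) ?deriveM //; try exact: diff_derivable.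
- by rewrite (near_pt_at dp Ff) (near_pt_at dp Gg) addrC [g p *: _]mulrC.
- exact: differentiableM.
by apply: near_ptS2 Ff Gg => q _ /= -> ->.
Qed.

Lemma pdN a p i f : dom a p -> dfr a p f -> pd a i (fun q => - f q) p = - pd a i f p.
Proof.
move=> dp [F dF Ff]; rewrite (pd_val i dp dF Ff).
rewrite (@pd_val _ _ _ _ (\- F)) ?deriveN //; try exact: diff_derivable.
  exact: differentiableN.
by apply: near_ptS Ff => q _ /= ->.
Qed.

Lemma pdB a p i f g : dom a p -> dfr a p f -> dfr a p g ->
  pd a i (fun q => f q - g q) p = pd a i f p - pd a i g p.
Proof. by move=> dp df dg; rewrite pdD ?pdN //; exact: dfrN. Qed.

Lemma pdZ a p i (k : R) f : dom a p -> dfr a p f ->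
  pd a i (fun q => k * f q) p = k * pd a i f p.
Proof. by move=> dp df; rewrite pdM ?pd_cst ?mul0r ?add0r //; exact: dfr_cst. Qed.

Lemma pd_sum a p i (I : Type) (r : seq I) (P : pred I) (f : I -> M -> R) : dom a p ->
  (forall k, P k -> dfr a p (f k)) ->
  pd a i (fun q => \sum_(k <- r | P k) f k q) p = \sum_(k <- r | P k) pd a i (f k) p.
Proof.
move=> dp H; elim: r => [|k r IH].
  rewrite big_nil -[RHS](@pd_cst a p i 0) //; apply: pd_eq => // q _; exact: big_nil.
rewrite big_cons; case: ifPn => Pk; rewrite -IH; last first.
  by apply: pd_eq => // q _; rewrite big_cons (negbTE Pk).
rewrite -pdD //; [|exact: H|exact: dfr_sum].
by apply: pd_eq => // q _; rewrite big_cons Pk.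
Qed.

Lemma sm_pd a p i f : dom a p -> sm a p f -> sm a p (pd a i f).
Proof.
move=> dp [V [F [oV Vp sF Ff]]]; exists V, ('D_(e_ i) F); split => //.
  exact: smooth_open_derive.
move=> q dq Vq; rewrite (@pd_val _ _ _ _ F) //.
  exact: smooth_open_differentiable sF Vq.
exact: near_pt_open oV Vq Ff.
Qed.

Lemma pd_comm a p i j f : dom a p -> sm a p f ->
  pd a i (pd a j f) p = pd a j (pd a i f) p.
Proof.
move=> dp [V [F [oV Vp sF Ff]]].
have H k q : dom a q -> V (crd a q) -> pd a k f q = 'D_(e_ k) F (crd a q).
  move=> dq Vq; rewrite (@pd_val _ _ _ _ F) //.
    exact: smooth_open_differentiable sF Vq.
  exact: near_pt_open oV Vq Ff.
have H2 k l : pd a k (pd a l f) p = 'D_(e_ k) ('D_(e_ l) F) (crd a p).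
  rewrite (@pd_val _ _ _ _ ('D_(e_ l) F)) //.
    exact: smooth_open_differentiable (smooth_open_derive l sF) Vp.
  by apply: (near_pt_open oV Vp) => q dq Vq; rewrite H.
by rewrite !H2; exact: smooth_open_schwarz oV sF Vp.
Qed.

Lemma dfr_comp (phi : R -> R) a p f : dom a p -> derivable phi (f p) 1 -> dfr a p f ->
  dfr a p (fun q => phi (f q)).
Proof.
move=> dp dphi [F dF Ff]; exists (phi \o F); last first.
  by apply: near_ptS Ff => q _ /= ->.
by apply: differentiable_comp => //; rewrite (near_pt_at dp Ff); exact/derivable1_diffP.
Qed.

Lemma pd_comp (phi : R -> R) a p i f : dom a p -> derivable phi (f p) 1 -> dfr a p f ->
  pd a i (fun q => phi (f q)) p = 'D_1 phi (f p) * pd a i f p.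
Proof.
move=> dp dphi [F dF Ff].
have fp := near_pt_at dp Ff.
have dphi' : differentiable phi (F (crd a p)) by rewrite fp; exact/derivable1_diffP.
rewrite (pd_val i dp dF Ff) (@pd_val _ _ _ _ (phi \o F)) //.
- have dc : differentiable (phi \o F) (crd a p) by apply: differentiable_comp.
  rewrite deriveE // diff_comp // -fp !deriveE //=.
  by rewrite -[X in 'd phi _ X]mulr1 [LHS]linearZ mulrC.
- by apply: differentiable_comp.
by apply: near_ptS Ff => q _ /= ->.
Qed.

(** [near_pt] speaks of coordinates, whereas [dom b] is open in the manifold; the continuity of
    [par a] translates one into the other. *)
Lemma near_dom a b p : dom a p -> dom b p -> near_pt a p (dom b).
Proof.
move=> dap dbp.
have /subspace_continuousP/(_ (crd a p)) := @mfd_par_continuous _ _ _ hM a.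
move=> /(_ (ex_intro2 _ _ p dap erefl)) /(_ (dom b)).
rewrite /from_subspace (mfd_parK hM) // => /(_ (open_nbhs_nbhs (conj (mfd_open hM b) dbp))).
apply: (@filterS _ (nbhs (crd a p))) => y H q dq yq.
by have := H; rewrite /= -yq (mfd_parK hM) //; apply; exists q.
Qed.

Lemma sm_crd a b p j : dom a p -> dom b p ->
  exists (V : set 'rV[R]_n.+1) F, [/\ open V, V (crd a p), smooth_open V F &
        forall q, dom a q -> dom b q -> V (crd a q) -> F (crd a q) = crd b q ord0 j].
Proof.
move=> dap dbp; have [V [F [oV Vp sF Ff]]] := mfd_transition hM j (conj dap dbp).
by exists V, F; split => // q da db; apply: Ff.
Qed.

(** The atlas provides an extension that agrees with the coordinate on the overlap of the two
    domains only. Shrinking its domain by [near_dom] removes the points of [dom a] outside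
    [dom b]. *)
Lemma sm_crd' a b p j : dom a p -> dom b p -> sm a p (fun q => crd b q ord0 j).
Proof.
move=> dap dbp; have [V [F [oV Vp sF Ff]]] := sm_crd j dap dbp.
have := near_dom dap dbp; rewrite /near_pt -[X in X -> _]/(nbhs _ _) nbhsE => -[U [oU Up] HU].
exists (U `&` V), F; split => //; first exact: openI.
  by move=> s x [_ Vx]; exact: sF.
by move=> q dq [Uq Vq]; apply: Ff => //; apply: (HU (crd a q)).
Qed.

Lemma sm_jacobian a b p i j : dom a p -> dom b p -> sm a p (fun q => jacobian a b q i j).
Proof.
move=> dap dbp; apply: (@sm_eq _ _ _ _ _ (pd a j (fun q => crd b q ord0 i))).
  by move=> q _; rewrite mxE.
by apply: sm_pd => //; exact: sm_crd'.
Qed.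

(** Second derivatives of a transition map commute. This symmetry is what keeps the transformed
    Christoffel symbols torsion-free in [Gam_chart]. *)
Lemma pd_jacobian a b p i j k : dom a p -> dom b p ->
  pd a k (fun q => jacobian a b q i j) p = pd a j (fun q => jacobian a b q i k) p.
Proof.
move=> dap dbp.
have E k' j' : pd a k' (fun q => jacobian a b q i j') p =
    pd a k' (pd a j' (fun q => crd b q ord0 i)) p.
  by apply: pd_eq => // q _; rewrite mxE.
rewrite !E.
by apply: pd_comm => //; exact: sm_crd'.
Qed.

(** The ordinary chain rule is applied to extensions of [f] and of the transition map to open sets,
    since at a boundary point both live on half-spaces only. *)
Lemma dfr_chart a b p f : dom a p -> dom b p -> dfr b p f ->
  dfr a p f /\ forall i, pd a i f p = \sum_j jacobian a b p j i * pd b j f p.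
Proof.
move=> dap dbp [F dF Ff].
have H j : exists Y : 'rV[R]_n.+1 -> R, differentiable Y (crd a p) /\
    near_pt a p (fun q => Y (crd a q) = crd b q ord0 j).
  by have [Y dY HY] := sm_dfr (sm_crd' j dap dbp); exists Y.
have [Y HY] := choice H.
(* The extensions chosen for the single coordinates are assembled into one vector-valued map. *)
pose YY := fun y => \sum_j (Y j y *: e_ j).
have YE y j : YY y ord0 j = Y j y.
  rewrite /YY summxE (bigD1 j) //= !mxE !eqxx mulr1 big1 ?addr0 // => k kj.
  by rewrite !mxE eqxx eq_sym (negbTE kj) mulr0.
have dYY : differentiable YY (crd a p).
  have -> : YY = \sum_j (fun y => Y j y *: e_ j) by rewrite fct_sumE.
  by apply: differentiable_sum => j; apply: differentiableZl; exact: (HY j).1.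
have YYb : near_pt a p (fun q => YY (crd a q) = crd b q).
  have : \forall y \near crd a p, forall j, forall q, dom a q -> crd a q = y ->
      Y j y = crd b q ord0 j.
    apply: (@filter_forall _ _ (fun j y => forall q, dom a q -> crd a q = y ->
      Y j y = crd b q ord0 j) (nbhs (crd a p))) => j.
    apply: (@filterS _ (nbhs (crd a p)) _ _ _ _ (HY j).2).
    by move=> y H1 q dq yq; rewrite -H1 // yq.
  apply: (@filterS _ (nbhs (crd a p))) => y H1 q dq yq.
  by apply/rowP => j; rewrite YE yq (H1 j q).
have YYp : YY (crd a p) = crd b p by exact: near_pt_at YYb.
have dF' : differentiable F (YY (crd a p)) by rewrite YYp.
have dFY : differentiable (F \o YY) (crd a p) by apply: differentiable_comp.
have rep : near_pt a p (fun q => (F \o YY) (crd a q) = f q).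
  have H1 : \forall y \near crd a p, forall q, dom b q -> crd b q = YY y -> F (YY y) = f q.
    have Yc := differentiable_continuous dYY.
    have := Yc [set z | forall q, dom b q -> crd b q = z -> F z = f q]; rewrite /= YYp; apply.
    by apply: (@filterS _ (nbhs (crd b p)) _ _ _ _ Ff) => z H1 q dq zq; rewrite -zq H1.
  have H2 := near_dom dap dbp.
  apply: (@filterS3 _ (nbhs (crd a p)) _ _ _ _ _ _ H1 H2 YYb) => y {}H1 {}H2 H3 q dq yq.
  by rewrite /= yq; apply: H1; [exact: H2|rewrite -yq H3].
split=> [|i]; first by exists (F \o YY).
rewrite (pd_val i dap dFY rep) deriveE // diff_comp //=.
have -> : 'd YY (crd a p) (e_ i) = \sum_j jacobian a b p j i *: e_ j.
  have -> : YY = \sum_j (fun y => Y j y *: e_ j) by rewrite fct_sumE.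
  rewrite -deriveE; last by apply: differentiable_sum => j; apply: differentiableZl; exact: (HY j).1.
  rewrite derive_sum; last first.
    by move=> j; apply: diff_derivable; apply: differentiableZl; exact: (HY j).1.
  apply: eq_bigr => j _; rewrite deriveE; last by apply: differentiableZl; exact: (HY j).1.
  rewrite diffZl; last exact: (HY j).1.
  by rewrite mxE (pd_val i dap (HY j).1 (HY j).2) deriveE //; exact: (HY j).1.
rewrite linear_sum; apply: eq_bigr => j _; rewrite linearZ /= YYp.
by rewrite (pd_val j dbp dF Ff) deriveE.
Qed.

End Pd.

(** * Exterior algebra *)

Section ExteriorAlgebra.
Context {R : realType} {m : nat}.
Implicit Types (A B : exterior R m) (i j e c f : 'I_m) (S T : {set 'I_m}) (u v : 'I_m -> R).

Lemma ext_basis_linear i : linear (ext_basis i : exterior R m -> exterior R m).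
Proof.
move=> k A B; apply/ffunP => S; rewrite !ffunE; case: ifP => _; rewrite /GRing.scale /=.
  by rewrite mulrDr mulrCA.
by rewrite mulr0 addr0.
Qed.
HB.instance Definition _ i := GRing.isLinear.Build R (exterior R m) (exterior R m) _
  (ext_basis i) (ext_basis_linear i).

Lemma int_basis_linear i : linear (int_basis i : exterior R m -> exterior R m).
Proof.
move=> k A B; apply/ffunP => S; rewrite !ffunE; case: ifP => _; rewrite /GRing.scale /=.
  by rewrite mulr0 addr0.
by rewrite mulrDr mulrCA.
Qed.
HB.instance Definition _ i := GRing.isLinear.Build R (exterior R m) (exterior R m) _
  (int_basis i) (int_basis_linear i).

Lemma ext_mul_linear u : linear (ext_mul u : exterior R m -> exterior R m).
Proof.
move=> k A B; rewrite /ext_mul scaler_sumr -big_split; apply: eq_bigr => i _ /=.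
by rewrite linearP scalerDr !scalerA mulrC.
Qed.
HB.instance Definition _ u := GRing.isLinear.Build R (exterior R m) (exterior R m) _
  (ext_mul u) (ext_mul_linear u).

Definition int_vec v A : exterior R m := \sum_i v i *: int_basis i A.

Lemma int_vec_linear v : linear (int_vec v).
Proof.
move=> k A B; rewrite /int_vec scaler_sumr -big_split; apply: eq_bigr => i _ /=.
by rewrite linearP scalerDr !scalerA mulrC.
Qed.
HB.instance Definition _ v := GRing.isLinear.Build R (exterior R m) (exterior R m) _
  (int_vec v) (int_vec_linear v).

(** The endomorphism sending dx^c to the sum of [C c e] dx^e, extended to forms as a derivation. The
    connection term of nabla, the Schouten action, the Hessian terms and the derivative of a
    pullback all have this shape. *)
Definition derv (C : 'I_m -> 'I_m -> R) A : exterior R m :=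
  \sum_e \sum_c C c e *: ext_basis e (int_basis c A).

Lemma derv_linear C : linear (derv C).
Proof.
move=> k A B; rewrite /derv scaler_sumr -big_split; apply: eq_bigr => e _ /=.
rewrite scaler_sumr -big_split; apply: eq_bigr => c _ /=.
by rewrite (linearP (int_basis c)) (linearP (ext_basis e)) scalerDr !scalerA mulrC.
Qed.
HB.instance Definition _ C := GRing.isLinear.Build R (exterior R m) (exterior R m) _
  (derv C) (derv_linear C).

Lemma ext_basisZ i k A : ext_basis i (k *: A) = k *: ext_basis i A.
Proof. exact: linearZ. Qed.
Lemma int_basisZ i k A : int_basis i (k *: A) = k *: int_basis i A.
Proof. exact: linearZ. Qed.
Lemma ext_mulZ u k A : ext_mul u (k *: A) = k *: ext_mul u A.
Proof. exact: linearZ. Qed.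
Lemma int_vecZ u k A : int_vec u (k *: A) = k *: int_vec u A.
Proof. exact: linearZ. Qed.
Lemma dervZ C k A : derv C (k *: A) = k *: derv C A.
Proof. exact: linearZ. Qed.

Lemma int_mulE (g : 'M[R]_m) u A :
  int_mul g u A = int_vec (fun i => \sum_j invmx g i j * u j) A.
Proof. by apply: eq_bigr => i _; rewrite scaler_suml. Qed.

Lemma int_mul_linear (g : 'M[R]_m) u : linear (int_mul g u : exterior R m -> exterior R m).
Proof. by move=> k A B; rewrite !int_mulE linearP. Qed.
HB.instance Definition _ (g : 'M[R]_m) u := GRing.isLinear.Build R (exterior R m) (exterior R m) _
  (int_mul g u) (int_mul_linear g u).

Lemma int_mulZ (g : 'M[R]_m) u k A : int_mul g u (k *: A) = k *: int_mul g u A.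
Proof. exact: linearZ. Qed.

Lemma eq_ext_mul u v A : u =1 v -> ext_mul u A = ext_mul v A.
Proof. by move=> uv; apply: eq_bigr => i _; rewrite uv. Qed.

Lemma eq_int_mul (g : 'M[R]_m) u v A : u =1 v -> int_mul g u A = int_mul g v A.
Proof. by move=> uv; apply: eq_bigr => i _; apply: eq_bigr => j _; rewrite uv. Qed.

Lemma int_mulDl (g : 'M[R]_m) u v A :
  int_mul g (fun i => u i + v i) A = int_mul g u A + int_mul g v A.
Proof.
rewrite /int_mul -big_split; apply: eq_bigr => i _ /=; rewrite -big_split.
by apply: eq_bigr => j _; rewrite mulrDr scalerDl.
Qed.

Lemma int_mulZl (g : 'M[R]_m) k u A : int_mul g (fun i => k * u i) A = k *: int_mul g u A.
Proof.
rewrite /int_mul scaler_sumr; apply: eq_bigr => i _ /=; rewrite scaler_sumr.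
by apply: eq_bigr => j _; rewrite scalerA mulrCA.
Qed.

Lemma eq_int_vec u v A : u =1 v -> int_vec u A = int_vec v A.
Proof. by move=> uv; apply: eq_bigr => i _; rewrite uv. Qed.

Lemma eq_derv C D A : (forall c e, C c e = D c e) -> derv C A = derv D A.
Proof. by move=> CD; apply: eq_bigr => e _; apply: eq_bigr => c _; rewrite CD. Qed.

Lemma ext_mulDl u v A : ext_mul (fun i => u i + v i) A = ext_mul u A + ext_mul v A.
Proof. by rewrite /ext_mul -big_split; apply: eq_bigr => i _; rewrite scalerDl. Qed.

Lemma ext_mulZl k u A : ext_mul (fun i => k * u i) A = k *: ext_mul u A.
Proof. by rewrite /ext_mul scaler_sumr; apply: eq_bigr => i _; rewrite scalerA. Qed.

Lemma int_vecDl u v A : int_vec (fun i => u i + v i) A = int_vec u A + int_vec v A.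
Proof. by rewrite /int_vec -big_split; apply: eq_bigr => i _; rewrite scalerDl. Qed.

Lemma int_vecZl k u A : int_vec (fun i => k * u i) A = k *: int_vec u A.
Proof. by rewrite /int_vec scaler_sumr; apply: eq_bigr => i _; rewrite scalerA. Qed.

Lemma dervDl C D A : derv (fun c e => C c e + D c e) A = derv C A + derv D A.
Proof.
rewrite /derv -big_split; apply: eq_bigr => e _; rewrite -big_split.
by apply: eq_bigr => c _; rewrite scalerDl.
Qed.

Lemma dervZl k C A : derv (fun c e => k * C c e) A = k *: derv C A.
Proof.
rewrite /derv scaler_sumr; apply: eq_bigr => e _; rewrite scaler_sumr.
by apply: eq_bigr => c _; rewrite scalerA.
Qed.

(** The factor by which [i] entering a set changes [ext_sign j] of that set. Its antisymmetry off
    the diagonal is the anticommutation of the generators. *)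
Definition sg i j : R := if (i < j)%N then -1 else 1.

Lemma sgii i : sg i i = 1. Proof. by rewrite /sg ltnn. Qed.

Lemma sgC i j : i != j -> sg j i = - sg i j.
Proof. by rewrite /sg neq_ltn; case: ltngtP; rewrite ?opprK. Qed.

Lemma sg_sqr i j : sg i j * sg i j = 1.
Proof. by rewrite /sg; case: ifP; rewrite ?mulrNN mulr1. Qed.

Lemma ext_sign_U1 i j S : i \notin S -> ext_sign j (i |: S) = sg i j * ext_sign j S :> R.
Proof.
move=> iS; rewrite /ext_sign (cardD1 i) !inE eqxx /= exprD; congr (_ * _).
  by rewrite /sg; case: (i < j)%N.
congr (_ ^+ _); apply: eq_card => k; rewrite !inE.
by case: eqVneq => //= ->; rewrite (negbTE iS).
Qed.

Lemma ext_sign_D1 i j S : i \in S -> ext_sign j S = sg i j * ext_sign j (S :\ i) :> R.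
Proof. by move=> iS; rewrite -{1}(finset.setD1K iS) ext_sign_U1 // !inE eqxx. Qed.

Lemma ext_sign_sqr i S : ext_sign i S * ext_sign i S = 1 :> R.
Proof. by rewrite -expr2 sqrr_sign. Qed.

Lemma ext_extC i j A : ext_basis i (ext_basis j A) = - ext_basis j (ext_basis i A).
Proof.
apply/ffunP => S; rewrite !ffunE !inE.
have [->|ij] := eqVneq i j; first by rewrite /= !mulr0 if_same oppr0.
rewrite /=.
case: (boolP (i \in S)) => iS; case: (boolP (j \in S)) => jS; rewrite ?mulr0 ?oppr0 //.
rewrite (ext_sign_D1 i jS) (ext_sign_D1 j iS) (sgC ij).
have -> : S :\ j :\ i = S :\ i :\ j by rewrite !finset.setDDl finset.setUC.
ring.
Qed.

Lemma int_intC i j A : int_basis i (int_basis j A) = - int_basis j (int_basis i A).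
Proof.
apply/ffunP => S; rewrite !ffunE !inE.
have [->|ij] := eqVneq i j; first by rewrite /= !mulr0 if_same oppr0.
rewrite /=.
case: (boolP (i \in S)) => iS; case: (boolP (j \in S)) => jS; rewrite ?mulr0 ?oppr0 //.
rewrite (ext_sign_U1 j iS) (ext_sign_U1 i jS) (sgC ij) finset.setUCA.
ring.
Qed.

Lemma int_ext i j A : int_basis i (ext_basis j A) = (i == j)%:R *: A - ext_basis j (int_basis i A).
Proof.
apply/ffunP => S; rewrite !ffunE !inE /GRing.scale /=.
have [->|ij] := eqVneq i j.
  rewrite /= mul1r; case: (boolP (j \in S)) => jS.
    by rewrite finset.setD1K // (ext_sign_D1 j jS) sgii mul1r mulrA ext_sign_sqr mul1r subrr.
  by rewrite ext_sign_U1 // sgii mul1r finset.setU1K // mulrA ext_sign_sqr mul1r subr0.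
rewrite /= mul0r add0r.
case: (boolP (i \in S)) => iS; case: (boolP (j \in S)) => jS; rewrite ?mulr0 ?oppr0 ?ij ?andbT ?andbF //=.
rewrite ext_sign_U1 // (ext_sign_D1 i jS) (sgC ij).
have -> : (i |: S) :\ j = i |: (S :\ j).
  by apply/finset.setP => k; rewrite !inE; case: (eqVneq k j) => // ->; rewrite eq_sym (negbTE ij).
have := sg_sqr i j; move: (sg i j) (ext_sign _ _) (ext_sign _ _) (A _) => s x y z ss.
by rewrite -[RHS]mulr1 -ss; ring.
Qed.

Definition ext_delta S : exterior R m := [ffun T => (T == S)%:R].

Lemma ext_delta0 : ext_delta finset.set0 = ext_one. Proof. by []. Qed.

Lemma ext_sum_delta A : A = \sum_S A S *: ext_delta S.
Proof.
apply/ffunP => T; rewrite sum_ffunE (bigD1 T) //= big1 => [|S ST].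
  by rewrite !ffunE eqxx addr0 /GRing.scale /= mulr1.
by rewrite !ffunE eq_sym (negbTE ST) scaler0.
Qed.

Lemma ext_basis_delta i S :
  ext_basis i (ext_delta S) = if i \in S then 0 else ext_sign i S *: ext_delta (i |: S).
Proof.
apply/ffunP => T; rewrite !ffunE; case: ifP => iT; case: ifPn => iS; rewrite !ffunE.
- have -> : (T :\ i == S) = false by apply: contraTF iS => /eqP <-; rewrite !inE eqxx.
  by rewrite mulr0.
- have -> : (T :\ i == S) = (T == i |: S).
    apply/eqP/eqP => [<-|->]; first by rewrite finset.setD1K.
    by rewrite finset.setU1K.
  case: eqP => [->|]; rewrite /GRing.scale /= ?mulr0 // ext_sign_U1 // sgii mul1r //.
- by [].
have -> : (T == i |: S) = false by apply: contraFF iT => /eqP ->; rewrite !inE eqxx.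
by rewrite scaler0.
Qed.

Lemma ext_delta_ind (P : exterior R m -> Prop) :
  (forall S, P (ext_delta S)) ->
  (forall k A B, P A -> P B -> P (k *: A + B)) -> forall A, P A.
Proof.
move=> PS PL A; have P0 : P 0.
  by rewrite -(addNr (ext_delta finset.set0)) -scaleN1r; exact: PL.
by rewrite [A]ext_sum_delta; elim/big_rec: _ => // S B _ PB; exact: PL.
Qed.

(** Each basis form is, up to sign, a product of generators applied to [ext_one]. Identities about
    pullbacks then need to be checked only on 1 and on multiplication by one generator. *)
Lemma ext_ind (P : exterior R m -> Prop) :
  P ext_one -> (forall i A, P A -> P (ext_basis i A)) ->
  (forall k A B, P A -> P B -> P (k *: A + B)) -> forall A, P A.
Proof.
move=> P1 Pe PL A.
suff PS : forall N S, #|S| = N -> P (ext_delta S).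
  by apply: ext_delta_ind => // S; exact: PS.
have P0 : P 0 by rewrite -(addNr ext_one) -scaleN1r; exact: PL.
elim=> [|N IH] S; first by move/eqP; rewrite cards_eq0 => /eqP ->.
  move=> SN; have /card_gt0P[i iS] : (0 < #|S|)%N by rewrite SN.
  have iS' : i \notin S :\ i by rewrite !inE eqxx.
  have -> : ext_delta S = ext_sign i (S :\ i) *: ext_basis i (ext_delta (S :\ i)) + 0.
    by rewrite addr0 ext_basis_delta (negbTE iS') scalerA ext_sign_sqr scale1r finset.setD1K.
  apply: PL => //; apply: Pe; apply: IH.
  by move: SN; rewrite (cardsD1 i) iS add1n => -[].
Qed.

Lemma ext_mul_delta j A : ext_mul (fun k => (k == j)%:R) A = ext_basis j A.
Proof.
rewrite /ext_mul (bigD1 j) //= eqxx scale1r big1 ?addr0 // => k kj.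
by rewrite (negbTE kj) scale0r.
Qed.

Lemma int_vec_delta j A : int_vec (fun k => (k == j)%:R) A = int_basis j A.
Proof.
rewrite /int_vec (bigD1 j) //= eqxx scale1r big1 ?addr0 // => k kj.
by rewrite (negbTE kj) scale0r.
Qed.

Lemma ext_mulC u v A : ext_mul u (ext_mul v A) = - ext_mul v (ext_mul u A).
Proof.
rewrite /ext_mul -sumrN.
under eq_bigr do rewrite linear_sum scaler_sumr.
under [RHS]eq_bigr do rewrite linear_sum scaler_sumr -sumrN.
rewrite exchange_big; apply: eq_bigr => i _; apply: eq_bigr => j _ /=.
by rewrite !linearZ /= !scalerA ext_extC scalerN mulrC.
Qed.

(** The device behind the cancellations below: a double sum of symmetric coefficients against
    anticommuting operators goes into its own negative when the indices are exchanged. *)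
Lemma ext_eqN0 A : A = - A -> A = 0.
Proof.
move=> AN; apply/ffunP => S; have /ffunP/(_ S) := AN; rewrite !ffunE => H; lra.
Qed.

Lemma ext_mul_sqr u A : ext_mul u (ext_mul u A) = 0.
Proof. by apply: ext_eqN0; rewrite -ext_mulC. Qed.

Lemma int_vecC u v A : int_vec u (int_vec v A) = - int_vec v (int_vec u A).
Proof.
rewrite /int_vec -sumrN.
under eq_bigr do rewrite linear_sum scaler_sumr.
under [RHS]eq_bigr do rewrite linear_sum scaler_sumr -sumrN.
rewrite exchange_big; apply: eq_bigr => i _; apply: eq_bigr => j _ /=.
by rewrite !linearZ /= !scalerA int_intC scalerN mulrC.
Qed.

Lemma int_vec_sqr u A : int_vec u (int_vec u A) = 0.
Proof. by apply: ext_eqN0; rewrite -int_vecC. Qed.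

Lemma int_mul_sqr (g : 'M[R]_m) u A : int_mul g u (int_mul g u A) = 0.
Proof. by rewrite !int_mulE int_vec_sqr. Qed.

Lemma int_vec_ext u v A :
  int_vec v (ext_mul u A) = (\sum_i v i * u i) *: A - ext_mul u (int_vec v A).
Proof.
have -> : ext_mul u (int_vec v A) = \sum_i v i *: ext_mul u (int_basis i A).
  by rewrite /int_vec linear_sum; apply: eq_bigr => i _; rewrite linearZ.
rewrite scaler_suml /int_vec -sumrB; apply: eq_bigr => i _.
rewrite -scalerA -scalerBr; congr (_ *: _).
rewrite /ext_mul linear_sum (eq_bigr (fun j => u j *: ((i == j)%:R *: A) -
  u j *: ext_basis j (int_basis i A))); last first.
  by move=> j _; rewrite linearZ /= int_ext scalerBr.
rewrite sumrB; congr (_ - _); rewrite (bigD1 i) //= eqxx scale1r big1 ?addr0 // => j ji.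
by rewrite eq_sym (negbTE ji) scale0r scaler0.
Qed.

Lemma int_mul_ext (g : 'M[R]_m) u v A : int_mul g v (ext_mul u A) =
  (\sum_i \sum_j u i * invmx g i j * v j) *: A - ext_mul u (int_mul g v A).
Proof.
rewrite !int_mulE int_vec_ext; congr (_ *: _ - _); apply: eq_bigr => i _.
by rewrite mulr_suml; apply: eq_bigr => j _; rewrite mulrC mulrA.
Qed.

Lemma derv_ext_basis C f A : derv C (ext_basis f A) =
  ext_basis f (derv C A) + ext_mul (fun e => C f e) A.
Proof.
rewrite /derv linear_sum /ext_mul -big_split; apply: eq_bigr => e _ /=.
rewrite linear_sum (eq_bigr (fun c => ext_basis f (C c e *: ext_basis e (int_basis c A)) +
   (c == f)%:R *: (C c e *: ext_basis e A))); last first.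
  move=> c _; rewrite int_ext linearB /= ext_basisZ [X in _ - X]ext_extC opprK scalerDr addrC.
  by rewrite ext_basisZ !scalerA mulrC.
rewrite big_split /=; congr (_ + _); rewrite (bigD1 f) //= eqxx scale1r big1 ?addr0 // => c cf.
by rewrite (negbTE cf) scale0r.
Qed.

Lemma derv_ext C u A : derv C (ext_mul u A) =
  ext_mul u (derv C A) + ext_mul (fun e => \sum_c C c e * u c) A.
Proof.
have -> : ext_mul (fun e => \sum_c C c e * u c) A = \sum_c u c *: ext_mul (fun e => C c e) A.
  rewrite /ext_mul; under [RHS]eq_bigr do rewrite scaler_sumr.
  rewrite exchange_big; apply: eq_bigr => e _ /=; rewrite scaler_suml.
  by apply: eq_bigr => c _; rewrite scalerA mulrC.
rewrite {1 2}/ext_mul linear_sum -big_split; apply: eq_bigr => f _ /=.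
by rewrite linearZ /= derv_ext_basis scalerDr.
Qed.

Lemma derv_int_basis C f A : derv C (int_basis f A) =
  int_basis f (derv C A) - int_vec (fun c => C c f) A.
Proof.
have -> : int_vec (fun c => C c f) A = \sum_e \sum_c (f == e)%:R *: (C c e *: int_basis c A).
  rewrite (bigD1 f) //= eqxx [X in _ + X]big1 => [|e ef].
    by rewrite addr0; apply: eq_bigr => c _; rewrite scale1r.
  by rewrite big1 // => c _; rewrite eq_sym (negbTE ef) scale0r.
rewrite /derv linear_sum -sumrB; apply: eq_bigr => e _ /=.
rewrite linear_sum -sumrB; apply: eq_bigr => c _ /=.
rewrite int_basisZ int_ext (int_intC f c) linearN /= opprK scalerDr !scalerA.
by rewrite [_%:R * _]mulrC addrAC subrr add0r.
Qed.

Lemma derv_int C v A : derv C (int_vec v A) =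
  int_vec v (derv C A) - int_vec (fun c => \sum_e C c e * v e) A.
Proof.
have -> : int_vec (fun c => \sum_e C c e * v e) A = \sum_e v e *: int_vec (fun c => C c e) A.
  rewrite /int_vec; under [RHS]eq_bigr do rewrite scaler_sumr.
  rewrite exchange_big; apply: eq_bigr => e _ /=; rewrite scaler_suml.
  by apply: eq_bigr => c _; rewrite scalerA mulrC.
rewrite {1 2}/int_vec linear_sum -sumrB; apply: eq_bigr => f _ /=.
by rewrite linearZ /= derv_int_basis scalerBr.
Qed.

Lemma homogeneous0 k : homogeneous k (0 : exterior R m).
Proof. by move=> S; rewrite ffunE eqxx. Qed.

Lemma homogeneousD k A B : homogeneous k A -> homogeneous k B -> homogeneous k (A + B).
Proof.
move=> hA hB S; rewrite ffunE => AB; have [A0|] := eqVneq (A S) 0; last exact: hA.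
by apply: hB; move: AB; rewrite A0 add0r.
Qed.

Lemma homogeneousZ k x A : homogeneous k A -> homogeneous k (x *: A).
Proof. by move=> hA S; rewrite ffunE scaler_eq0 negb_or => /andP[_ /hA]. Qed.

Lemma homogeneousN k A : homogeneous k A -> homogeneous k (- A).
Proof. by rewrite -scaleN1r; exact: homogeneousZ. Qed.

Lemma homogeneousB k A B : homogeneous k A -> homogeneous k B -> homogeneous k (A - B).
Proof. by move=> hA hB; apply: homogeneousD => //; exact: homogeneousN. Qed.

Lemma homogeneous_sum k (I : Type) (r : seq I) (P : pred I) (F : I -> exterior R m) :
  (forall a, P a -> homogeneous k (F a)) -> homogeneous k (\sum_(a <- r | P a) F a).
Proof.
move=> H; elim/big_rec: _ => [|a x Pa hx]; first exact: homogeneous0.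
by apply: homogeneousD => //; exact: H.
Qed.

Lemma homogeneous_ext_basis k i A : homogeneous k A -> homogeneous (k + 1) (ext_basis i A).
Proof.
move=> hA S; rewrite ffunE; case: ifP => iS; rewrite ?eqxx // mulf_eq0 negb_or => /andP[_ /hA <-].
by rewrite (cardsD1 i S) iS add1n -addn1 PoszD.
Qed.

Lemma homogeneous_int_basis k i A : homogeneous k A -> homogeneous (k - 1) (int_basis i A).
Proof.
move=> hA S; rewrite ffunE; case: ifPn => iS; rewrite ?eqxx // mulf_eq0 negb_or => /andP[_ /hA <-].
by rewrite cardsU1 iS PoszD addrAC subrr add0r.
Qed.

Lemma homogeneous_ext_mul k u A : homogeneous k A -> homogeneous (k + 1) (ext_mul u A).
Proof.
by move=> hA; apply: homogeneous_sum => i _; apply: homogeneousZ; exact: homogeneous_ext_basis.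
Qed.

Lemma homogeneous_int_vec k u A : homogeneous k A -> homogeneous (k - 1) (int_vec u A).
Proof.
by move=> hA; apply: homogeneous_sum => i _; apply: homogeneousZ; exact: homogeneous_int_basis.
Qed.

Lemma homogeneous_int_mul k (g : 'M[R]_m) u A : homogeneous k A -> homogeneous (k - 1) (int_mul g u A).
Proof. by move=> hA; rewrite int_mulE; exact: homogeneous_int_vec. Qed.

Lemma homogeneous_derv k C A : homogeneous k A -> homogeneous k (derv C A).
Proof.
move=> hA; apply: homogeneous_sum => e _; apply: homogeneous_sum => c _; apply: homogeneousZ.
rewrite -(subrK 1 k); apply: homogeneous_ext_basis; exact: homogeneous_int_basis.
Qed.

(** Removing and restoring [i] is the identity on the components with [i \in S] and kills the
    others, so the sum counts the elements of [S]. *)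
Lemma ext_int_euler k A : homogeneous k A -> \sum_i ext_basis i (int_basis i A) = k%:~R *: A.
Proof.
move=> hA; apply/ffunP => S; rewrite sum_ffunE.
have [A0|/[dup] A0 /hA <-] := eqVneq (A S) 0.
  rewrite ffunE A0 scaler0 big1 // => i _; rewrite !ffunE; case: ifP => // iS.
  by rewrite !inE eqxx /= finset.setD1K // A0 !mulr0.
rewrite ffunE /GRing.scale /= (eq_bigr (fun i => (i \in S)%:R * A S)).
  rewrite -mulr_suml -pmulrn -sum1_card natr_sum [in RHS]big_mkcond; congr (_ * _).
  by apply: eq_bigr => i _; case: ifP.
move=> i _; rewrite !ffunE; case: ifP => iS; last by rewrite mul0r.
by rewrite !inE eqxx /= finset.setD1K // (ext_sign_D1 i iS) sgii mul1r mulrA ext_sign_sqr.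
Qed.

Lemma int_ext_euler k A : homogeneous k A ->
  \sum_i int_basis i (ext_basis i A) = (m%:R - k%:~R) *: A.
Proof.
move=> hA; rewrite scalerBl -(ext_int_euler hA) scaler_nat.
have -> : A *+ m = \sum_(i < m) A by rewrite sumr_const card_ord.
rewrite -sumrB.
by apply: eq_bigr => i _; rewrite int_ext eqxx scale1r.
Qed.

(** * Pulling back exterior forms along a linear map *)

Section Pullback.
Variable J : 'M[R]_m.

(** The products occurring in [ext_pullback], but for arbitrary lists instead of the sorted list
    [enum S], so that a factor can be moved or repeated. *)
Definition ext_word (s : seq 'I_m) : exterior R m :=
  foldr (fun i B => ext_mul (J i) B) ext_one s.

Lemma ext_pullback_linear : linear (ext_pullback J : exterior R m -> exterior R m).
Proof.
move=> k A B; rewrite /ext_pullback scaler_sumr -big_split; apply: eq_bigr => S _ /=.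
by rewrite !ffunE scalerDl scalerA.
Qed.
HB.instance Definition _ := GRing.isLinear.Build R (exterior R m) (exterior R m) _
  (ext_pullback J) ext_pullback_linear.

Lemma ext_pullback_delta S : ext_pullback J (ext_delta S) = ext_word (enum S).
Proof.
rewrite /ext_pullback (bigD1 S) //= ffunE eqxx scale1r big1 ?addr0 // => T TS.
by rewrite ffunE (negbTE TS) scale0r.
Qed.

Lemma ext_pullback1 : ext_pullback J ext_one = ext_one.
Proof. by rewrite -ext_delta0 ext_pullback_delta enum_set0. Qed.

Lemma ext_word_move s i t : ext_word (s ++ i :: t) = (-1) ^+ size s *: ext_mul (J i) (ext_word (s ++ t)).
Proof.
elim: s => [|j s IH] /=; first by rewrite scale1r.
by rewrite /ext_word /= -/(ext_word _) IH linearZ /= ext_mulC exprS mulN1r scaleNr scalerN.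
Qed.

(** [enum] lists a set of ordinals increasingly, so the elements of [S] before the place of [i] are
    exactly those counted by [ext_sign i S]. *)
Lemma enum_split i S : exists s t, [/\ enum S = s ++ (if i \in S then [:: i] else [::]) ++ t,
  enum (i |: S) = s ++ i :: t & ext_sign i S = (-1) ^+ size s :> R].
Proof.
pose E := enum 'I_m.
have ES (T : {set 'I_m}) : enum T = [seq x <- E | x \in T].
  by rewrite /E /enum_mem -seq.filter_predI; apply: seq.eq_filter => x; rewrite /= andbT.
have Esz : (i < size E)%N by rewrite size_enum_ord.
have EE : E = take i E ++ i :: drop i.+1 E.
  by rewrite -{1}(cat_take_drop i E) (drop_nth i Esz) nth_ord_enum.
have vE : map (@nat_of_ord m) E = iota 0 m by exact: val_enum_ord.
have tE x : x \in take i E -> (x < i)%N.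
  move=> xt; have : nat_of_ord x \in map (@nat_of_ord m) (take i E) by exact: map_f.
  by rewrite map_take vE take_iota mem_iota add0n leq_min => /andP[_ /andP[]].
have dE x : x \in drop i.+1 E -> (i < x)%N.
  move=> xt; have : nat_of_ord x \in map (@nat_of_ord m) (drop i.+1 E) by exact: map_f.
  by rewrite map_drop vE drop_iota mem_iota add0n => /andP[].
exists [seq x <- take i E | x \in S], [seq x <- drop i.+1 E | x \in S]; split.
- by rewrite ES {1}EE filter_cat /=; case: ifP.
- rewrite ES {1}EE filter_cat /= !inE eqxx /=; congr (_ ++ _ :: _); apply: eq_in_filter => x.
    by move/tE => xi; rewrite /= !inE -val_eqE /= ltn_eqF.
  by move/dE => xi; rewrite /= !inE -val_eqE /= gtn_eqF.
rewrite /ext_sign; congr (_ ^+ _).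
rewrite cardE /enum_mem !size_filter -enumT -/E {1}EE count_cat /=.
rewrite [X in (_ + X)%N](_ : _ = 0%N) ?addn0.
  by apply: eq_in_count => x /tE xi; rewrite /= !inE xi andbT.
rewrite inE ltnn andbF add0n; apply/eqP; rewrite -leqn0 leqNgt -has_count; apply/hasPn => x /dE xi.
by rewrite /= !inE negb_and -leqNgt (ltnW xi) orbT.
Qed.

(** Moving [J i] to its sorted place costs the sign [ext_sign i S]; if [i] already belongs to [S], a
    factor is repeated and the product vanishes. *)
Lemma ext_pullback_basis i A : ext_pullback J (ext_basis i A) = ext_mul (J i) (ext_pullback J A).
Proof.
elim/ext_delta_ind: A => [S|k A B IHA IHB]; last first.
  by rewrite !linearP /= IHA IHB.
rewrite ext_pullback_delta ext_basis_delta.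
have [s [t [E1 E2 E3]]] := enum_split i S; rewrite E1.
case: ifP E1 => iS _.
  by rewrite linear0 ext_word_move linearZ /= ext_mul_sqr scaler0.
by rewrite linearZ /= ext_pullback_delta E2 ext_word_move E3 scalerA -expr2 sqrr_sign scale1r.
Qed.

Lemma ext_pullback_mul u A : ext_pullback J (ext_mul u A) =
  ext_mul (fun j => \sum_i u i * J i j) (ext_pullback J A).
Proof.
rewrite /ext_mul linear_sum.
under eq_bigr do rewrite linearZ /= ext_pullback_basis /ext_mul scaler_sumr.
rewrite exchange_big; apply: eq_bigr => j _ /=; rewrite scaler_suml.
by apply: eq_bigr => i _; rewrite scalerA.
Qed.

Lemma int_basis_pullback j A :
  int_basis j (ext_pullback J A) = \sum_i J i j *: ext_pullback J (int_basis i A).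
Proof.
have int1 i : int_basis i (ext_one : exterior R m) = 0.
  apply/ffunP => S; rewrite !ffunE; case: ifPn => // iS.
  have -> : (i |: S == finset.set0) = false.
    by apply/eqP => /finset.setP /(_ i); rewrite !inE eqxx.
  by rewrite mulr0.
elim/ext_ind: A => [|l A IH|k A B IHA IHB].
- by rewrite ext_pullback1 int1 big1 // => i _; rewrite int1 linear0 scaler0.
- rewrite ext_pullback_basis -int_vec_delta int_vec_ext int_vec_delta IH.
  rewrite (bigD1 j) //= eqxx mul1r big1 => [|i ij]; last by rewrite (negbTE ij) mul0r.
  rewrite addr0 (linear_sum (ext_mul (J l))) [RHS](eq_bigr (fun i => (i == l)%:R *: (J i j *: ext_pullback J A)
     - J i j *: ext_pullback J (ext_basis l (int_basis i A)))); last first.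
    move=> i _; rewrite int_ext linearB linearZ /= scalerBr !scalerA; congr (_ *: _ - _).
    exact: mulrC.
  rewrite sumrB; congr (_ - _).
    rewrite (bigD1 l) //= eqxx scale1r big1 ?addr0 // => i il.
    by rewrite (negbTE il) scale0r.
  by apply: eq_bigr => i _; rewrite /= ext_mulZ ext_pullback_basis.
rewrite !linearP /= IHA IHB scaler_sumr -big_split; apply: eq_bigr => i _ /=.
by rewrite (linearP (int_basis i)) (linearP (ext_pullback J)) scalerDr !scalerA mulrC.
Qed.

End Pullback.

Lemma ext_pullback_comp (J K : 'M[R]_m) A :
  ext_pullback J (ext_pullback K A) = ext_pullback (K *m J) A.
Proof.
elim/ext_ind: A => [|l A IH|k A B IHA IHB].
- by rewrite !ext_pullback1.
- rewrite !ext_pullback_basis ext_pullback_mul IH; apply: eq_ext_mul => j; by rewrite mxE.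
- by rewrite !linearP /= IHA IHB.
Qed.

Lemma ext_pullback_id A : ext_pullback 1%:M A = A.
Proof.
elim/ext_ind: A => [|l A IH|k A B IHA IHB].
- by rewrite ext_pullback1.
- rewrite ext_pullback_basis IH -ext_mul_delta; apply: eq_ext_mul => j.
  by rewrite mxE eq_sym.
- by rewrite !linearP /= IHA IHB.
Qed.

End ExteriorAlgebra.

(** * Fields of forms in a chart *)

Section Fields.
Context {R : realType} {n : nat} {M : chart_space R n.+1}.
Hypothesis hM : manifold_with_boundary M.
Local Notation ext := (exterior R n.+1).
Implicit Types (a b : chart M) (p q : M) (f : M -> R) (i j : 'I_n.+1) (A B : M -> ext)
  (u v : 'I_n.+1 -> M -> R).

Definition smx a p A := forall S, sm a p (fun q => A q S).
Definition dfx a p A := forall S, dfr a p (fun q => A q S).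
Definition dx a i A p : ext := [ffun S : {set 'I_n.+1} => pd a i (fun q => A q S) p].

Lemma dxE a i A p S : dx a i A p S = pd a i (fun q => A q S) p.
Proof. by rewrite ffunE. Qed.

Lemma smx_dfx a p A : smx a p A -> dfx a p A.
Proof. by move=> H S; exact/sm_dfr/H. Qed.

Lemma smx_eq a p A B : (forall q, dom a q -> A q = B q) -> smx a p A -> smx a p B.
Proof. by move=> AB H S; apply: sm_eq (H S) => q /AB ->. Qed.

Lemma dfx_eq a p A B : (forall q, dom a q -> A q = B q) -> dfx a p A -> dfx a p B.
Proof. by move=> AB H S; apply: dfr_near_eq (H S); apply: near_ptT => q /AB ->. Qed.

Lemma smx_cst a p (C : ext) : smx a p (fun=> C).
Proof. by move=> S; exact: sm_cst. Qed.

Lemma smxD a p A B : smx a p A -> smx a p B -> smx a p (fun q => A q + B q).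
Proof. by move=> hA hB S; apply: sm_eq (smD (hA S) (hB S)) => q _; rewrite ffunE. Qed.

Lemma smxZ a p f A : sm a p f -> smx a p A -> smx a p (fun q => f q *: A q).
Proof. by move=> hf hA S; apply: sm_eq (smM hf (hA S)) => q _; rewrite ffunE. Qed.

Lemma smxN a p A : smx a p A -> smx a p (fun q => - A q).
Proof. by move=> hA S; apply: sm_eq (smN (hA S)) => q _; rewrite ffunE. Qed.

Lemma smxB a p A B : smx a p A -> smx a p B -> smx a p (fun q => A q - B q).
Proof. by move=> hA hB; apply: smxD => //; exact: smxN. Qed.

Lemma smx_sum (I : Type) (r : seq I) (P : pred I) (F : I -> M -> ext) a p :
  (forall k, P k -> smx a p (F k)) -> smx a p (fun q => \sum_(k <- r | P k) F k q).
Proof.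
move=> H S; apply: sm_eq (@sm_sum _ _ _ _ r P (fun k q => F k q S) a p _).
  by move=> q _; rewrite sum_ffunE.
by move=> k /H; apply.
Qed.

Lemma smx_lin (L : {linear ext -> ext}) a p A : smx a p A -> smx a p (fun q => L (A q)).
Proof.
move=> H; apply: (@smx_eq _ _ (fun q => \sum_S A q S *: L (ext_delta S))).
  by move=> q _; rewrite {2}(ext_sum_delta (A q)) linear_sum; apply: eq_bigr => S _; rewrite linearZ.
by apply: smx_sum => S _; apply: smxZ; [exact: H|exact: smx_cst].
Qed.

Lemma dfxD a p A B : dfx a p A -> dfx a p B -> dfx a p (fun q => A q + B q).
Proof.
move=> hA hB S; apply: dfr_near_eq (dfrD (hA S) (hB S)).
by apply: near_ptT => q _; rewrite ffunE.
Qed.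

Lemma dfxZ a p f A : dfr a p f -> dfx a p A -> dfx a p (fun q => f q *: A q).
Proof.
move=> hf hA S; apply: dfr_near_eq (dfrM hf (hA S)).
by apply: near_ptT => q _; rewrite ffunE.
Qed.

Lemma dfx_sum (I : Type) (r : seq I) (P : pred I) (F : I -> M -> ext) a p :
  (forall k, P k -> dfx a p (F k)) -> dfx a p (fun q => \sum_(k <- r | P k) F k q).
Proof.
move=> H S; apply: dfr_near_eq (@dfr_sum _ _ _ _ r P (fun k q => F k q S) a p _).
  by apply: near_ptT => q _; rewrite sum_ffunE.
by move=> k /H; apply.
Qed.

Lemma dx_near_eq a p i A B : dom a p -> near_pt a p (fun q => A q = B q) ->
  dx a i A p = dx a i B p.
Proof.
move=> dp AB; apply/ffunP => S; rewrite !ffunE; apply: pd_near_eq => //.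
by apply: near_ptS AB => q _ ->.
Qed.

Lemma dx_eq a p i A B : dom a p -> (forall q, dom a q -> A q = B q) ->
  dx a i A p = dx a i B p.
Proof. by move=> dp AB; apply: dx_near_eq => //; exact: near_ptT. Qed.

Lemma dx_cst a p i (C : ext) : dom a p -> dx a i (fun=> C) p = 0.
Proof. by move=> dp; apply/ffunP => S; rewrite !ffunE pd_cst. Qed.

Lemma dxD a p i A B : dom a p -> dfx a p A -> dfx a p B ->
  dx a i (fun q => A q + B q) p = dx a i A p + dx a i B p.
Proof.
move=> dp hA hB; apply/ffunP => S; rewrite !ffunE -pdD //.
by apply: pd_eq => // q _; rewrite ffunE.
Qed.

Lemma dxZ a p i f A : dom a p -> dfr a p f -> dfx a p A ->
  dx a i (fun q => f q *: A q) p = pd a i f p *: A p + f p *: dx a i A p.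
Proof.
move=> dp hf hA; apply/ffunP => S; rewrite !ffunE /GRing.scale /= -pdM //.
by apply: pd_eq => // q _; rewrite ffunE.
Qed.

Lemma dx_sum (I : Type) (r : seq I) (P : pred I) (F : I -> M -> ext) a i p : dom a p ->
  (forall k, P k -> dfx a p (F k)) ->
  dx a i (fun q => \sum_(k <- r | P k) F k q) p = \sum_(k <- r | P k) dx a i (F k) p.
Proof.
move=> dp H; apply/ffunP => S; rewrite sum_ffunE ffunE.
under eq_bigr do rewrite ffunE.
rewrite -pd_sum //; last by move=> k /H; apply.
by apply: pd_eq => // q _; rewrite sum_ffunE.
Qed.

Lemma dx_lin (L : {linear ext -> ext}) a p i A : dom a p -> dfx a p A ->
  dx a i (fun q => L (A q)) p = L (dx a i A p).
Proof.
move=> dp H.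
rewrite (@dx_eq _ _ _ _ (fun q => \sum_S A q S *: L (ext_delta S))) //; last first.
  by move=> q _; rewrite {1}(ext_sum_delta (A q)) linear_sum; apply: eq_bigr => S _; rewrite linearZ.
rewrite dx_sum //; last by move=> S _; apply: dfxZ; [exact: H|exact/smx_dfx/smx_cst].
rewrite [in RHS](ext_sum_delta (dx a i A p)) linear_sum; apply: eq_bigr => S _.
rewrite dxZ //; try exact: H; try exact/smx_dfx/smx_cst.
by rewrite dx_cst // scaler0 addr0 linearZ ffunE.
Qed.

Lemma dfx_lin (L : {linear ext -> ext}) a p A : dfx a p A -> dfx a p (fun q => L (A q)).
Proof.
move=> H; apply: (@dfx_eq _ _ (fun q => \sum_S A q S *: L (ext_delta S))).
  by move=> q _; rewrite {2}(ext_sum_delta (A q)) linear_sum; apply: eq_bigr => S _; rewrite linearZ.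
by apply: dfx_sum => S _; apply: dfxZ; [exact: H|exact/smx_dfx/smx_cst].
Qed.

Lemma dx_comm a p i j A : dom a p -> smx a p A ->
  dx a i (dx a j A) p = dx a j (dx a i A) p.
Proof.
move=> dp H; apply/ffunP => S. rewrite [LHS]dxE. rewrite [RHS]dxE.
have E k l : pd a k (fun q => dx a l A q S) p = pd a k (pd a l (fun q => A q S)) p.
  by apply: pd_eq => // q _; rewrite dxE.
rewrite !E; apply: pd_comm => //; exact: H.
Qed.

Lemma smx_dx a p i A : dom a p -> smx a p A -> smx a p (dx a i A).
Proof.
by move=> dp H S; apply: sm_eq (sm_pd hM i dp (H S)) => q _; rewrite ffunE.
Qed.

Section Bilinear.
Variable (I : finType) (L : I -> {linear ext -> ext}).
Implicit Type w : I -> M -> R.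

Lemma smx_bil a p w A : (forall k, sm a p (w k)) -> smx a p A ->
  smx a p (fun q => \sum_k w k q *: L k (A q)).
Proof. by move=> hw hA; apply: smx_sum => k _; apply: smxZ => //; exact: smx_lin. Qed.

Lemma dfx_bil a p w A : (forall k, dfr a p (w k)) -> dfx a p A ->
  dfx a p (fun q => \sum_k w k q *: L k (A q)).
Proof. by move=> hw hA; apply: dfx_sum => k _; apply: dfxZ => //; exact: dfx_lin. Qed.

Lemma dx_bil a p i w A : dom a p -> (forall k, dfr a p (w k)) -> dfx a p A ->
  dx a i (fun q => \sum_k w k q *: L k (A q)) p =
  (\sum_k pd a i (w k) p *: L k (A p)) + \sum_k w k p *: L k (dx a i A p).
Proof.
move=> dp hw hA; rewrite dx_sum //; last by move=> k _; apply: dfxZ => //; exact: dfx_lin.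
rewrite -big_split; apply: eq_bigr => k _ /=.
by rewrite dxZ // ?dx_lin //; exact: dfx_lin.
Qed.

End Bilinear.

Lemma smx_ext_mul a p u A : (forall j, sm a p (u j)) -> smx a p A ->
  smx a p (fun q => ext_mul (u^~ q) (A q)).
Proof. exact: (@smx_bil _ (fun i => ext_basis i : {linear ext -> ext})). Qed.

Lemma dfx_ext_mul a p u A : (forall j, dfr a p (u j)) -> dfx a p A ->
  dfx a p (fun q => ext_mul (u^~ q) (A q)).
Proof. exact: (@dfx_bil _ (fun i => ext_basis i : {linear ext -> ext})). Qed.

Lemma dx_ext_mul a p i u A : dom a p -> (forall j, dfr a p (u j)) -> dfx a p A ->
  dx a i (fun q => ext_mul (u^~ q) (A q)) p =
  ext_mul (fun j => pd a i (u j) p) (A p) + ext_mul (u^~ p) (dx a i A p).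
Proof. exact: (@dx_bil _ (fun i => ext_basis i : {linear ext -> ext})). Qed.

Lemma smx_int_vec a p u A : (forall j, sm a p (u j)) -> smx a p A ->
  smx a p (fun q => int_vec (u^~ q) (A q)).
Proof. exact: (@smx_bil _ (fun i => int_basis i : {linear ext -> ext})). Qed.

Lemma dfx_int_vec a p u A : (forall j, dfr a p (u j)) -> dfx a p A ->
  dfx a p (fun q => int_vec (u^~ q) (A q)).
Proof. exact: (@dfx_bil _ (fun i => int_basis i : {linear ext -> ext})). Qed.

Lemma dx_int_vec a p i u A : dom a p -> (forall j, dfr a p (u j)) -> dfx a p A ->
  dx a i (fun q => int_vec (u^~ q) (A q)) p =
  int_vec (fun j => pd a i (u j) p) (A p) + int_vec (u^~ p) (dx a i A p).
Proof. exact: (@dx_bil _ (fun i => int_basis i : {linear ext -> ext})). Qed.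

Lemma smx_derv a p (C : M -> 'I_n.+1 -> 'I_n.+1 -> R) A :
  (forall c e, sm a p (fun q => C q c e)) -> smx a p A ->
  smx a p (fun q => derv (C q) (A q)).
Proof.
move=> hC hA; apply: smx_sum => e _; apply: smx_sum => c _; apply: smxZ => //.
apply: (@smx_lin (ext_basis e)); exact: (@smx_lin (int_basis c)).
Qed.

Definition dmx (k l : nat) a i (K : M -> 'M[R]_(k, l)) p : 'M[R]_(k, l) :=
  \matrix_(s, t) pd a i (fun q => K q s t) p.

Definition smm (k l : nat) a p (K : M -> 'M[R]_(k, l)) := forall s t, sm a p (fun q => K q s t).
Definition dfm (k l : nat) a p (K : M -> 'M[R]_(k, l)) := forall s t, dfr a p (fun q => K q s t).

Lemma smm_dfm (k l : nat) a p (K : M -> 'M[R]_(k, l)) : smm a p K -> dfm a p K.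
Proof. by move=> H s t; exact/sm_dfr/H. Qed.

Lemma smmM (k l r : nat) a p (K : M -> 'M[R]_(k, l)) (L : M -> 'M[R]_(l, r)) :
  smm a p K -> smm a p L -> smm a p (fun q => K q *m L q).
Proof.
move=> hK hL s t; apply: (@sm_eq _ _ _ _ _ (fun q => \sum_j K q s j * L q j t)).
  by move=> q _; rewrite mxE.
by apply: sm_sum => j _; exact: smM.
Qed.

Lemma dfmM (k l r : nat) a p (K : M -> 'M[R]_(k, l)) (L : M -> 'M[R]_(l, r)) :
  dfm a p K -> dfm a p L -> dfm a p (fun q => K q *m L q).
Proof.
move=> hK hL s t; apply: (@dfr_near_eq _ _ _ _ _ (fun q => \sum_j K q s j * L q j t)).
  by apply: near_ptT => q _; rewrite mxE.
by apply: dfr_sum => j _; exact: dfrM.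
Qed.

Lemma dfmT (k l : nat) a p (K : M -> 'M[R]_(k, l)) : dfm a p K -> dfm a p (fun q => (K q)^T).
Proof.
by move=> hK s t; apply: dfr_near_eq (hK t s); apply: near_ptT => q _; rewrite mxE.
Qed.

Lemma dmx_near_eq (k l : nat) a p i (K L : M -> 'M[R]_(k, l)) : dom a p ->
  near_pt a p (fun q => K q = L q) -> dmx a i K p = dmx a i L p.
Proof.
move=> dp KL; apply/matrixP => s t; rewrite !mxE; apply: pd_near_eq => //.
by apply: near_ptS KL => q _ ->.
Qed.

Lemma dmxM (k l r : nat) a p i (K : M -> 'M[R]_(k, l)) (L : M -> 'M[R]_(l, r)) : dom a p ->
  dfm a p K -> dfm a p L ->
  dmx a i (fun q => K q *m L q) p = dmx a i K p *m L p + K p *m dmx a i L p.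
Proof.
move=> dp hK hL; apply/matrixP => s t; rewrite !mxE -big_split /=.
rewrite (@pd_eq _ _ _ hM _ _ _ _ (fun q => \sum_j K q s j * L q j t)) //; last by move=> q _; rewrite mxE.
rewrite pd_sum //; last by move=> j _; exact: dfrM.
by apply: eq_bigr => j _; rewrite pdM // !mxE.
Qed.

Lemma dmxT (k l : nat) a p i (K : M -> 'M[R]_(k, l)) : dom a p ->
  dmx a i (fun q => (K q)^T) p = (dmx a i K p)^T.
Proof.
move=> dp; apply/matrixP => s t; rewrite !mxE; apply: pd_eq => // q _; by rewrite mxE.
Qed.

Lemma dmx_cst (k l : nat) a p i (K : 'M[R]_(k, l)) : dom a p -> dmx a i (fun=> K) p = 0.
Proof. by move=> dp; apply/matrixP => s t; rewrite !mxE pd_cst. Qed.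

Lemma dmxZ (k l : nat) a p i f (K : M -> 'M[R]_(k, l)) : dom a p ->
  dfr a p f -> dfm a p K ->
  dmx a i (fun q => f q *: K q) p = pd a i f p *: K p + f p *: dmx a i K p.
Proof.
move=> dp hf hK; apply/matrixP => s t; rewrite !mxE -pdM //.
by apply: pd_eq => // q _; rewrite mxE.
Qed.

Lemma smm_invmx (k : nat) a p (K : M -> 'M[R]_k) : dom a p ->
  near_pt a p (fun q => K q \in unitmx) -> smm a p K -> smm a p (fun q => invmx (K q)).
Proof.
move=> dp Ku H s t.
(* Cramer's rule: the entries are polynomials in the entries of [K] divided by the determinant. *)
apply: (@sm_near_eq _ _ _ _ _ (fun q => (\det (K q))^-1 * cofactor (K q) t s)).
  by apply: near_ptS Ku => q dq Kq; rewrite /invmx Kq // !mxE.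
apply: smM; first by apply: smV => //; [rewrite -unitfE; exact: near_pt_at Ku|exact: sm_det].
apply: smM; first exact: sm_cst.
by apply: sm_det => s' t'; apply: sm_eq (H (lift t s') (lift s t')) => q _; rewrite !mxE.
Qed.

Lemma dmx_invmx (k : nat) a p i (K : M -> 'M[R]_k) : dom a p ->
  near_pt a p (fun q => K q \in unitmx) -> smm a p K ->
  dmx a i (fun q => invmx (K q)) p = - (invmx (K p) *m dmx a i K p *m invmx (K p)).
Proof.
move=> dp Ku hK; have hV := smm_invmx dp Ku hK.
have Kp : K p \in unitmx by exact: near_pt_at Ku.
have : dmx a i (fun q => invmx (K q) *m K q) p = 0.
  rewrite -(@dmx_cst _ _ a p i 1%:M) //; apply: dmx_near_eq => //.
  by apply: near_ptS Ku => q _ Kq; rewrite mulVmx.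
rewrite dmxM //; try exact: smm_dfm.
move/eqP; rewrite addr_eq0 => /eqP /(congr1 (mulmx^~ (invmx (K p)))).
by rewrite mulmxK // mulNmx.
Qed.

(** The derivative of each factor [J k] is its image under the endomorphism [J^-1 dJ], so a product
    of such factors is differentiated by the derivation extending it. *)
Lemma dx_word a p i (J : M -> 'M[R]_n.+1) (s : seq 'I_n.+1) : dom a p ->
  J p \in unitmx -> dfm a p J ->
  dfx a p (fun q => ext_word (J q) s) /\
  dx a i (fun q => ext_word (J q) s) p =
    derv (fun c e => (invmx (J p) *m dmx a i J p) c e) (ext_word (J p) s).
Proof.
move=> dp Jp hJ; elim: s => [|k s [IH1 IH2]] /=.
  split; first exact/smx_dfx/smx_cst.
  rewrite dx_cst // /derv big1 // => e _; rewrite big1 // => c _.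
  have -> : int_basis c ext_one = 0 :> ext.
    apply/ffunP => S; rewrite !ffunE; case: ifPn => // cS.
    have -> : (c |: S == finset.set0)%SET = false.
      by apply/eqP => /finset.setP /(_ c); rewrite !inE eqxx.
    by rewrite mulr0.
  by rewrite linear0 scaler0.
rewrite -/(ext_word _ _); split; first by apply: (@dfx_ext_mul _ _ (fun j q => J q k j)).
rewrite (@dx_ext_mul _ _ _ (fun j q => J q k j)) // IH2 derv_ext addrC; congr (_ + _).
apply: eq_ext_mul => e; rewrite -[LHS](mxE tt (fun _ e => pd a i (fun q => J q k e) p) k e).
transitivity ((J p *m (invmx (J p) *m dmx a i J p)) k e); last first.
  by rewrite mxE; apply: eq_bigr => c _; rewrite mulrC.
by rewrite mulmxA mulmxV // mul1mx !mxE.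
Qed.

Lemma dfx_pullback a p (J : M -> 'M[R]_n.+1) A : dom a p ->
  J p \in unitmx -> dfm a p J -> dfx a p A -> dfx a p (fun q => ext_pullback (J q) (A q)).
Proof.
move=> dp Jp hJ hA; apply: dfx_sum => S _; apply: dfxZ; first exact: hA.
by have [] := dx_word ord0 (enum S) dp Jp hJ.
Qed.

Lemma smx_pullback a p (J : M -> 'M[R]_n.+1) A : 
  smm a p J -> smx a p A -> smx a p (fun q => ext_pullback (J q) (A q)).
Proof.
move=> hJ hA; apply: smx_sum => S _; apply: smxZ; first exact: hA.
elim: (enum S) => [|k s IH] /=; first exact: smx_cst.
by apply: (@smx_ext_mul _ _ (fun j q => J q k j)).
Qed.

Lemma dx_pullback a p i (J : M -> 'M[R]_n.+1) A : dom a p ->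
  J p \in unitmx -> dfm a p J -> dfx a p A ->
  dx a i (fun q => ext_pullback (J q) (A q)) p =
  ext_pullback (J p) (dx a i A p) +
    derv (fun c e => (invmx (J p) *m dmx a i J p) c e) (ext_pullback (J p) (A p)).
Proof.
move=> dp Jp hJ hA.
have hw (S : {set 'I_n.+1}) := dx_word i (enum S) dp Jp hJ.
have -> : dx a i (fun q => ext_pullback (J q) (A q)) p =
  dx a i (fun q => \sum_(S : {set 'I_n.+1}) A q S *: ext_word (J q) (enum S)) p by [].
rewrite dx_sum //; last by move=> S _; apply: dfxZ; [exact: hA|exact: (hw S).1].
rewrite /ext_pullback (linear_sum (derv _)) -big_split; apply: eq_bigr => S _ /=.
rewrite dxZ //; try exact: hA; try exact: (hw S).1.
by rewrite (hw S).2 ffunE dervZ.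
Qed.

End Fields.

(** * The Levi-Civita connection *)

Section LeviCivita.
Context {R : realType} {n : nat} {M : chart_space R n.+1}.
Hypothesis hM : manifold_with_boundary M.
Local Notation ext := (exterior R n.+1).
Implicit Types (g : metric M) (a b : chart M) (p q : M) (f : M -> R) (i j k c e : 'I_n.+1)
  (A B : M -> ext) (u v : 'I_n.+1 -> M -> R).

Lemma sum_delta (N : nat) (F : 'I_N -> R) (i : 'I_N) : \sum_j F j * (j == i)%:R = F i.
Proof.
rewrite (bigD1 i) //= eqxx mulr1 big1 => [|j ji]; first by rewrite addr0.
by rewrite (negbTE ji) mulr0.
Qed.

(** A condition near a single point, so that it also covers sigma^-2 g, which is a metric in the
    interior only. *)
Definition metric_at g a p := [/\ near_pt a p (fun q => (g a q)^T = g a q),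
  near_pt a p (fun q => g a q \in unitmx) & smm a p (g a)].

Lemma metric_at_near g a p : metric_at g a p -> near_pt a p (metric_at g a).
Proof.
move=> [/near_pt_join H1 /near_pt_join H2 H3].
have H4 : near_pt a p (fun q => smm a q (g a)).
  apply: (@filterS _ (nbhs (crd a p)) _ (fun y => forall s t, forall q, dom a q -> crd a q = y ->
     sm a q (fun q => g a q s t))); first by move=> y H q dq yq s t; exact: H.
  apply: (@filter_forall _ _ (fun s y => forall t, forall q, dom a q -> crd a q = y ->
     sm a q (fun q => g a q s t)) (nbhs (crd a p))) => s.
  apply: (@filter_forall _ _ (fun t y => forall q, dom a q -> crd a q = y ->
     sm a q (fun q => g a q s t)) (nbhs (crd a p))) => t.
  exact: sm_near (H3 s t).
have H12 := near_ptS2 (fun q _ x y => conj x y) H1 H2.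
by apply: near_ptS2 H12 H4 => q _ [].
Qed.

Section At.
Variables (g : metric M) (a : chart M) (p : M).
Hypotheses (dp : dom a p) (hg : metric_at g a p).

Definition Gam i q : 'M[R]_n.+1 := \matrix_(c, e) christoffel g a c i e q.
Definition Low i q : 'M[R]_n.+1 := \matrix_(s, e) (pd a i (fun q => g a q s e) q +
  pd a e (fun q => g a q s i) q - pd a s (fun q => g a q i e) q).

Let gp_unit : g a p \in unitmx. Proof. by case: hg => _ H _; exact: near_pt_at H. Qed.
Let gp_sym : (g a p)^T = g a p. Proof. by case: hg => H _ _; exact: near_pt_at H. Qed.
Let gp_sm : smm a p (g a). Proof. by case: hg. Qed.
Let gp_dfm : dfm a p (g a). Proof. exact: smm_dfm. Qed.

Lemma GamE i q : Gam i q = 2^-1 *: (invmx (g a q) *m Low i q).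
Proof.
apply/matrixP => c e; rewrite !mxE /christoffel; congr (_ * _); apply: eq_bigr => s _.
by rewrite !mxE.
Qed.

Lemma pd_metric_sym i s t : pd a i (fun q => g a q s t) p = pd a i (fun q => g a q t s) p.
Proof.
apply: pd_near_eq => //; case: hg => H _ _; apply: near_ptS H => q _ H.
by rewrite -{1}H mxE.
Qed.

Lemma mul_Gam i : g a p *m Gam i p = 2^-1 *: Low i p.
Proof. by rewrite GamE -scalemxAr mulKVmx. Qed.

Lemma christoffel_sym c i e : christoffel g a c i e p = christoffel g a c e i p.
Proof.
have -> : christoffel g a c i e p = Gam i p c e by rewrite mxE.
have -> : christoffel g a c e i p = Gam e p c i by rewrite mxE.
rewrite !GamE !mxE; congr (_ * _); apply: eq_bigr => s _; congr (_ * _); rewrite !mxE.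
by rewrite (pd_metric_sym s i e); congr (_ - _); rewrite addrC.
Qed.

Lemma dmx_metric i : dmx a i (g a) p = g a p *m Gam i p + (g a p *m Gam i p)^T.
Proof.
rewrite mul_Gam; apply/matrixP => s t; rewrite !mxE -mulrDr.
rewrite (pd_metric_sym i t s) (pd_metric_sym t s i) (pd_metric_sym s t i).
set x := pd _ _ _ _; set y := pd _ _ _ _; set z := pd _ _ _ _; by field.
Qed.

(** Koszul's argument: adding and subtracting the compatibility equation with cyclically permuted
    indices isolates one symbol. Through this uniqueness the Christoffel symbols in another chart or
    scale are recognised by checking symmetry and compatibility of a candidate. *)
Lemma Gam_unique (G : 'I_n.+1 -> 'M[R]_n.+1) : (forall i c e, G i c e = G e c i) ->
  (forall i, dmx a i (g a) p = g a p *m G i + (g a p *m G i)^T) ->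
  forall i, Gam i p = G i.
Proof.
move=> Gs HG i; apply: (can_inj (mulKmx gp_unit)); rewrite mul_Gam.
have Hs k s t : (g a p *m G k) s t = (g a p *m G t) s k.
  by rewrite !mxE; apply: eq_bigr => c _; rewrite Gs.
have HG' k s t : pd a k (fun q => g a q s t) p = (g a p *m G k) s t + (g a p *m G k) t s.
  have /matrixP/(_ s t) := HG k; rewrite [LHS]mxE => ->.
  by rewrite [LHS]mxE [X in _ + X]mxE.
apply/matrixP => s e; rewrite mxE [Low _ _ _ _]mxE !HG' (Hs e s i) (Hs e i s) (Hs i e s).
set x := (_ *m G i) s e; set y := (_ *m G s) e i; set z := (_ *m G s) i e; by field.
Qed.

Lemma dmx_inv_metric i : dmx a i (fun q => invmx (g a q)) p =
  - (Gam i p *m invmx (g a p) + invmx (g a p) *m (Gam i p)^T).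
Proof.
case: hg => _ Hu _; rewrite dmx_invmx // dmx_metric trmx_mul gp_sym mulmxDr mulmxDl.
by rewrite mulKmx // mulmxA mulmxK.
Qed.

Lemma smm_inv_metric : smm a p (fun q => invmx (g a q)).
Proof. by case: hg => _ Hu Hs; exact: smm_invmx. Qed.

Lemma sm_christoffel c i e : sm a p (christoffel g a c i e).
Proof.
apply: smM; first exact: sm_cst.
apply: sm_sum => s _; apply: smM; first exact: smm_inv_metric.
by apply: smB; [apply: smD|]; apply: sm_pd.
Qed.

(* [nab], [ed] and [del] are Defs' nabla, ext_d and codiff in a fixed scale and
   chart, on fields that are not indexed by the scale; [cov] is nabla on 1-forms. *)
Definition nab i A p : ext := dx a i A p - derv (fun c e => christoffel g a c i e p) (A p).
Definition ed A p : ext := \sum_i ext_basis i (nab i A p).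
Definition del A p : ext := \sum_i \sum_j invmx (g a p) i j *: int_basis i (nab j A p).
Definition cov i u p e : R := pd a i (u e) p - \sum_c christoffel g a c i e p * u c p.
(* interior multiplication by the vector metrically dual to dx^j *)
Definition iup q j : ext -> ext := int_vec (fun i => invmx (g a q) i j).
HB.instance Definition _ q j := GRing.Linear.copy (iup q j) (int_vec (fun i => invmx (g a q) i j)).

Lemma int_mul_iup q (v : 'I_n.+1 -> R) (C : ext) : int_mul (g a q) v C = \sum_j v j *: iup q j C.
Proof.
rewrite /int_mul exchange_big; apply: eq_bigr => j _ /=; rewrite scaler_sumr.
by apply: eq_bigr => i _; rewrite scalerA mulrC.
Qed.

Lemma delE A q : del A q = \sum_j iup q j (nab j A q).
Proof. by rewrite /del exchange_big. Qed.

Lemma nab_near_eq i A B : near_pt a p (fun q => A q = B q) -> nab i A p = nab i B p.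
Proof. by move=> AB; rewrite /nab (dx_near_eq hM i dp AB) (near_pt_at dp AB). Qed.

Lemma ed_near_eq A B : near_pt a p (fun q => A q = B q) -> ed A p = ed B p.
Proof. by move=> AB; apply: eq_bigr => i _; rewrite (nab_near_eq i AB). Qed.

Lemma del_near_eq A B : near_pt a p (fun q => A q = B q) -> del A p = del B p.
Proof. by move=> AB; apply: eq_bigr => i _; apply: eq_bigr => j _; rewrite (nab_near_eq j AB). Qed.

Lemma nabD i A B : dfx a p A -> dfx a p B ->
  nab i (fun q => A q + B q) p = nab i A p + nab i B p.
Proof. by move=> hA hB; rewrite /nab dxD // linearD /= opprD addrACA. Qed.

Lemma nabZ i f A : dfr a p f -> dfx a p A ->
  nab i (fun q => f q *: A q) p = pd a i f p *: A p + f p *: nab i A p.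
Proof. by move=> hf hA; rewrite /nab dxZ // dervZ scalerBr addrA. Qed.

Lemma edD A B : dfx a p A -> dfx a p B -> ed (fun q => A q + B q) p = ed A p + ed B p.
Proof.
by move=> hA hB; rewrite /ed -big_split; apply: eq_bigr => i _; rewrite nabD // linearD.
Qed.

Lemma delD A B : dfx a p A -> dfx a p B -> del (fun q => A q + B q) p = del A p + del B p.
Proof.
by move=> hA hB; rewrite !delE -big_split; apply: eq_bigr => i _; rewrite nabD // linearD.
Qed.

Lemma edZ f A : dfr a p f -> dfx a p A ->
  ed (fun q => f q *: A q) p = ext_mul (fun i => pd a i f p) (A p) + f p *: ed A p.
Proof.
move=> hf hA; rewrite /ed /ext_mul scaler_sumr -big_split; apply: eq_bigr => i _ /=.
by rewrite nabZ // linearD /= !ext_basisZ.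
Qed.

Lemma delZ f A : dfr a p f -> dfx a p A ->
  del (fun q => f q *: A q) p = int_mul (g a p) (fun i => pd a i f p) (A p) + f p *: del A p.
Proof.
move=> hf hA; rewrite !delE int_mul_iup scaler_sumr -big_split; apply: eq_bigr => i _ /=.
by rewrite nabZ // linearD; congr (_ + _); rewrite linearZ.
Qed.

(** The Christoffel symbols are symmetric in the two lower indices, which meet two anticommuting
    multiplications. The exterior derivative thus does not depend on the metric, which [ed_conf]
    exploits. *)
Lemma edE A : ed A p = \sum_i ext_basis i (dx a i A p).
Proof.
rewrite /ed /nab.
under eq_bigr do rewrite linearB /=.
rewrite sumrB [X in _ - X](_ : _ = 0) ?subr0 //.
apply: ext_eqN0; rewrite -sumrN /derv.
under eq_bigr do rewrite linear_sum.
under [RHS]eq_bigr do rewrite linear_sum -sumrN.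
rewrite exchange_big; apply: eq_bigr => i _; apply: eq_bigr => j _ /=.
rewrite (linear_sum (ext_basis j)) (linear_sum (ext_basis i)) -sumrN /=; apply: eq_bigr => c _ /=.
by rewrite !ext_basisZ ext_extC scalerN christoffel_sym.
Qed.

Lemma smx_nb i A : smx a p A -> smx a p (nab i A).
Proof.
move=> hA; apply: smxB; first exact: smx_dx.
by apply: smx_derv => // c e; exact: sm_christoffel.
Qed.

Lemma smx_ed A : smx a p A -> smx a p (ed A).
Proof. by move=> hA; apply: smx_sum => i _; apply: (@smx_lin _ _ _ (ext_basis i)); exact: smx_nb. Qed.

Lemma smx_del A : smx a p A -> smx a p (del A).
Proof.
move=> hA; apply: smx_sum => i _; apply: smx_sum => j _; apply: smxZ; first exact: smm_inv_metric.
by apply: (@smx_lin _ _ _ (int_basis i)); exact: smx_nb.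
Qed.

Lemma nab_ext_mul i u A : (forall j, dfr a p (u j)) -> dfx a p A ->
  nab i (fun q => ext_mul (u^~ q) (A q)) p =
  ext_mul (cov i u p) (A p) + ext_mul (u^~ p) (nab i A p).
Proof.
move=> hu hA; rewrite /nab dx_ext_mul // derv_ext linearB /= opprD.
rewrite [- ext_mul _ _ + _]addrC addrACA; congr (_ + _).
by rewrite -scaleN1r -ext_mulZl -ext_mulDl; apply: eq_ext_mul => e; rewrite mulN1r.
Qed.

Lemma dfr_raise u c : (forall j, dfr a p (u j)) ->
  dfr a p (fun q => \sum_j invmx (g a q) c j * u j q).
Proof. by move=> hu; apply: dfr_sum => j _; apply: dfrM => //; exact/sm_dfr/smm_inv_metric. Qed.

Lemma sm_raise u c : (forall j, sm a p (u j)) ->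
  sm a p (fun q => \sum_j invmx (g a q) c j * u j q).
Proof. by move=> hu; apply: sm_sum => j _; apply: smM => //; exact: smm_inv_metric. Qed.

Lemma smx_int_mul u A : (forall j, sm a p (u j)) -> smx a p A ->
  smx a p (fun q => int_mul (g a q) (u^~ q) (A q)).
Proof.
move=> hu hA; apply: (@smx_eq _ _ _ _ _
  (fun q => int_vec (fun c => \sum_j invmx (g a q) c j * u j q) (A q))).
  by move=> q _; rewrite int_mulE.
by apply: (@smx_int_vec _ _ _ _ _ (fun c q => \sum_j invmx (g a q) c j * u j q)) => // c; exact: sm_raise.
Qed.

(** Raising an index commutes with covariant differentiation, because the inverse metric is parallel
    ([dmx_inv_metric]). *)
Lemma pd_raise i u c : (forall j, dfr a p (u j)) ->
  pd a i (fun q => \sum_j invmx (g a q) c j * u j q) p +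
    \sum_e christoffel g a c i e p * (\sum_j invmx (g a p) e j * u j p) =
  \sum_j invmx (g a p) c j * cov i u p j.
Proof.
move=> hu; pose U q : 'cV[R]_n.+1 := \col_j u j q.
have hU : dfm a p U by move=> s t; apply: dfr_near_eq (hu s); apply: near_ptT => q _; rewrite mxE.
have raiseE q e : \sum_j invmx (g a q) e j * u j q = (invmx (g a q) *m U q) e ord0.
  by rewrite mxE; apply: eq_bigr => j _; rewrite mxE.
have -> : pd a i (fun q => \sum_j invmx (g a q) c j * u j q) p =
  (dmx a i (fun q => invmx (g a q) *m U q) p) c ord0.
  by rewrite mxE; apply: pd_eq => // q _; rewrite raiseE.
rewrite dmxM //; last exact/smm_dfm/smm_inv_metric.
rewrite dmx_inv_metric.
have -> : \sum_e christoffel g a c i e p * (\sum_j invmx (g a p) e j * u j p) =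
   (Gam i p *m (invmx (g a p) *m U p)) c ord0.
  by rewrite [RHS]mxE; apply: eq_bigr => e _; rewrite raiseE [Gam i p c e]mxE.
have -> : \sum_j invmx (g a p) c j * cov i u p j =
   (invmx (g a p) *m (dmx a i U p - (Gam i p)^T *m U p)) c ord0.
  rewrite [RHS]mxE; apply: eq_bigr => e _; congr (_ * _); rewrite [RHS]mxE [X in _ + X]mxE; congr (_ - _).
    rewrite mxE; by apply: pd_eq => // q _; rewrite mxE.
  by rewrite mxE; apply: eq_bigr => j _; rewrite !mxE.
transitivity ((- (Gam i p *m invmx (g a p) + invmx (g a p) *m (Gam i p)^T) *m U p +
   invmx (g a p) *m dmx a i U p + Gam i p *m (invmx (g a p) *m U p)) c ord0).
  by rewrite [RHS]mxE.
congr (fun_of_matrix _ c ord0).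
rewrite mulNmx mulmxDl mulmxBr !mulmxA.
by rewrite addrAC opprD [X in X + _ + _]addrC addrNK addrC.
Qed.

Lemma nab_int_mul i u A : (forall j, dfr a p (u j)) -> dfx a p A ->
  nab i (fun q => int_mul (g a q) (u^~ q) (A q)) p =
  int_mul (g a p) (cov i u p) (A p) + int_mul (g a p) (u^~ p) (nab i A p).
Proof.
move=> hu hA; pose w c q := \sum_j invmx (g a q) c j * u j q.
have hw c : dfr a p (w c) by exact: dfr_raise.
rewrite (@nab_near_eq _ _ (fun q => int_vec (w^~ q) (A q))); last first.
  by apply: near_ptT => q _; rewrite int_mulE.
rewrite /nab dx_int_vec // derv_int !int_mulE opprB [int_vec _ (_ - _)]linearB /=.
rewrite addrACA; congr (_ + _).
rewrite -int_vecDl; apply: eq_int_vec => c; exact: pd_raise.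
Qed.

(** The symmetry assumption says that [u] is closed; the term with its derivative is then a
    symmetric matrix contracted with two anticommuting interior products. What remains is the
    anticommutation of iota(u) with the interior products in delta. *)
Lemma del_int_mul u A : (forall j, dfr a p (u j)) -> dfx a p A ->
  (forall i j, cov i u p j = cov j u p i) ->
  del (fun q => int_mul (g a q) (u^~ q) (A q)) p = - int_mul (g a p) (u^~ p) (del A p).
Proof.
move=> hu hA us; rewrite !delE.
under eq_bigr do rewrite nab_int_mul // linearD /=.
rewrite big_split /= [X in X + _](_ : _ = 0).
  rewrite add0r (linear_sum (int_mul _ _)) -sumrN; apply: eq_bigr => j _ /=.
  by rewrite !int_mulE /iup int_vecC.
have E k : iup p k (int_mul (g a p) (cov k u p) (A p)) =
    \sum_i cov k u p i *: iup p k (iup p i (A p)).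
  rewrite int_mul_iup (linear_sum (iup p k)); apply: eq_bigr => i _; exact: int_vecZ.
apply: ext_eqN0; under eq_bigr do rewrite E.
rewrite {1}exchange_big -sumrN; apply: eq_bigr => i _; rewrite -sumrN; apply: eq_bigr => j _ /=.
by rewrite /iup int_vecC scalerN us.
Qed.

(** Besides algebraic terms in the derivative of [u], this contains the covariant derivative along
    the vector dual to [u]. The same first-order term appears in [ed_int_mul], so that it can be
    eliminated between the two. *)
Lemma del_ext_mul u A : (forall j, dfr a p (u j)) -> dfx a p A ->
  del (fun q => ext_mul (u^~ q) (A q)) p + ext_mul (u^~ p) (del A p) =
  (\sum_j \sum_i invmx (g a p) i j * cov j u p i) *: A p
  - derv (fun c e => \sum_j invmx (g a p) c j * cov j u p e) (A p)
  + \sum_j (\sum_i invmx (g a p) i j * u i p) *: nab j A p.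
Proof.
move=> hu hA; rewrite !delE (linear_sum (ext_mul _)) -big_split /=.
rewrite (eq_bigr (fun j => (\sum_i invmx (g a p) i j * cov j u p i) *: A p
  - ext_mul (cov j u p) (iup p j (A p)) + (\sum_i invmx (g a p) i j * u i p) *: nab j A p)); last first.
  by move=> j _; rewrite nab_ext_mul // linearD /= /iup !int_vec_ext -!addrA addNr addr0.
rewrite big_split sumrB -scaler_suml /=; congr (_ - _ + _).
rewrite /derv /ext_mul exchange_big; apply: eq_bigr => e _ /=.
rewrite (eq_bigr (fun j => \sum_c (invmx (g a p) c j * cov j u p e) *: ext_basis e (int_basis c (A p)))); last first.
  move=> j _; rewrite /iup /int_vec linear_sum scaler_sumr; apply: eq_bigr => c _.
  by rewrite linearZ /= scalerA mulrC.
by rewrite exchange_big; apply: eq_bigr => c _ /=; rewrite scaler_suml.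
Qed.

(** Cartan's formula: the left side is the Lie derivative along the vector dual to [u], written out
    with the Levi-Civita connection. *)
Lemma ed_int_mul u A : (forall j, dfr a p (u j)) -> dfx a p A ->
  ed (fun q => int_mul (g a q) (u^~ q) (A q)) p + int_mul (g a p) (u^~ p) (ed A p) =
  derv (fun c e => \sum_j invmx (g a p) c j * cov e u p j) (A p)
  + \sum_i (\sum_j invmx (g a p) i j * u j p) *: nab i A p.
Proof.
move=> hu hA; rewrite /ed [X in _ + X]int_mulE (linear_sum (int_vec _)) -big_split /=.
rewrite (eq_bigr (fun i => ext_basis i (int_mul (g a p) (cov i u p) (A p)) +
  (\sum_j invmx (g a p) i j * u j p) *: nab i A p)); last first.
  move=> i _; rewrite nab_int_mul // linearD /= -addrA; congr (_ + _).
  rewrite int_mulE -!ext_mul_delta int_vec_ext addrCA addrN addr0.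
  by rewrite sum_delta.
rewrite big_split /=; congr (_ + _); apply: eq_bigr => e _.
by rewrite int_mulE /int_vec linear_sum; apply: eq_bigr => c _; rewrite linearZ.
Qed.

End At.
End LeviCivita.

Lemma linearZ_pullback {R : realType} {m : nat} (J : 'M[R]_m) x (E : exterior R m) :
  ext_pullback J (x *: E) = x *: ext_pullback J E.
Proof. exact: linearZ. Qed.

Lemma derv_pullback {R : realType} {m : nat} (J C D : 'M[R]_m) (E : exterior R m) :
  J *m C = D *m J ->
  derv (fun c e => C c e) (ext_pullback J E) = ext_pullback J (derv (fun c e => D c e) E).
Proof.
move=> JC.
have -> : derv (fun c e => C c e) (ext_pullback J E) =
    \sum_e \sum_h (J *m C) h e *: ext_basis e (ext_pullback J (int_basis h E)).
  apply: eq_bigr => e _; under eq_bigr do rewrite int_basis_pullback linear_sum scaler_sumr.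
  rewrite exchange_big; apply: eq_bigr => h _; rewrite mxE scaler_suml.
  by apply: eq_bigr => c _; rewrite linearZ /= scalerA mulrC.
rewrite JC /derv exchange_big [in RHS]exchange_big (linear_sum (ext_pullback J)).
apply: eq_bigr => h _; rewrite (linear_sum (ext_pullback J)) /=.
under [RHS]eq_bigr do rewrite linearZ /= ext_pullback_basis /ext_mul scaler_sumr.
rewrite [RHS]exchange_big; apply: eq_bigr => e _; rewrite mxE scaler_suml.
by apply: eq_bigr => c _; rewrite scalerA.
Qed.

Lemma int_vec_pullback {R : realType} {m : nat} (J : 'M[R]_m) (v : 'I_m -> R) (E : exterior R m) :
  int_vec v (ext_pullback J E) = ext_pullback J (int_vec (fun i => \sum_j J i j * v j) E).
Proof.
rewrite {1}/int_vec; under eq_bigr do rewrite int_basis_pullback scaler_sumr.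
rewrite exchange_big [in RHS]/int_vec (linear_sum (ext_pullback J)); apply: eq_bigr => i _ /=.
rewrite linearZ_pullback scaler_suml; apply: eq_bigr => j _ /=.
by rewrite scalerA mulrC.
Qed.

(** * The square of the codifferential vanishes *)

Section DelDel.
Context {R : realType} {n : nat} {M : chart_space R n.+1}.
Hypothesis hM : manifold_with_boundary M.
Local Notation ext := (exterior R n.+1).
Implicit Types (g : metric M) (a b : chart M) (p q : M) (f : M -> R) (i j k c e : 'I_n.+1)
  (A B E : M -> ext) (u v : 'I_n.+1 -> M -> R).

(** The contracted Christoffel symbol, which is the logarithmic derivative of the Riemannian volume
    density (compare [gamE]). *)
Definition gam g a l q : R := \sum_j christoffel g a j j l q.
(** The divergence of [E] read as a multivector field. Since [ext_pullback (g a q)] lowers all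
    indices, delta becomes an operator in which only the trace [gam] of the connection is left, and
    its square can be computed without any curvature term. *)
Definition dv g a E q : ext := \sum_j int_basis j (dx a j E q) + int_vec (fun l => gam g a l q) (E q).

(** Lowering indices commutes with covariant differentiation by metric compatibility. Of the
    connection terms only the trace survives, the others being symmetric coefficients of two
    anticommuting interior products. *)
Lemma del_pullback g a p E : dom a p -> metric_at g a p -> dfx a p E ->
  del g a (fun q => ext_pullback (g a q) (E q)) p = ext_pullback (g a p) (dv g a E p).
Proof.
move=> dp hg hE; have [gs gu gsm] := hg.
have gp_u : g a p \in unitmx by exact: near_pt_at gu.
have gp_s : (g a p)^T = g a p by exact: near_pt_at gs.
have nbE i : nab g a i (fun q => ext_pullback (g a q) (E q)) p =
   ext_pullback (g a p) (dx a i E p + derv (fun c e => christoffel g a e i c p) (E p)).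
  rewrite /nab dx_pullback //; last exact: smm_dfm.
  rewrite linearD -addrA; congr (_ + _).
  rewrite -scaleN1r -dervZl -dervDl.
  have -> : derv (fun c e => christoffel g a e i c p) (E p) =
      derv (fun c e => (Gam g a i p)^T c e) (E p) by apply: eq_derv => c e; rewrite !mxE.
  rewrite /= -(@derv_pullback _ _ _ (invmx (g a p) *m (Gam g a i p)^T *m g a p)); last first.
    by rewrite -mulmxA mulKVmx.
  apply: eq_derv => c e; rewrite dmx_metric // mulmxDr mulKmx // trmx_mul gp_s -mulmxA.
  by rewrite mxE [Gam g a i p c e]mxE mulN1r addrAC addrN add0r.
rewrite delE /dv linearD /= (linear_sum (ext_pullback (g a p))) /=.
have iupE j X : iup g a p j (ext_pullback (g a p) X) = ext_pullback (g a p) (int_basis j X).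
  rewrite /iup int_vec_pullback; congr ext_pullback; rewrite -int_vec_delta.
  apply: eq_int_vec => i; have /matrixP/(_ i j) := mulmxV gp_u; rewrite !mxE => ->.
  by [].
under eq_bigr do rewrite nbE iupE linearD linearD /=.
rewrite big_split /=; congr (_ + _).
rewrite -(linear_sum (ext_pullback (g a p))) /=; congr ext_pullback.
have -> : \sum_j int_basis j (derv (fun c e => christoffel g a e j c p) (E p)) =
  \sum_j derv (fun c e => christoffel g a e j c p) (int_basis j (E p)) +
  int_vec (gam g a ^~ p) (E p).
  rewrite /gam; have -> : int_vec (fun l => \sum_j christoffel g a j j l p) (E p) =
     \sum_j int_vec (fun l => christoffel g a j j l p) (E p).
    rewrite /int_vec exchange_big; apply: eq_bigr => j _ /=; by rewrite scaler_suml.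
  by rewrite -big_split; apply: eq_bigr => j _ /=; rewrite derv_int_basis subrK.
rewrite [X in X + _](_ : _ = 0) ?add0r //.
apply: ext_eqN0; rewrite -sumrN /derv.
rewrite [LHS]exchange_big; under [RHS]eq_bigr do rewrite -sumrN.
rewrite [RHS]exchange_big; apply: eq_bigr => e _ /=.
under [RHS]eq_bigr do rewrite -sumrN.
rewrite exchange_big; apply: eq_bigr => c _; apply: eq_bigr => j _ /=.
by rewrite int_intC linearN /= scalerN christoffel_sym.
Qed.

Lemma sm_gam g a p l : dom a p -> metric_at g a p -> sm a p (gam g a l).
Proof. by move=> dp hg; apply: sm_sum => j _; exact: sm_christoffel. Qed.

Lemma gamE g a p l : dom a p -> metric_at g a p ->
  gam g a l p = 2^-1 * \tr (invmx (g a p) *m dmx a l (g a) p).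
Proof.
move=> dp hg; have [gs gu gsm] := hg.
have gp_u : g a p \in unitmx by exact: near_pt_at gu.
have gp_s : (g a p)^T = g a p by exact: near_pt_at gs.
rewrite dmx_metric // mulmxDr mulKmx // mxtraceD trmx_mul gp_s mxtrace_mulC mulmxK // mxtrace_tr.
have -> : gam g a l p = \tr (Gam g a l p).
  by apply: eq_bigr => j _; rewrite mxE christoffel_sym.
set t := \tr _; by field.
Qed.

(** A logarithmic derivative is closed. In terms of [gamE] this is the symmetry of the second
    derivatives of the metric together with the cyclicity of the trace. *)
Lemma pd_gam g a p i l : dom a p -> metric_at g a p ->
  pd a i (gam g a l) p = pd a l (gam g a i) p.
Proof.
move=> dp hg; have [gs gu gsm] := hg.
have nl := metric_at_near hg.
have sd k : smm a p (dmx a k (g a)).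
  by move=> s t; apply: sm_eq (sm_pd hM k dp (gsm s t)) => q _; rewrite mxE.
have sQ : smm a p (fun q => invmx (g a q)) by exact: smm_inv_metric.
have H k r : pd a k (gam g a r) p = 2^-1 *
   (\tr (invmx (g a p) *m dmx a k (dmx a r (g a)) p)
    - \tr (invmx (g a p) *m dmx a k (g a) p *m invmx (g a p) *m dmx a r (g a) p)).
  rewrite (pd_near_eq hM k dp (near_ptS (fun q dq h => gamE r dq h) nl)).
  rewrite pdZ //; last first.
    by apply/sm_dfr; apply: sm_sum => s _; exact: smmM.
  congr (_ * _); rewrite pd_sum //; last by move=> s _; exact/sm_dfr/smmM.
  rewrite -raddfB /=; apply: eq_bigr => s _.
  transitivity ((dmx a k (fun q => invmx (g a q) *m dmx a r (g a) q) p) s s).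
    by rewrite mxE.
  rewrite dmxM //; try exact: smm_dfm.
  by rewrite dmx_invmx // mulNmx addrC.
have C1 : dmx a i (dmx a l (g a)) p = dmx a l (dmx a i (g a)) p.
  apply/matrixP => s t; rewrite [LHS]mxE [RHS]mxE.
  have E k r : pd a k (fun q => dmx a r (g a) q s t) p = pd a k (pd a r (fun q => g a q s t)) p.
    by apply: pd_eq => // q _; rewrite mxE.
  by rewrite [LHS]E [RHS]E; apply: pd_comm.
rewrite (H i l). rewrite (H l i). rewrite C1.
have C2 (K L N : 'M[R]_n.+1) : \tr (N *m K *m N *m L) = \tr (N *m L *m N *m K).
  by rewrite -mulmxA mxtrace_mulC mulmxA.
by rewrite C2.
Qed.

Lemma smx_dv g a p E : dom a p -> metric_at g a p -> smx a p E -> smx a p (dv g a E).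
Proof.
move=> dp hg hE; apply: smxD.
  by apply: smx_sum => j _; apply: (@smx_lin _ _ _ (int_basis j)); exact: smx_dx.
by apply: smx_int_vec => // l; exact: sm_gam.
Qed.

(** Three cancellations by antisymmetry: second derivatives commute, [gam] is closed, and the mixed
    terms anticommute. *)
Lemma dv_dv g a p E : dom a p -> metric_at g a p -> smx a p E -> dv g a (dv g a E) p = 0.
Proof.
move=> dp hg hE.
have sdx j : smx a p (dx a j E) by exact: smx_dx.
have sii k j : smx a p (fun q => int_basis k (dx a j E q)).
  by apply: (@smx_lin _ _ _ (int_basis k)).
have sgm l : dfr a p (gam g a l) by exact/sm_dfr/sm_gam.
have D k : dx a k (dv g a E) p = \sum_j int_basis j (dx a k (dx a j E) p) +
   (int_vec (fun l => pd a k (gam g a l) p) (E p) + int_vec (gam g a ^~ p) (dx a k E p)).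
  rewrite /dv dxD //.
  - rewrite dx_sum //; last by move=> j _; exact: smx_dfx.
    rewrite dx_int_vec //; last exact: smx_dfx.
    congr (_ + _); apply: eq_bigr => j _.
    by rewrite (@dx_lin _ _ _ _ (int_basis j)) //; exact: smx_dfx.
  - by apply: dfx_sum => j _; exact: smx_dfx.
  by apply: dfx_int_vec => //; exact: smx_dfx.
rewrite {1}/dv /=.
under eq_bigr do rewrite D !linearD /=.
rewrite !big_split /=.
have -> : \sum_i int_basis i (\sum_j int_basis j (dx a i (dx a j E) p)) = 0.
  apply: ext_eqN0; rewrite -sumrN.
  under eq_bigr do rewrite linear_sum.
  under [RHS]eq_bigr do rewrite linear_sum -sumrN.
  rewrite exchange_big; apply: eq_bigr => i _; apply: eq_bigr => j _ /=.
  by rewrite int_intC dx_comm.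
have -> : \sum_i int_basis i (int_vec (fun l => pd a i (gam g a l) p) (E p)) = 0.
  apply: ext_eqN0; rewrite -sumrN.
  under eq_bigr do rewrite linear_sum.
  under [RHS]eq_bigr do rewrite linear_sum -sumrN.
  rewrite exchange_big; apply: eq_bigr => i _; apply: eq_bigr => j _ /=.
  by rewrite !int_basisZ int_intC scalerN pd_gam.
rewrite /dv !add0r linearD /= int_vec_sqr addr0 (linear_sum (int_vec _)) -big_split.
rewrite big1 // => i _ /=.
by rewrite -!int_vec_delta int_vecC addNr.
Qed.

Lemma del_del g a p A : dom a p -> metric_at g a p -> smx a p A -> del g a (del g a A) p = 0.
Proof.
move=> dp hg hA; have [gs gu gsm] := hg.
(* All indices of [A] are raised, so that [del_pullback] applies twice. *)
pose E q := ext_pullback (invmx (g a q)) (A q).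
have sQ : smm a p (fun q => invmx (g a q)) by exact: smm_inv_metric.
have hE : smx a p E by exact: smx_pullback.
have AE : near_pt a p (fun q => A q = ext_pullback (g a q) (E q)).
  apply: near_ptS gu => q _ gq.
  by rewrite /E ext_pullback_comp mulVmx // ext_pullback_id.
have nE : near_pt a p (fun q => dfx a q E).
  apply: (@filterS _ (nbhs (crd a p)) _ (fun y => forall S, forall q, dom a q -> crd a q = y ->
     sm a q (fun q => E q S))).
    by move=> y H q dq yq S; apply/sm_dfr; exact: H.
  apply: (@filter_forall _ _ (fun S y => forall q, dom a q -> crd a q = y ->
     sm a q (fun q => E q S)) (nbhs (crd a p))) => S.
  exact: sm_near (hE S).
have dE : near_pt a p (fun q => del g a A q = ext_pullback (g a q) (dv g a E q)).
  have H1 := near_ptS2 (fun q _ x y => conj x y) (near_pt_join AE) (metric_at_near hg).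
  apply: near_ptS2 H1 nE => q dq [H1 H2] H3.
  by rewrite (del_near_eq hM g dq H1) del_pullback.
rewrite (del_near_eq hM g dp dE) del_pullback //; last exact/smx_dfx/smx_dv.
by rewrite dv_dv // linear0.
Qed.

End DelDel.

(** * Change of chart and of scale *)

Section Charts.
Context {R : realType} {n : nat} {M : chart_space R n.+1}.
Hypothesis hM : manifold_with_boundary M.
Local Notation ext := (exterior R n.+1).
Implicit Types (i j k c e : 'I_n.+1) (A B E : M -> ext) (u v : 'I_n.+1 -> M -> R).
Variables (g : metric M) (a b : chart M) (p : M).
Hypotheses (dap : dom a p) (dbp : dom b p) (hga : metric_at g a p) (hgb : metric_at g b p).
Variable J : M -> 'M[R]_n.+1.
Hypothesis JE : J = jacobian a b.
Hypothesis ht : forall q, dom a q -> dom b q -> g a q = (J q)^T *m g b q *m J q.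

Let gaU : g a p \in unitmx. Proof. by case: hga => _ H _; exact: near_pt_at H. Qed.
Let gbU : g b p \in unitmx. Proof. by case: hgb => _ H _; exact: near_pt_at H. Qed.
Let gbS : (g b p)^T = g b p. Proof. by case: hgb => H _ _; exact: near_pt_at H. Qed.

(** Read off from the transformation law, in which the invertible matrix [g a p] has [J p] as a
    factor. *)
Lemma jacobian_unit : J p \in unitmx.
Proof. by have := gaU; rewrite ht // !unitmx_mul => /andP[]. Qed.
Let JU := jacobian_unit.

Lemma dfm_jacobian : dfm a p J.
Proof. by rewrite JE => s t; exact/sm_dfr/sm_jacobian. Qed.

Lemma inv_metric_chart : J p *m invmx (g a p) *m (J p)^T = invmx (g b p).
Proof.
have JtU : (J p)^T \in unitmx by rewrite unitmx_tr.
have H : J p *m invmx (g a p) *m (J p)^T *m g b p = 1%:M.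
  apply: (can_inj (mulmxK JU)); rewrite -!mulmxA (mulmxA (J p)^T) -ht //.
  by rewrite mulVmx // mulmx1 mul1mx.
by rewrite -[LHS](mulmxK gbU) H mul1mx.
Qed.

Lemma dfx_chart B : dfx b p B -> dfx a p B.
Proof. by move=> hB S; have [] := dfr_chart hM dap dbp (hB S). Qed.

Lemma dx_chart i B : dfx b p B -> dx a i B p = \sum_j J p j i *: dx b j B p.
Proof.
move=> hB; apply/ffunP => S; rewrite sum_ffunE ffunE.
have [_ ->] := dfr_chart hM dap dbp (hB S); rewrite -JE.
by apply: eq_bigr => j _; rewrite !ffunE.
Qed.

Lemma dmx_chart i (k l : nat) (K : M -> 'M[R]_(k, l)) : dfm b p K ->
  dmx a i K p = \sum_j J p j i *: dmx b j K p.
Proof.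
move=> hK; apply/matrixP => s t; rewrite summxE mxE.
have [_ ->] := dfr_chart hM dap dbp (hK s t); rewrite -JE.
by apply: eq_bigr => j _; rewrite !mxE.
Qed.

Lemma dfm_chart (k l : nat) (K : M -> 'M[R]_(k, l)) : dfm b p K -> dfm a p K.
Proof. by move=> hK s t; have [] := dfr_chart hM dap dbp (hK s t). Qed.

Definition GamJ i : 'M[R]_n.+1 := \sum_j J p j i *: Gam g b j p.

(** The inhomogeneous transformation law, by uniqueness: symmetry of the candidate comes from
    [pd_jacobian], compatibility from differentiating the transformation law of the metric. *)
Lemma Gam_chart i : Gam g a i p = invmx (J p) *m (GamJ i *m J p + dmx a i J p).
Proof.
have [Y YE] : exists Y : 'I_n.+1 -> 'M[R]_n.+1, forall i, GamJ i *m J p + dmx a i J p = Y i.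
  by exists (fun i => GamJ i *m J p + dmx a i J p).
rewrite YE.
apply: (Gam_unique dap hga (G := fun i => invmx (J p) *m Y i) _ _ i) => {}i.
  have Ys k e f : Y k f e = Y e f k.
    have E1 : dmx a k J p f e = dmx a e J p f k.
      by rewrite [LHS]mxE [RHS]mxE JE; exact: pd_jacobian.
    have E s t : (GamJ s *m J p) f t = \sum_l \sum_j J p j s * christoffel g b f j l p * J p l t.
      rewrite mxE; apply: eq_bigr => l _; rewrite summxE mulr_suml; apply: eq_bigr => j _.
      by congr (_ * _); rewrite mxE; congr (_ * _); rewrite mxE.
    have E2 : (GamJ k *m J p) f e = (GamJ e *m J p) f k.
      rewrite !E exchange_big; apply: eq_bigr => l _; apply: eq_bigr => j _ /=.
      by rewrite (christoffel_sym hM dbp hgb); ring.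
    by rewrite -!YE [LHS]mxE [RHS]mxE E1 E2.
  move=> c e; rewrite mxE [RHS]mxE; apply: eq_bigr => f _; by rewrite Ys.
have gbd : dfm a p (g b) by apply: dfm_chart; case: hgb => _ _ /smm_dfm.
have Jd := dfm_jacobian.
have -> : dmx a i (g a) p = dmx a i (fun q => (J q)^T *m g b q *m J q) p.
  apply: dmx_near_eq => //; apply: near_ptS (near_dom hM dap dbp) => q da db; exact: ht.
rewrite !dmxM //; try apply: dfmM => //; try exact: dfmT.
have gbb : dfm b p (g b) by case: hgb => _ _ /smm_dfm.
rewrite dmxT // (dmx_chart i gbb).
have -> : \sum_j J p j i *: dmx b j (g b) p = g b p *m GamJ i + (g b p *m GamJ i)^T.
  rewrite /GamJ mulmx_sumr raddf_sum -big_split; apply: eq_bigr => j _.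
  by rewrite /= dmx_metric // scalerDr -scalemxAr [in RHS]linearZ.
have -> : g a p *m (invmx (J p) *m Y i) = (J p)^T *m g b p *m Y i.
  by rewrite ht // -!mulmxA mulKVmx.
rewrite -YE !mulmxDr !mulmxDl !linearD /= !trmx_mul trmxK gbS !mulmxA.
set x := _ *m _; set y := _ *m J p; set z := _ *m J p; set w := _ *m _.
by rewrite addrCA addrAC [x + z]addrC.
Qed.

(** The inhomogeneous term of [Gam_chart] cancels the derivative of the Jacobian produced by
    [dx_pullback]. *)
Lemma nb_chart i B : dfx b p B ->
  nab g a i (fun q => ext_pullback (J q) (B q)) p =
  \sum_j J p j i *: ext_pullback (J p) (nab g b j B p).
Proof.
move=> hB; have hBa := dfx_chart hB.
rewrite /nab dx_pullback //; last exact: dfm_jacobian.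
rewrite dx_chart //.
rewrite -addrA -scaleN1r -dervZl -dervDl.
rewrite -(@eq_derv _ _ (fun c e => (- (invmx (J p) *m GamJ i *m J p)) c e)); last first.
  move=> c e; have -> : christoffel g a c i e p = Gam g a i p c e by rewrite mxE.
  rewrite Gam_chart mulmxDr !mulmxA mulN1r [LHS]mxE [in X in _ - X]mxE.
  by rewrite opprD addrCA addrN addr0.
rewrite (@derv_pullback _ _ _ _ (- GamJ i)); last first.
  by rewrite mulmxN mulNmx -!mulmxA mulKVmx.
rewrite (linear_sum (ext_pullback (J p))) /=.
have -> : derv (fun c e => (- GamJ i) c e) (B p) =
   - \sum_j J p j i *: derv (fun c e => christoffel g b c j e p) (B p).
  have -> : \sum_j J p j i *: derv (fun c e => christoffel g b c j e p) (B p) =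
    derv (fun c e => GamJ i c e) (B p).
    rewrite /derv; under eq_bigr do rewrite scaler_sumr.
    rewrite exchange_big; apply: eq_bigr => e _ /=.
    under eq_bigr do rewrite scaler_sumr.
    rewrite exchange_big; apply: eq_bigr => c _ /=; rewrite summxE scaler_suml.
    by apply: eq_bigr => j _; rewrite scalerA !mxE.
  by rewrite -[RHS]scaleN1r -dervZl; apply: eq_derv => c e; rewrite mxE mulN1r.
rewrite linearN /= (linear_sum (ext_pullback (J p))) -sumrB; apply: eq_bigr => j _ /=.
by rewrite -(linearB (ext_pullback (J p))) /= -scalerBr linearZ_pullback.
Qed.

Lemma ext_mul_chart (v : 'I_n.+1 -> R) (C : ext) :
  ext_mul (fun i => \sum_j J p j i * v j) (ext_pullback (J p) C) = ext_pullback (J p) (ext_mul v C).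
Proof.
rewrite ext_pullback_mul; apply: eq_ext_mul => i; apply: eq_bigr => j _; exact: mulrC.
Qed.

Lemma int_mul_chart (v : 'I_n.+1 -> R) (C : ext) :
  int_mul (g a p) (fun i => \sum_j J p j i * v j) (ext_pullback (J p) C) =
  ext_pullback (J p) (int_mul (g b p) v C).
Proof.
rewrite !int_mulE int_vec_pullback; congr ext_pullback; apply: eq_int_vec => i.
pose V : 'cV[R]_n.+1 := \col_j v j.
transitivity ((J p *m invmx (g a p) *m (J p)^T *m V) i ord0); last first.
  by rewrite inv_metric_chart mxE; apply: eq_bigr => j _; rewrite mxE.
rewrite -!mulmxA mxE; apply: eq_bigr => j _; rewrite mxE; congr (_ * _).
apply: eq_bigr => k _; rewrite mxE; congr (_ * _).
by apply: eq_bigr => l _; rewrite !mxE.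
Qed.

Lemma ed_chart A B : dfx b p B -> near_pt a p (fun q => A q = ext_pullback (J q) (B q)) ->
  ed g a A p = ext_pullback (J p) (ed g b B p).
Proof.
move=> hB AB; rewrite (ed_near_eq hM g dap AB) /ed (linear_sum (ext_pullback (J p))) /=.
under eq_bigr do rewrite nb_chart // linear_sum.
rewrite exchange_big; apply: eq_bigr => j _ /=.
by rewrite ext_pullback_basis; apply: eq_bigr => i _; rewrite linearZ.
Qed.

Lemma del_chart A B : dfx b p B -> near_pt a p (fun q => A q = ext_pullback (J q) (B q)) ->
  del g a A p = ext_pullback (J p) (del g b B p).
Proof.
move=> hB AB; rewrite (del_near_eq hM g dap AB) !delE (linear_sum (ext_pullback (J p))) /=.
under eq_bigr do rewrite nb_chart // linear_sum.
rewrite exchange_big; apply: eq_bigr => j _ /=.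
rewrite (eq_bigr (fun i => int_vec (fun l => J p j i * invmx (g a p) l i)
  (ext_pullback (J p) (nab g b j B p)))); last first.
  by move=> i _; rewrite int_vecZl /iup int_vecZ.
have -> : \sum_i int_vec (fun l => J p j i * invmx (g a p) l i) (ext_pullback (J p) (nab g b j B p)) =
  int_vec (fun l => \sum_i J p j i * invmx (g a p) l i) (ext_pullback (J p) (nab g b j B p)).
  by rewrite /int_vec exchange_big; apply: eq_bigr => l _ /=; rewrite scaler_suml.
rewrite int_vec_pullback; congr ext_pullback; apply: eq_int_vec => k.
rewrite -inv_metric_chart -mulmxA mxE; apply: eq_bigr => l _; congr (_ * _).
by rewrite mxE; apply: eq_bigr => i _; rewrite mxE mulrC.
Qed.

End Charts.

Section Iup.
Context {R : realType} {n : nat} {M : chart_space R n.+1}.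
Implicit Types (X Y : exterior R n.+1).
Lemma iupD (g : metric M) a q j X Y : iup g a q j (X + Y) = iup g a q j X + iup g a q j Y.
Proof. exact: linearD. Qed.
Lemma iupB (g : metric M) a q j X Y : iup g a q j (X - Y) = iup g a q j X - iup g a q j Y.
Proof. exact: linearB. Qed.
End Iup.

(** * The Levi-Civita connection and the codifferential of a rescaled metric *)

Section Conformal.
Context {R : realType} {n : nat} {M : chart_space R n.+1}.
Hypothesis hM : manifold_with_boundary M.
Local Notation ext := (exterior R n.+1).
Implicit Types (i j k c e : 'I_n.+1) (A B E : M -> ext) (u v : 'I_n.+1 -> M -> R).
Variables (g g' : metric M) (a : chart M) (p : M) (Om : M -> R).
Hypotheses (dp : dom a p) (hg : metric_at g a p) (sOm : sm a p Om) (Omp : Om p != 0).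
Hypothesis hc : near_pt a p (fun q => g' a q = Om q ^+ 2 *: g a q).

Let gU : g a p \in unitmx. Proof. by case: hg => _ H _; exact: near_pt_at H. Qed.
Let gS : (g a p)^T = g a p. Proof. by case: hg => H _ _; exact: near_pt_at H. Qed.
Let gE : g' a p = Om p ^+ 2 *: g a p. Proof. exact: near_pt_at hc. Qed.

Lemma near_neq0 : near_pt a p (fun q => Om q != 0).
Proof.
have [F dF Ff] := sm_dfr sOm.
have Fc := differentiable_continuous dF.
have F0 : nbhs (F (crd a p)) [set z : R | z != 0].
  apply: open_nbhs_nbhs; split; first exact: open_neq.
  by rewrite /= (near_pt_at dp Ff).
have H : \forall y \near crd a p, F y != 0 by exact: (Fc _ F0).
apply: (@filterS2 _ (nbhs (crd a p)) _ _ _ _ _ H Ff) => y {}H Ff' q dq yq.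
by rewrite -Ff' // yq.
Qed.

Lemma metric_at_conf : metric_at g' a p.
Proof.
have [gs gu gsm] := hg; split.
- by apply: near_ptS2 hc gs => q _ -> gs'; rewrite linearZ /= gs'.
- have H := near_ptS2 (fun q _ x y => conj x y) hc near_neq0.
  apply: near_ptS2 H gu => q _ [-> Oq] gu'.
  by rewrite unitmxZ // unitfE expf_neq0.
move=> s t; apply: (@sm_near_eq _ _ _ _ _ (fun q => Om q ^+ 2 * g a q s t)).
  by apply: near_ptS hc => q _ ->; rewrite mxE.
by apply: smM => //; exact: smX.
Qed.

(** The components of Upsilon = d log Omega; [UpR] is the dual vector. *)
Definition Up i : R := (Om p)^-1 * pd a i Om p.
Definition UpR c : R := \sum_k invmx (g a p) c k * Up k.

(** Again by [Gam_unique]: the candidate is symmetric in [i] and [e], and the extra terms account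
    for the derivative of [Om ^+ 2]. *)
Lemma christoffel_conf c i e : christoffel g' a c i e p =
  christoffel g a c i e p + (c == e)%:R * Up i + (c == i)%:R * Up e - g a p i e * UpR c.
Proof.
pose G i : 'M[R]_n.+1 := \matrix_(c, e) (christoffel g a c i e p + (c == e)%:R * Up i
  + (c == i)%:R * Up e - g a p i e * UpR c).
have gs i' j' : g a p i' j' = g a p j' i' by rewrite -{1}gS mxE.
suff H : forall i, Gam g' a i p = G i by have /matrixP/(_ c e) := H i; rewrite mxE => ->; rewrite mxE.
apply: (Gam_unique dp metric_at_conf) => {c i e} [i c e|i].
  rewrite !mxE (christoffel_sym hM dp hg c i e) (gs i e); ring.
have gG : g a p *m G i = g a p *m Gam g a i p + Up i *: g a p +
    \matrix_(l, e) (g a p l i * Up e - g a p i e * Up l).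
  apply/matrixP => l e; rewrite [LHS]mxE.
  rewrite (eq_bigr (fun c => g a p l c * Gam g a i p c e + Up i * (g a p l c * (c == e)%:R)
    + Up e * (g a p l c * (c == i)%:R) - g a p i e * (g a p l c * UpR c))); last first.
    by move=> c _; rewrite !mxE; ring.
  rewrite sumrB !big_split /= -!mulr_sumr !sum_delta.
  have -> : \sum_c g a p l c * UpR c = Up l.
    pose U : 'cV[R]_n.+1 := \col_j Up j.
    transitivity ((g a p *m (invmx (g a p) *m U)) l ord0); last by rewrite mulKVmx // mxE.
    rewrite mxE; apply: eq_bigr => c _; rewrite mxE; congr (_ * _).
    by apply: eq_bigr => k _; rewrite mxE.
  by rewrite !mxE; ring.
have -> : dmx a i (g' a) p = dmx a i (fun q => Om q ^+ 2 *: g a q) p by exact: dmx_near_eq.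
have dO := sm_dfr sOm.
rewrite dmxZ //; last 2 first.
- exact/sm_dfr/smX.
- by apply: smm_dfm; case: hg.
have -> : pd a i (fun q => Om q ^+ 2) p = Om p ^+ 2 * (2 * Up i).
  have -> : pd a i (fun q => Om q ^+ 2) p = pd a i (fun q => Om q * Om q) p.
    by apply: pd_eq => // q _; rewrite expr2.
  by rewrite pdM // /Up; field.
rewrite gE -scalemxAl linearZ /= gG -scalerA -!scalerDr; congr (_ *: _).
rewrite dmx_metric // !linearD /= linearZ /= gS.
apply/matrixP => l e; rewrite !mxE (gs l i) (gs e i) (gs l e); ring.
Qed.

Lemma nb_conf i A : nab g' a i A p = nab g a i A p -
  (Up i *: (\sum_e ext_basis e (int_basis e (A p))) + ext_mul Up (int_basis i (A p))
   - ext_mul (g a p i) (int_mul (g a p) Up (A p))).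
Proof.
rewrite /nab -addrA; congr (_ + _); rewrite -opprD; congr (- _).
pose C1 c e := (c == e)%:R * Up i.
pose C2 c e := (c == i)%:R * Up e.
pose C3 c e := g a p i e * UpR c.
have -> : derv (fun c e => christoffel g' a c i e p) (A p) =
  derv (fun c e => christoffel g a c i e p + (C1 c e + (C2 c e + -1 * C3 c e))) (A p).
  apply: eq_derv => c e; rewrite christoffel_conf /C1 /C2 /C3; ring.
rewrite !dervDl (dervZl (-1)) scaleN1r -[_ + _ - _]addrA; congr (_ + (_ + (_ - _))).
- rewrite /derv scaler_sumr; apply: eq_bigr => e _.
  rewrite (bigD1 e) //= big1 => [|c ce]; first by rewrite /C1 eqxx mul1r addr0.
  by rewrite /C1 (negbTE ce) mul0r scale0r.
- rewrite /derv /ext_mul; apply: eq_bigr => e _.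
  rewrite (bigD1 i) //= big1 => [|c ce]; first by rewrite /C2 eqxx mul1r addr0.
  by rewrite /C2 (negbTE ce) mul0r scale0r.
rewrite /derv /ext_mul int_mulE; apply: eq_bigr => e _.
rewrite /int_vec linear_sum scaler_sumr; apply: eq_bigr => c _ /=.
by rewrite ext_basisZ scalerA.
Qed.

Lemma inv_metric_sym i j : invmx (g a p) i j = invmx (g a p) j i.
Proof. by rewrite -{1}gS -trmx_inv mxE. Qed.

(** Contracting the three correction terms of [nb_conf] gives iota(Upsilon) with the factors [kk], 1
    and [n.+1 - (kk - 1)], the first and the last by the Euler identities; their signed sum is the
    coefficient [n.+1 - 2 kk]. *)
Lemma del_conf (kk : int) A : homogeneous kk (A p) ->
  del g' a A p = (Om p ^- 2) *: (del g a A p +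
    (n.+1%:R - 2 * kk%:~R) *: int_mul (g a p) Up (A p)).
Proof.
move=> hA; rewrite !delE.
have iupE j X : iup g' a p j X = Om p ^- 2 *: iup g a p j X.
  rewrite /iup -int_vecZl; apply: eq_int_vec => i.
  by rewrite gE invmxZ ?mxE // unitmxZ // unitfE expf_neq0.
under eq_bigr do rewrite iupE nb_conf iupB.
rewrite -scaler_sumr sumrB; congr (_ *: (_ + _)).
under eq_bigr do rewrite iupB iupD.
rewrite sumrB big_split /=.
have -> : \sum_i iup g a p i (Up i *: \sum_e ext_basis e (int_basis e (A p))) =
   kk%:~R *: int_mul (g a p) Up (A p).
  rewrite (ext_int_euler hA) int_mul_iup scaler_sumr; apply: eq_bigr => i _.
  by rewrite /iup !int_vecZ !scalerA mulrC.
have -> : \sum_i iup g a p i (ext_mul Up (int_basis i (A p))) = int_mul (g a p) Up (A p).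
  under eq_bigr do rewrite /iup int_vec_ext.
  rewrite sumrB -[RHS]subr0; congr (_ - _).
    rewrite int_mulE /int_vec; apply: eq_bigr => i _; congr (_ *: _).
    by apply: eq_bigr => j _; rewrite inv_metric_sym.
  rewrite -(linear_sum (ext_mul Up)) /= [X in ext_mul _ X](_ : _ = 0) ?linear0 //.
  apply: ext_eqN0; rewrite -sumrN /int_vec.
  under [RHS]eq_bigr do rewrite -sumrN.
  rewrite exchange_big; apply: eq_bigr => i _; apply: eq_bigr => j _ /=.
  by rewrite int_intC scalerN inv_metric_sym.
have -> : \sum_i iup g a p i (ext_mul (g a p i) (int_mul (g a p) Up (A p))) =
   (n.+1%:R - (kk - 1)%:~R) *: int_mul (g a p) Up (A p).
  have hX : homogeneous (kk - 1) (int_mul (g a p) Up (A p)) by exact: homogeneous_int_mul.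
  rewrite -(int_ext_euler hX).
  set X := int_mul _ _ _; rewrite /iup /int_vec exchange_big; apply: eq_bigr => k _ /=.
  rewrite /ext_mul.
  under eq_bigr do rewrite linear_sum scaler_sumr.
  rewrite exchange_big /= (eq_bigr (fun e => (k == e)%:R *: int_basis k (ext_basis e X))).
    rewrite (bigD1 k) //= eqxx scale1r big1 ?addr0 // => e ek.
    by rewrite eq_sym (negbTE ek) scale0r.
  move=> e _; have /matrixP/(_ k e) := mulVmx gU; rewrite !mxE => <-; rewrite scaler_suml.
  by apply: eq_bigr => j _; rewrite linearZ /= scalerA.
rewrite -[X in _ + X - _]scale1r -scalerDl -scalerBl -scaleNr; congr (_ *: _).
by rewrite intrB; ring.
Qed.

End Conformal.

(** * Powers and logarithm of the conformal factor *)

Section Powers.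
Context {R : realType} {n : nat} {M : chart_space R n.+1}.
Hypothesis hM : manifold_with_boundary M.
Variables (a : chart M) (p : M) (Om : M -> R).
Hypotheses (dp : dom a p) (sOm : sm a p Om) (Omp : 0 < Om p).

Lemma dfr_powR w : dfr a p (fun q => Om q `^ w).
Proof.
apply: (@dfr_comp _ _ _ (fun x => x `^ w)) => //; last exact: sm_dfr.
by have [] := is_derive1_powR w Omp.
Qed.

Lemma pd_powR w i : pd a i (fun q => Om q `^ w) p = Om p `^ w * (w * Up a p Om i).
Proof.
have [d1 d2] := is_derive1_powR w Omp.
rewrite (@pd_comp _ _ _ _ (fun x => x `^ w)) //; last exact: sm_dfr.
rewrite d2 /Up powRD; last by apply/implyP => _; rewrite (gt_eqF Omp).
by rewrite powR_inv1 ?ltW //; ring.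
Qed.

Lemma pd_ln i : pd a i (fun q => ln (Om q)) p = Up a p Om i.
Proof.
have [d1 d2] := is_derive1_ln Omp.
by rewrite (@pd_comp _ _ _ hM (@ln R)) // ?d2 //; exact: sm_dfr.
Qed.

End Powers.

(** * The Ricci tensor under conformal change *)

Section RicciAlgebra.
Context {R : realType} {m : nat}.
Variables (Gm : 'I_m -> 'I_m -> 'I_m -> R) (G : 'I_m -> 'I_m -> R) (U V : 'I_m -> R).
Hypotheses (GmS : forall k i j, Gm k i j = Gm k j i) (GS : forall i j, G i j = G j i).
Hypothesis GV : forall i, \sum_k G i k * V k = U i.

(** The difference of the two connections in [christoffel_conf], with [U] for Upsilon, [V] for its
    dual vector and [G] for the metric. *)
Definition conf_diff k i j : R := (k == j)%:R * U i + (k == i)%:R * U j - G i j * V k.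
Local Notation C := conf_diff.
Local Notation nU := (\sum_l U l * V l).

Lemma sum_conf_upper F i j :
  \sum_l F l * C l i j = F j * U i + F i * U j - G i j * \sum_l F l * V l.
Proof.
rewrite (eq_bigr (fun l => U i * (F l * (l == j)%:R) + U j * (F l * (l == i)%:R)
   - G i j * (F l * V l))); last by move=> l _; rewrite /C; ring.
by rewrite sumrB big_split /= -!mulr_sumr !sum_delta; ring.
Qed.

Lemma sum_conf_lower F k j :
  \sum_l C k j l * F l = F k * U j + (k == j)%:R * (\sum_l U l * F l) - V k * \sum_l G j l * F l.
Proof.
rewrite (eq_bigr (fun l => U j * (F l * (l == k)%:R) + (k == j)%:R * (U l * F l)
   - V k * (G j l * F l))); last by move=> l _; rewrite /C (eq_sym l k); ring.
by rewrite sumrB big_split /= -!mulr_sumr sum_delta; ring.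
Qed.

Lemma sum_delta_l (F : 'I_m -> R) j : \sum_k (k == j)%:R * F k = F j.
Proof. by rewrite -[RHS](sum_delta F); apply: eq_bigr => k _; rewrite mulrC. Qed.

Lemma sum_conf_trace l : \sum_k C k k l = m%:R * U l.
Proof.
rewrite (eq_bigr (fun k => (k == l)%:R * U k + U l - G l k * V k)); last first.
  by move=> k _; rewrite /C eqxx mul1r (GS l k); ring.
rewrite sumrB big_split /= GV sum_delta_l sumr_const card_ord -mulr_natl; ring.
Qed.

Lemma sum_conf_trace' l : \sum_k C k l k = m%:R * U l.
Proof. by rewrite -sum_conf_trace; apply: eq_bigr => k _; rewrite /C GS; ring. Qed.

(** The part of the Ricci tensor quadratic in the connection, for the sum of a connection and a
    conformal difference. [T1] to [T4] are the mixed products, in which the traces [g_] cancel; [Q1]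
    and [Q2] are quadratic in the difference. The remaining mixed terms are those that [ricci_conf]
    needs to complete partial derivatives of Upsilon to covariant ones. *)
Lemma ricci_algebra i j :
  \sum_k \sum_l ((Gm k k l + C k k l) * (Gm l i j + C l i j)
                 - (Gm k j l + C k j l) * (Gm l i k + C l i k)) =
  \sum_k \sum_l (Gm k k l * Gm l i j - Gm k j l * Gm l i k)
  + (m%:R - 2) * (\sum_l U l * Gm l i j) - G i j * (\sum_k \sum_l Gm k k l * V l)
  + \sum_l V l * (\sum_k G i k * Gm k j l + \sum_k G j k * Gm k i l)
  + (m%:R - 2) * (U i * U j - G i j * nU).
Proof.
pose g_ l := \sum_k Gm k k l.
have T1 : \sum_k \sum_l Gm k k l * C l i j =
  g_ j * U i + g_ i * U j - G i j * (\sum_k \sum_l Gm k k l * V l).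
  under eq_bigr do rewrite sum_conf_upper.
  by rewrite sumrB big_split /= -!mulr_suml -mulr_sumr.
have T2 : \sum_k \sum_l C k k l * Gm l i j = m%:R * (\sum_l U l * Gm l i j).
  rewrite exchange_big /= mulr_sumr; apply: eq_bigr => l _.
  by rewrite -mulr_suml sum_conf_trace mulrA.
have T3 : \sum_k \sum_l Gm k j l * C l i k =
  g_ j * U i + \sum_l U l * Gm l i j - \sum_l V l * (\sum_k G i k * Gm k j l).
  under eq_bigr do rewrite sum_conf_upper.
  rewrite sumrB big_split /= -mulr_suml; congr (_ * _ + _ - _).
  - by apply: eq_bigr => k _; rewrite GmS.
  - by apply: eq_bigr => k _; rewrite GmS mulrC.
  under eq_bigr do rewrite mulr_sumr.
  rewrite exchange_big; apply: eq_bigr => l _ /=; rewrite mulr_sumr.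
  by apply: eq_bigr => k _; ring.
have T4 : \sum_k \sum_l C k j l * Gm l i k =
  g_ i * U j + \sum_l U l * Gm l i j - \sum_l V l * (\sum_k G j k * Gm k i l).
  under eq_bigr do rewrite sum_conf_lower.
  rewrite sumrB big_split /= -mulr_suml sum_delta_l; congr (_ * _ + _ - _).
  by apply: eq_bigr => k _; rewrite GmS.
have Q1 : \sum_k \sum_l C k k l * C l i j = m%:R * (2 * (U i * U j) - G i j * nU).
  rewrite exchange_big /=; under eq_bigr do rewrite -mulr_suml sum_conf_trace.
  rewrite sum_conf_upper (eq_bigr (fun l => m%:R * (U l * V l))) => [|l _]; last by rewrite mulrA.
  by rewrite -mulr_sumr; ring.
have Q2 : \sum_k \sum_l C k j l * C l i k = (m%:R + 2) * (U i * U j) - 2 * (G i j * nU).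
  under eq_bigr do rewrite sum_conf_upper.
  rewrite sumrB big_split /= -mulr_suml sum_conf_trace'.
  have -> : \sum_k C k j i * U k = 2 * (U i * U j) - G i j * nU.
    under eq_bigr do rewrite mulrC.
    by rewrite sum_conf_upper (GS j i); ring.
  have -> : \sum_k G i k * (\sum_l C k j l * V l) = G i j * nU.
    rewrite (eq_bigr (fun k => (G i k * nU) * (k == j)%:R)).
      by rewrite sum_delta.
    by move=> k _; rewrite sum_conf_lower GV; ring.
  ring.
rewrite (eq_bigr (fun k => \sum_l (Gm k k l * Gm l i j - Gm k j l * Gm l i k)
  + (\sum_l Gm k k l * C l i j) + (\sum_l C k k l * Gm l i j)
  - (\sum_l Gm k j l * C l i k) - (\sum_l C k j l * Gm l i k)
  + (\sum_l C k k l * C l i j) - (\sum_l C k j l * C l i k))); last first.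
  move=> k _; rewrite -!big_split -?sumrB /= -!big_split -?sumrB /=.
  by apply: eq_bigr => l _; ring.
rewrite sumrB big_split /= !sumrB !big_split /= T1 T2 T3 T4 Q1 Q2.
have -> : \sum_l V l * (\sum_k G i k * Gm k j l + \sum_k G j k * Gm k i l) =
  \sum_l V l * (\sum_k G i k * Gm k j l) + \sum_l V l * (\sum_k G j k * Gm k i l).
  by rewrite -big_split /=; apply: eq_bigr => l _; rewrite mulrDr.
set x1 := \sum_k \sum_l (_ - _); set x2 := \sum_l U l * Gm l i j.
set x3 := \sum_k \sum_l Gm k k l * V l; set x4 := \sum_l V l * (\sum_k G i k * _).
set x5 := \sum_l V l * (\sum_k G j k * _); set x6 := nU.
move: x1 x2 x3 x4 x5 x6 => *; ring.
Qed.

End RicciAlgebra.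

(** * The Ricci tensor of s^-2 g *)

Section RicciConformal.
Context {R : realType} {n : nat} {M : chart_space R n.+1}.
Hypothesis hM : manifold_with_boundary M.
Implicit Types (i j k l c e : 'I_n.+1).
Variables (g g' : metric M) (a : chart M) (p : M) (s : M -> R).
Hypotheses (dp : dom a p) (hg : metric_at g a p) (ss : sm a p s) (sp : s p != 0).
Hypothesis hc : forall q, dom a q -> g' a q = (s q) ^- 2 *: g a q.

(** Upsilon for the conformal factor s^-1, that is, - d log s; [rdlog] is the dual vector field. *)
Definition dlog i q : R := - ((s q)^-1 * pd a i s q).
Definition rdlog c q : R := \sum_k invmx (g a q) c k * dlog k q.

Lemma sm_dlog i : sm a p (dlog i).
Proof. by apply: smN; apply: smM; [exact: smV|exact: sm_pd]. Qed.

Lemma sm_rdlog c : sm a p (rdlog c).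
Proof. by apply: sm_sum => k _; apply: smM; [exact: smm_inv_metric|exact: sm_dlog]. Qed.

Lemma Up_inv i q : dom a q -> sm a q s -> s q != 0 -> Up a q (fun q => (s q)^-1) i = dlog i q.
Proof.
move=> dq sq s0; rewrite /Up /dlog.
have dV : derivable (@GRing.inv R) (s q) 1.
  by apply: diff_derivable; exact: differentiable_Rinv.
have -> : pd a i (fun q => (s q)^-1) q = - (s q) ^- 2 * pd a i s q.
  rewrite (pd_comp hM i dq dV (sm_dfr sq)); congr (_ * _).
  rewrite -[LHS]/('D_1 (fun x : R => (id x)^-1) (s q)) deriveV //.
  by rewrite derive_id scaler1.
by rewrite invrK; field.
Qed.

(** Stated on a neighbourhood because the Ricci tensor differentiates the Christoffel symbols. *)
Lemma christoffel_inv : near_pt a p (fun q => forall k i j,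
  christoffel g' a k i j q = christoffel g a k i j q + conf_diff (g a q) (dlog^~ q) (rdlog^~ q) k i j).
Proof.
have H1 := near_ptS2 (fun q _ x y => conj x y) (metric_at_near hg) (sm_near ss).
have H2 := near_ptS2 (fun q _ x y => conj x y) H1 (near_neq0 dp ss sp).
apply: near_ptS H2 => q dq [[hgq sq] s0] k i j.
have sV : sm a q (fun q => (s q)^-1) by exact: smV.
have cV : near_pt a q (fun q => g' a q = (fun q => (s q)^-1) q ^+ 2 *: g a q).
  by apply: near_ptT => r dr; rewrite hc // exprVn.
rewrite (christoffel_conf hM dq hgq sV (invr_neq0 s0) cV) /conf_diff /UpR /rdlog.
by rewrite !Up_inv // !addrA; congr (_ - _ * _); apply: eq_bigr => l _; rewrite Up_inv.
Qed.

Lemma pd_dlog i j : pd a i (dlog j) p =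
  - ((s p)^-1 * pd a i (pd a j s) p) + (s p) ^- 2 * pd a i s p * pd a j s p.
Proof.
have dV : derivable (@GRing.inv R) (s p) 1.
  by apply: diff_derivable; exact: differentiable_Rinv.
have sV : sm a p (fun q => (s q)^-1) by exact: smV.
have sd : sm a p (pd a j s) by exact: sm_pd.
rewrite pdN //; last exact/sm_dfr/smM.
rewrite pdM //; try exact: sm_dfr.
have -> : pd a i (fun q => (s q)^-1) p = - (s p) ^- 2 * pd a i s p.
  rewrite (pd_comp hM i dp dV (sm_dfr ss)); congr (_ * _).
  rewrite -[LHS]/('D_1 (fun x : R => (id x)^-1) (s p)) deriveV //.
  by rewrite derive_id scaler1.
ring.
Qed.

Local Notation m := (n.+1%:R : R).
Local Notation U i := (dlog i p).
Local Notation V i := (rdlog i p).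

Lemma metric_rdlog q i : g a q \in unitmx -> \sum_k g a q i k * rdlog k q = dlog i q.
Proof.
move=> gu; pose Z : 'cV[R]_n.+1 := \col_j dlog j q.
transitivity ((g a q *m (invmx (g a q) *m Z)) i ord0); last by rewrite mulKVmx // mxE.
rewrite mxE; apply: eq_bigr => c _; rewrite mxE; congr (_ * _).
by apply: eq_bigr => k _; rewrite mxE.
Qed.

Lemma ricci_conf i j : ricci g' a p i j = ricci g a p i j
  - (m - 2) * (cov g a i dlog p j - U i * U j)
  - g a p i j * (\sum_k \sum_l invmx (g a p) k l * cov g a k dlog p l
                + (m - 2) * \sum_k U k * V k).
Proof.
have [gs gu gsm] := hg.
have gpu := near_pt_at dp gu; have gps := near_pt_at dp gs.
have GS i' j' : g a p i' j' = g a p j' i' by rewrite -{1}gps mxE.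
have sC k i' j' : sm a p (christoffel g a k i' j') by exact: sm_christoffel.
have sG i' j' : sm a p (fun q => g a q i' j') by [].
have sU k := sm_dlog k; have sV k := sm_rdlog k.
have sCd k i' j' : sm a p (fun q => conf_diff (g a q) (dlog^~ q) (rdlog^~ q) k i' j').
  by apply: smB; [apply: smD|]; apply: smM => //; exact: sm_cst.
have pdC k r i' j' : pd a r (christoffel g' a k i' j') p = pd a r (christoffel g a k i' j') p
   + pd a r (fun q => conf_diff (g a q) (dlog^~ q) (rdlog^~ q) k i' j') p.
  rewrite -pdD //; try exact: sm_dfr.
  by apply: pd_near_eq => //; apply: near_ptS christoffel_inv => q _ ->.
have pdCd k r i' j' : pd a r (fun q => conf_diff (g a q) (dlog^~ q) (rdlog^~ q) k i' j') p =
  (k == j')%:R * pd a r (dlog i') p + (k == i')%:R * pd a r (dlog j') p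
  - (pd a r (fun q => g a q i' j') p * V k + g a p i' j' * pd a r (rdlog k) p).
  rewrite pdB //; try exact: sm_dfr; first last.
  - exact/sm_dfr/smM.
  - by apply: sm_dfr; apply: smD; apply: smM => //; exact: sm_cst.
  rewrite pdM //; try exact: sm_dfr.
  rewrite pdD //; try (apply: sm_dfr; apply: smM => //; exact: sm_cst).
  by rewrite !pdZ //; exact: sm_dfr.
(* The trace of the difference is [m] times [dlog i] on a whole neighbourhood, so this simple form
   may be differentiated. *)
have trC r : pd a r (fun q => \sum_k conf_diff (g a q) (dlog^~ q) (rdlog^~ q) k i k) p =
   m * pd a r (dlog i) p.
  rewrite -pdZ //; last exact: sm_dfr.
  apply: pd_near_eq => //; have H := near_ptS2 (fun q _ x y => conj x y) gs gu.
  apply: near_ptS H => q dq [gqs gqu]; rewrite sum_conf_trace' //.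
    by move=> i' j'; rewrite -{1}gqs mxE.
  by move=> k; exact: metric_rdlog.
have E1 : \sum_k (pd a k (christoffel g' a k i j) p - pd a j (christoffel g' a k i k) p) =
  \sum_k (pd a k (christoffel g a k i j) p - pd a j (christoffel g a k i k) p)
  + pd a j (dlog i) p + pd a i (dlog j) p - \sum_k V k * pd a k (fun q => g a q i j) p
  - g a p i j * (\sum_k pd a k (rdlog k) p) - m * pd a j (dlog i) p.
  rewrite -trC pd_sum //; last by move=> k _; exact: sm_dfr.
  rewrite (eq_bigr (fun k => (pd a k (christoffel g a k i j) p - pd a j (christoffel g a k i k) p)
    + (k == j)%:R * pd a k (dlog i) p + (k == i)%:R * pd a k (dlog j) p
    - V k * pd a k (fun q => g a q i j) p - g a p i j * pd a k (rdlog k) p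
    - pd a j (fun q => conf_diff (g a q) (dlog^~ q) (rdlog^~ q) k i k) p)); last first.
    move=> k _; rewrite !pdC pdCd.
    have R1 (x1 x2 x3 b1 b2 y1 y2 z v h w : R) : x1 + (b1 * y1 + b2 * y2 - (z * v + h * w)) - (x2 + x3)
      = x1 - x2 + b1 * y1 + b2 * y2 - v * z - h * w - x3 by ring.
    exact: R1.
  have R2 (x1 x2 x3 y1 y2 v z w : 'I_n.+1 -> R) h :
    \sum_k (x1 k - x2 k + (k == j)%:R * y1 k + (k == i)%:R * y2 k - v k * z k - h * w k - x3 k)
    = \sum_k (x1 k - x2 k) + y1 j + y2 i - \sum_k v k * z k - h * (\sum_k w k) - \sum_k x3 k.
    by rewrite sumrB sumrB sumrB big_split big_split /= !sum_delta_l -mulr_sumr.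
  exact: (R2 (fun k => pd a k (christoffel g a k i j) p) (fun k => pd a j (christoffel g a k i k) p)
   (fun k => pd a j (fun q => conf_diff (g a q) (dlog^~ q) (rdlog^~ q) k i k) p)
   (fun k => pd a k (dlog i) p) (fun k => pd a k (dlog j) p) (fun k => V k)
   (fun k => pd a k (fun q => g a q i j) p) (fun k => pd a k (rdlog k) p)).
(* By metric compatibility the derivative of the metric along the vector dual to Upsilon cancels the
   term with the two contracted Christoffel symbols in [ricci_algebra]. *)
have E2 : \sum_k V k * pd a k (fun q => g a q i j) p =
  \sum_l V l * (\sum_k g a p i k * christoffel g a k j l p + \sum_k g a p j k * christoffel g a k i l p).
  apply: eq_bigr => l _; congr (_ * _).
  have /matrixP/(_ i j) := dmx_metric hM dp hg l; rewrite [LHS]mxE => ->.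
  rewrite [LHS]mxE [X in _ + X]mxE; congr (_ + _); rewrite mxE; apply: eq_bigr => k _;
    by rewrite mxE (christoffel_sym hM dp hg).
(* The divergence of the vector dual to Upsilon, computed by raising the index before or after
   differentiating. *)
have E3 : \sum_k pd a k (rdlog k) p + \sum_k \sum_l christoffel g a k k l p * V l =
  \sum_k \sum_l invmx (g a p) k l * cov g a k dlog p l.
  rewrite -big_split /=; apply: eq_bigr => k _.
  by apply: (pd_raise hM dp hg k k) => l; exact: sm_dfr.
have symU : pd a i (dlog j) p = pd a j (dlog i) p.
  by rewrite !pd_dlog (pd_comm hM i j dp ss); ring.
have gE : forall i, \sum_k g a p i k * V k = U i by move=> ?; exact: metric_rdlog.
rewrite /ricci [LHS]mxE [X in _ = X - _ - _]mxE.
rewrite [LHS]big_split [X in _ = X - _ - _]big_split /= E1.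
have CE k i' j' : christoffel g' a k i' j' p = christoffel g a k i' j' p +
   conf_diff (g a p) (dlog^~ p) (rdlog^~ p) k i' j' by exact: (near_pt_at dp christoffel_inv).
rewrite [X in _ + X = _](eq_bigr (fun k => \sum_l (
   (christoffel g a k k l p + conf_diff (g a p) (dlog^~ p) (rdlog^~ p) k k l) *
   (christoffel g a l i j p + conf_diff (g a p) (dlog^~ p) (rdlog^~ p) l i j)
   - (christoffel g a k j l p + conf_diff (g a p) (dlog^~ p) (rdlog^~ p) k j l) *
   (christoffel g a l i k p + conf_diff (g a p) (dlog^~ p) (rdlog^~ p) l i k)))); last first.
  by move=> k _; apply: eq_bigr => l _; rewrite !CE.
have RA := @ricci_algebra R n.+1 (fun k i j => christoffel g a k i j p) (g a p) (dlog^~ p) (rdlog^~ p)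
   (christoffel_sym hM dp hg) GS gE i j.
rewrite [X in _ + X = _]RA.
rewrite -E3 E2 symU /cov.
have -> : \sum_c christoffel g a c i j p * dlog c p = \sum_l U l * christoffel g a l i j p.
  by apply: eq_bigr => l _; rewrite mulrC.
rewrite symU.
set x1 := \sum_k (_ - _); set x2 := \sum_l U l * _; set x3 := \sum_k \sum_l christoffel g a k k l p * V l.
set x4 := \sum_l V l * _; set x5 := \sum_k U k * V k; set x6 := \sum_k pd a k (rdlog k) p.
set x7 := \sum_k \sum_l _; set x8 := pd a j (dlog i) p.
move: x1 x2 x3 x4 x5 x6 x7 x8 => *; ring.
Qed.

End RicciConformal.

(** * The Einstein equation in terms of the scale sigma *)

Section Einstein.
#[local] Opaque pd.
Context {R : realType} {n : nat} {M : chart_space R n.+1}.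
Hypothesis hM : manifold_with_boundary M.
Hypothesis hn : (2 <= n)%N.
Implicit Types (i j k l c e : 'I_n.+1).
Variables (sigma : metric M -> M -> R).

Definition grad (g : metric M) (a : chart M) i : M -> R := pd a i (sigma g).

Definition nu_sq (g : metric M) (a : chart M) p : R :=
  \sum_i \sum_j nu sigma g a p i * invmx (g a p) i j * nu sigma g a p j.

(** The transformation law of the Ricci tensor is solved for the Hessian of sigma: the trace of the
    Einstein equation gives the length of nu, and substituting this back leaves an equation for the
    Hessian. These are the unit length of the scale tractor and the middle slot of its
    parallelism. *)
Lemma einstein_at (g g' : metric M) a p : dom a p -> metric_at g a p ->
  sm a p (sigma g) -> sigma g p != 0 ->
  (forall q, dom a q -> g' a q = (sigma g q) ^- 2 *: g a q) ->
  ricci g' a p = - n%:R *: g' a p ->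
  nu_sq g a p = 1 - 2 * rho sigma g a p * sigma g p /\
  forall i j, cov g a i (grad g a) p j =
    - (sigma g p * schouten g a p i j) - rho sigma g a p * g a p i j.
Proof.
move=> dp hg ss sp hc hE; have [gs gu _] := hg.
have gpu := near_pt_at dp gu; have gps := near_pt_at dp gs.
pose H i j := cov g a i (grad g a) p j.
pose Q := invmx (g a p); pose s := sigma g p; pose v i := nu sigma g a p i.
pose h := \sum_k \sum_l Q k l * H k l.
pose N := nu_sq g a p.
have covU i j : cov g a i (dlog a (sigma g)) p j = - (s^-1 * H i j) + s ^- 2 * v i * v j.
  rewrite /cov (pd_dlog hM dp ss sp) /H /cov.
  have -> : \sum_c christoffel g a c i j p * dlog a (sigma g) c p =
    - (s^-1 * \sum_c christoffel g a c i j p * grad g a c p).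
    by rewrite mulr_sumr -sumrN; apply: eq_bigr => c _; rewrite /dlog /s /grad; ring.
  by rewrite /grad /v /nu -/s; ring.
have UV : \sum_k dlog a (sigma g) k p * rdlog g a (sigma g) k p = s ^- 2 * N.
  rewrite /N /nu_sq mulr_sumr; apply: eq_bigr => k _.
  rewrite /rdlog !mulr_sumr; apply: eq_bigr => l _.
  by rewrite /dlog /nu -/s -exprVn expr2; ring.
have trU : \sum_k \sum_l Q k l * cov g a k (dlog a (sigma g)) p l = - (s^-1 * h) + s ^- 2 * N.
  rewrite /N /nu_sq !mulr_sumr -sumrN -big_split; apply: eq_bigr => k _ /=.
  rewrite !mulr_sumr -sumrN -big_split; apply: eq_bigr => l _ /=.
  by rewrite covU -/Q /v; ring.
have E i j : ricci g a p i j + (n.+1%:R - 2) * (s^-1 * H i j)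
   + g a p i j * (s^-1 * h - n%:R * (s ^- 2 * N)) = - n%:R * (s ^- 2 * g a p i j).
  have := ricci_conf hM dp hg ss sp hc i j.
  rewrite hE mxE hc // mxE -/s trU UV covU => ->.
  have -> : dlog a (sigma g) i p * dlog a (sigma g) j p = s ^- 2 * v i * v j.
    by rewrite /dlog /v /nu -/s -exprVn expr2; ring.
  by rewrite -(natr1 n); ring.
pose trR := \tr (Q *m ricci g a p).
have nR : n%:R != 0 :> R by rewrite pnatr_eq0 -lt0n; exact: ltn_trans hn.
have mR : n.+1%:R != 0 :> R by rewrite pnatr_eq0.
have nR1 : n.+1%:R - 2 != 0 :> R.
  by rewrite subr_eq0 (eqr_nat R n.+1 2) eqSS; apply: contraTN hn => /eqP ->.
have Hs i j : H i j = H j i.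
  have P1 : pd a i (grad g a j) p = pd a j (grad g a i) p := pd_comm hM i j dp ss.
  have P2 : \sum_c christoffel g a c i j p * grad g a c p =
      \sum_c christoffel g a c j i p * grad g a c p.
    by apply: eq_bigr => l _; rewrite (christoffel_sym hM dp hg l i j).
  by rewrite /H /cov P1 P2.
have gQ : \sum_i \sum_k Q i k * g a p k i = n.+1%:R.
  transitivity (\tr (Q *m g a p)); first by apply: eq_bigr => i _; rewrite mxE.
  by rewrite mulVmx // mxtrace1.
(* The contraction of [E] with the inverse metric. *)
have Etr : trR + (n.+1%:R - 2) * (s^-1 * h)
   + n.+1%:R * (s^-1 * h - n%:R * (s ^- 2 * N)) = - n%:R * (s ^- 2 * n.+1%:R).
  have R2 (A B C : 'I_n.+1 -> 'I_n.+1 -> R) x y :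
      \sum_i \sum_k Q i k * (A k i + x * B k i + C k i * y) =
      \sum_i \sum_k Q i k * A k i + x * (\sum_i \sum_k Q i k * B k i)
      + (\sum_i \sum_k Q i k * C k i) * y.
    rewrite mulr_sumr mulr_suml -!big_split; apply: eq_bigr => i _ /=.
    by rewrite mulr_sumr mulr_suml -!big_split; apply: eq_bigr => k _ /=; ring.
  have := R2 (ricci g a p) (fun k l => s^-1 * H k l) (g a p) (n.+1%:R - 2)
     (s^-1 * h - n%:R * (s ^- 2 * N)).
  have -> : \sum_i \sum_k Q i k * ricci g a p k i = trR.
    by apply: eq_bigr => i _; rewrite mxE.
  have -> : \sum_i \sum_k Q i k * (s^-1 * H k i) = s^-1 * h.
    rewrite /h mulr_sumr; apply: eq_bigr => i _; rewrite mulr_sumr; apply: eq_bigr => k _.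
    by rewrite (Hs k i) mulrCA.
  rewrite gQ => <-.
  rewrite -[in RHS]gQ [in RHS]mulr_sumr [RHS]mulr_sumr; apply: eq_bigr => i _.
  rewrite [in RHS]mulr_sumr [RHS]mulr_sumr.
  by apply: eq_bigr => k _; rewrite E mulrCA; congr (_ * _); rewrite mulrCA.
pose Jt := trR / (2 * (n.+1%:R - 1)).
have JtE : schouten_trace g a p = Jt by [].
pose r := rho sigma g a p.
have rE : r = - (n.+1%:R)^-1 * (h + Jt * s) by [].
have s0 : s != 0 by [].
have NE : nu_sq g a p = N by [].
have sE : sigma g p = s by [].
rewrite NE sE; clearbody trR N h s.
have N1 : N = 1 - 2 * r * s.
  have trRE : trR = 2 * n%:R * Jt.
    by rewrite /Jt -(natr1 n) addrK; field.
  move: Etr; rewrite trRE rE => Etr.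
  (* The traced equation multiplied by [s ^+ 2]; by the definition of rho, the sum [Jt * s + h] is
     [- (n + 1) rho]. *)
  have : n%:R * (n.+1%:R * (N - 1)) = n%:R * (2 * s * (Jt * s + h)).
    have := congr1 (fun x => s ^+ 2 * x) Etr.
    have -> : s ^+ 2 * (2 * n%:R * Jt + (n.+1%:R - 2) * (s^-1 * h) +
      n.+1%:R * (s^-1 * h - n%:R * (s ^- 2 * N))) =
       2 * n%:R * Jt * s ^+ 2 + 2 * n%:R * s * h - n%:R * (n.+1%:R * N).
      by rewrite -(natr1 n); field.
    have -> : s ^+ 2 * (- n%:R * (s ^- 2 * n.+1%:R)) = - n%:R * n.+1%:R.
      by field.
    by move=> X; apply/eqP; rewrite -subr_eq0; apply/eqP; 
       transitivity (- (2 * n%:R * Jt * s ^+ 2 + 2 * n%:R * s * h - n%:R * (n.+1%:R * N)) - n%:R * n.+1%:R);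
       [ring | rewrite X; ring].
  move/(mulfI nR) => X.
  have -> : N = (n.+1%:R)^-1 * (n.+1%:R * (N - 1)) + 1 by field; rewrite addrC natr1.
  by rewrite X; ring.
split; first exact: N1.
move=> i j.
have PE : schouten g a p i j = (n.+1%:R - 2)^-1 * (ricci g a p i j - Jt * g a p i j).
  rewrite /schouten JtE [LHS]mxE; congr (_ * _); rewrite [LHS]mxE; congr (_ + _).
  by rewrite [LHS]mxE; congr (- _); rewrite [LHS]mxE.
rewrite PE -/(H i j) -/r; have Eij := E i j; move: Eij.
move: (ricci g a p i j) (g a p i j) (H i j) => A G Hh Eij.
apply: (mulfI nR1); apply: (mulfI (invr_neq0 s0)).
have -> : s^-1 * ((n.+1%:R - 2) * Hh) =
   - n%:R * (s ^- 2 * G) - A - G * (s^-1 * h - n%:R * (s ^- 2 * N)).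
  by rewrite -Eij; ring.
have hE' : h = - n.+1%:R * r - Jt * s by rewrite rE; field; rewrite addrC natr1.
rewrite N1 hE' -(natr1 n); field.
by rewrite s0 -[_ + 1 - 2]/(_ + 1 - 2) natr1 nR1.
Qed.

End Einstein.

Lemma posdef_unitmx {R : realType} (m : nat) (G : 'M[R]_m) :
  (forall v : 'rV[R]_m, v != 0 -> 0 < (v *m G *m v^T) ord0 ord0) -> G \in unitmx.
Proof.
move=> H; rewrite -row_free_unit -kermx_eq0; apply/rowV0P => v /sub_kermxP vG.
apply/eqP/negPn/negP => /H; by rewrite vG mul0mx mxE ltxx.
Qed.

(** * Poincaré-Einstein structures: cancelling sigma, and the Einstein identities up to the
    boundary *)

Section PE.
Context {R : realType} {n : nat} {M : chart_space R n.+1}.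
Hypothesis hM : manifold_with_boundary M.
Hypothesis hn : (2 <= n)%N.
Variables (c : set (metric M)) (sigma : metric M -> M -> R).
Hypotheses (hc : conformal_class c) (hs : poincare_einstein c sigma).
Implicit Types (g : metric M) (a b : chart M) (p q : M) (i j k l : 'I_n.+1) (f : M -> R).

Lemma c_rescaled g : c g -> exists g0 Om, riemannian g0 /\ rescaled Om g0 g.
Proof. by case: hc => g0 rg0 H /H [Om hOm]; exists g0, Om. Qed.

Lemma metric_at_c g a p : c g -> dom a p -> metric_at g a p.
Proof.
move=> /c_rescaled[g0 [Om [rg [sOm pOm gE]]]] dp; split.
- apply: near_ptT => q dq; rewrite gE // linearZ /=; congr (_ *: _); exact: riem_sym.
- apply: near_ptT => q dq; rewrite gE // unitmxZ; last first.
    by rewrite unitfE expf_neq0 // gt_eqF //; apply: pOm; exists a.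
  by apply: posdef_unitmx => v; exact: riem_pos.
move=> s t; apply: (@sm_eq _ _ _ _ _ (fun q => Om q ^+ 2 * g0 a q s t)).
  by move=> q dq; rewrite gE // mxE.
by apply: smM; [apply: smX; exact: sOm|exact: riem_smooth].
Qed.

Lemma tensor_c g a b q : c g -> dom a q -> dom b q ->
  g a q = (jacobian a b q)^T *m g b q *m jacobian a b q.
Proof.
move=> /c_rescaled[g0 [Om [rg [sOm pOm gE]]]] da db.
by rewrite !gE // (riem_tensor rg da db) -scalemxAr -scalemxAl.
Qed.

Lemma sm_sigma g a p : c g -> dom a p -> sm a p (sigma g).
Proof. by move=> cg dp; exact: (pe_density hs).1. Qed.

Lemma rescaled_pos g g' Om a p : rescaled Om g g' -> dom a p -> 0 < Om p.
Proof. by move=> [_ H _] dp; apply: H; exists a. Qed.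

Lemma sigma_conf g g' Om a p : c g -> c g' -> rescaled Om g g' -> dom a p ->
  sigma g' p = Om p * sigma g p.
Proof.
move=> cg cg' r dp; rewrite ((pe_density hs).2 _ _ _ cg cg' r a p dp) powRr1 //.
by apply/ltW; exact: rescaled_pos r dp.
Qed.

Lemma sigma_neq0 g p : c g -> ~ boundary M p -> sigma g p != 0.
Proof. by move=> cg bp; rewrite gt_eqF //; exact: (pe_pos hs). Qed.

(* At a boundary point some one-sided derivative of [sigma] is nonzero, so that
   points with [sigma <> 0] accumulate there. *)
Lemma sigma_cancel g a p f : c g -> dom a p -> dfr a p f ->
  near_pt a p (fun q => sigma g q * f q = 0) -> f p = 0.
Proof.
move=> cg dp [F dF Ff] sf0.
have [s0|s0] := eqVneq (sigma g p) 0; last first.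
  by have /eqP := near_pt_at dp sf0; rewrite mulf_eq0 (negbTE s0) => /eqP.
have bp : boundary M p by apply: contrapT => /(sigma_neq0 cg); rewrite s0 eqxx.
have [i nui] := pe_nabla hs cg bp dp.
have [G dG Gs] := sm_dfr (sm_sigma cg dp).
have cv := @pd_cvg _ _ _ hM a p i _ _ dp dG Gs.
have D0 : 'D_(delta_mx ord0 i) G (crd a p) != 0 by rewrite -(pd_val hM i dp dG Gs).
have nz : \forall h \near (0 : R)^'+,
   h^-1 * (sigma g (par a (crd a p + h *: delta_mx ord0 i)) - sigma g p) != 0.
  have N0 : nbhs ('D_(delta_mx ord0 i) G (crd a p)) [set z : R | z != 0].
    by apply: open_nbhs_nbhs; split => //; exact: open_neq.
  exact: (cv _ N0).
have Fh : \forall h \near (0 : R)^'+, F (crd a p + h *: delta_mx ord0 i) = 0.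
  have H1 := near_par hM i dp (near_ptS2 (fun q _ x y => conj x y) sf0 Ff).
  apply: filterS2 nz H1 => h nzh [dq qE [sf Fq]].
  rewrite -qE Fq; move/eqP: sf; rewrite mulf_eq0 => /orP[/eqP sq|/eqP //].
  by move: nzh; rewrite sq s0 subrr mulr0 eqxx.
have Fc := differentiable_continuous dF.
have lc : (fun h : R => F (crd a p + h *: delta_mx ord0 i)) @ (0 : R)^'+ --> F (crd a p).
  apply: cvg_within_filter.
  have l0 : crd a p + 0 *: delta_mx ord0 i = crd a p by rewrite scale0r addr0.
  have : {for (0 : R), continuous (fun h : R => F (crd a p + h *: delta_mx ord0 i))}.
    apply: (@continuous_comp _ _ _ (fun h : R => crd a p + h *: delta_mx ord0 i) F).
      apply: continuousD; first exact: cst_continuous.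
      exact: scalel_continuous.
    by rewrite /= l0.
  by rewrite /prop_for /continuous_at l0.
rewrite -(near_pt_at dp Ff); apply: (norm_cvg_unique lc).
have : cst (0 : R) @ (0 : R)^'+ --> (0 : R) by exact: cvg_cst.
apply: cvg_trans; apply: near_eq_cvg; apply: filterS Fh => h ->; by [].
Qed.

Lemma sigma_cancel_sm g a f : c g -> (forall p, dom a p -> sm a p f) ->
  (forall p, dom a p -> sigma g p * f p = 0) -> forall p, dom a p -> f p = 0.
Proof.
move=> cg sf H p dp; apply: (sigma_cancel cg dp); first exact/sm_dfr/sf.
exact: near_ptT.
Qed.

Lemma sm_nu g a p i : c g -> dom a p -> sm a p (fun q => nu sigma g a q i).
Proof. by move=> cg dp; apply: sm_pd => //; exact: sm_sigma. Qed.

Lemma sm_ricci g a p i j : c g -> dom a p -> sm a p (fun q => ricci g a q i j).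
Proof.
move=> cg dp; have hg := metric_at_c cg dp.
apply: (@sm_eq _ _ _ _ _ (fun p => \sum_k
  (pd a k (christoffel g a k i j) p - pd a j (christoffel g a k i k) p
   + \sum_l (christoffel g a k k l p * christoffel g a l i j p
             - christoffel g a k j l p * christoffel g a l i k p)))).
  by move=> q _; rewrite /ricci [RHS]mxE.
apply: sm_sum => k _; apply: smD.
  by apply: smB; apply: sm_pd => //; exact: sm_christoffel.
by apply: sm_sum => l _; apply: smB; apply: smM; exact: sm_christoffel.
Qed.

Lemma sm_schouten_trace g a p : c g -> dom a p -> sm a p (schouten_trace g a).
Proof.
move=> cg dp; apply: smM; last exact: sm_cst.
apply: sm_sum => i _; apply: (@sm_eq _ _ _ _ _ (fun q => \sum_k invmx (g a q) i k * ricci g a q k i)).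
  by move=> q _; rewrite mxE.
apply: sm_sum => k _; apply: smM; last exact: sm_ricci.
by apply: smm_inv_metric => //; exact: metric_at_c.
Qed.

Lemma sm_schouten g a p i j : c g -> dom a p -> sm a p (fun q => schouten g a q i j).
Proof.
move=> cg dp; apply: (@sm_eq _ _ _ _ _ (fun q => (n.+1%:R - 2)^-1 *
   (ricci g a q i j - schouten_trace g a q * g a q i j))).
  move=> q _; rewrite /schouten [RHS]mxE; congr (_ * _); rewrite [RHS]mxE; congr (_ + _).
  by rewrite [RHS]mxE; congr (- _); rewrite [RHS]mxE.
apply: smM; first exact: sm_cst.
apply: smB; first exact: sm_ricci.
apply: smM; first exact: sm_schouten_trace.
by have [_ _] := metric_at_c cg dp; apply.
Qed.

Lemma sm_hess g a p i j : c g -> dom a p -> sm a p (fun q => cov g a i (grad sigma g a) q j).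
Proof.
move=> cg dp; apply: smB.
  by apply: sm_pd => //; apply: sm_pd => //; exact: sm_sigma.
apply: sm_sum => k _; apply: smM; first by apply: sm_christoffel => //; exact: metric_at_c.
exact: sm_nu.
Qed.

Lemma sm_rho g a p : c g -> dom a p -> sm a p (rho sigma g a).
Proof.
move=> cg dp; apply: smM; first exact: sm_cst.
apply: smD; last by apply: smM; [exact: sm_schouten_trace|exact: sm_sigma].
apply: sm_sum => i _; apply: sm_sum => j _; apply: smM; last exact: sm_hess.
by apply: smm_inv_metric => //; exact: metric_at_c.
Qed.

Lemma sm_nu_sq g a p : c g -> dom a p -> sm a p (nu_sq sigma g a).
Proof.
move=> cg dp; apply: sm_sum => i _; apply: sm_sum => j _; apply: smM; last exact: sm_nu.
apply: smM; first exact: sm_nu.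
by apply: smm_inv_metric => //; exact: metric_at_c.
Qed.

Lemma einstein_interior g a p : c g -> dom a p -> ~ boundary M p ->
  nu_sq sigma g a p = 1 - 2 * rho sigma g a p * sigma g p /\
  forall i j, cov g a i (grad sigma g a) p j =
    - (sigma g p * schouten g a p i j) - rho sigma g a p * g a p i j.
Proof.
move=> cg dp bp; have H := pe_einstein hs cg bp dp.
apply: (einstein_at hM hn dp (metric_at_c cg dp) (sm_sigma cg dp) (sigma_neq0 cg bp) _ H).
by [].
Qed.

(** Multiplied by sigma, the identity holds at interior points by the Einstein equation and at
    boundary points because sigma is zero there; both sides are smooth, so sigma can be cancelled.
    The Hessian is treated alike in [hessE]. *)
Lemma nu_sqE g a p : c g -> dom a p ->
  nu_sq sigma g a p = 1 - 2 * rho sigma g a p * sigma g p.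
Proof.
move=> cg dp; apply/eqP; rewrite -subr_eq0; apply/eqP; move: p dp.
apply: (sigma_cancel_sm cg) => p dp.
  apply: smB; first exact: sm_nu_sq.
  apply: smB; first exact: sm_cst.
  apply: smM; last exact: sm_sigma.
  by apply: smM; [exact: sm_cst|exact: sm_rho].
have [bp|bp] := pselect (boundary M p); first by rewrite (pe_zero hs cg bp) mul0r.
by rewrite (einstein_interior cg dp bp).1 subrr mulr0.
Qed.

Lemma hessE g a p i j : c g -> dom a p -> cov g a i (grad sigma g a) p j =
    - (sigma g p * schouten g a p i j) - rho sigma g a p * g a p i j.
Proof.
move=> cg dp; apply/eqP; rewrite -subr_eq0; apply/eqP; move: p dp.
apply: (sigma_cancel_sm cg) => p dp.
  apply: smB; first exact: sm_hess.
  apply: smB.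
    by apply: smN; apply: smM; [exact: sm_sigma|exact: sm_schouten].
  by apply: smM; [exact: sm_rho|have [_ _] := metric_at_c cg dp; apply].
have [bp|bp] := pselect (boundary M p); first by rewrite (pe_zero hs cg bp) mul0r.
by rewrite (einstein_interior cg dp bp).2 subrr mulr0.
Qed.

Lemma hess_sym g a p i j : c g -> dom a p ->
  cov g a i (grad sigma g a) p j = cov g a j (grad sigma g a) p i.
Proof.
move=> cg dp; have hg := metric_at_c cg dp.
have P1 : pd a i (grad sigma g a j) p = pd a j (grad sigma g a i) p :=
  pd_comm hM i j dp (sm_sigma cg dp).
have P2 : \sum_k christoffel g a k i j p * grad sigma g a k p =
    \sum_k christoffel g a k j i p * grad sigma g a k p.
  by apply: eq_bigr => l _; rewrite (christoffel_sym hM dp hg l i j).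
by rewrite /cov P1 P2.
Qed.

End PE.

(** * The tilde operators in a fixed scale and chart *)

Section Local.
Context {R : realType} {n : nat} {M : chart_space R n.+1}.
Hypothesis hM : manifold_with_boundary M.
Hypothesis hn : (2 <= n)%N.
Variables (c : set (metric M)) (sigma : metric M -> M -> R).
Hypotheses (hc : conformal_class c) (hs : poincare_einstein c sigma).
Variables (g : metric M) (a : chart M).
Hypothesis cg : c g.
Local Notation ext := (exterior R n.+1).
Implicit Types (p q : M) (i j k l : 'I_n.+1) (f : M -> R) (A B C ph : M -> ext).

Definition smooth_field A := forall p, dom a p -> smx a p A.

Local Notation s := (sigma g).
Local Notation m := (n.+1%:R : R).
(* In a fixed scale and chart Defs' operators are definitionally these; in
   [tilde_iota_at] the scalar [x] stands for [d + w' - 2k]. *)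
Definition ext_nu_at A q : ext := ext_mul (nu sigma g a q) (A q).
Definition int_nu_at A q : ext := int_mul (g a q) (nu sigma g a q) (A q).
Definition tilde_eps_at (w : R) A q : ext := w *: ext_nu_at A q - s q *: ed g a A q.
Definition tilde_iota_at (x : R) A q : ext := x *: int_nu_at A q - s q *: del g a A q.
Definition schouten_at A q : ext :=
  \sum_i \sum_j (invmx (g a q) *m schouten g a q) i j *: ext_basis j (int_basis i (A q)).
Definition J2P_at A q : ext := schouten_trace g a q *: A q - 2 *: schouten_at A q.

Let hg p (dp : dom a p) : metric_at g a p := metric_at_c hc cg dp.
Let ss p (dp : dom a p) : sm a p s := sm_sigma hs cg dp.
Let snu p (dp : dom a p) i : sm a p (fun q => nu sigma g a q i) := sm_nu hM hs i cg dp.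

Lemma sf_N A : smooth_field A -> smooth_field (ext_nu_at A).
Proof.
move=> hA p dp; apply: (@smx_ext_mul _ _ _ _ _ (fun i q => nu sigma g a q i)); last exact: hA.
by move=> j; exact: snu.
Qed.

Lemma sf_I A : smooth_field A -> smooth_field (int_nu_at A).
Proof.
move=> hA p dp; apply: (@smx_int_mul _ _ _ _ _ _ _ _ (fun i q => nu sigma g a q i)) => //.
- exact: hg.
- by move=> j; exact: snu.
- exact: hA.
Qed.

Lemma sf_ed A : smooth_field A -> smooth_field (ed g a A).
Proof. by move=> hA p dp; apply: smx_ed => //; [exact: hg|exact: hA]. Qed.

Lemma sf_del A : smooth_field A -> smooth_field (del g a A).
Proof. by move=> hA p dp; apply: smx_del => //; [exact: hg|exact: hA]. Qed.

Lemma sf_Z f A : (forall p, dom a p -> sm a p f) -> smooth_field A -> smooth_field (fun q => f q *: A q).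
Proof. by move=> hf hA p dp; apply: smxZ; [exact: hf|exact: hA]. Qed.

Lemma sf_cZ (x : R) A : smooth_field A -> smooth_field (fun q => x *: A q).
Proof. by apply: sf_Z => p _; exact: sm_cst. Qed.

Lemma sf_D A B : smooth_field A -> smooth_field B -> smooth_field (fun q => A q + B q).
Proof. by move=> hA hB p dp; apply: smxD; [exact: hA|exact: hB]. Qed.

Lemma sf_N1 A : smooth_field A -> smooth_field (fun q => - A q).
Proof. by move=> hA p dp; apply: smxN; exact: hA. Qed.

Lemma sf_B A B : smooth_field A -> smooth_field B -> smooth_field (fun q => A q - B q).
Proof. by move=> hA hB; apply: sf_D => //; exact: sf_N1. Qed.

Lemma sf_sZ A : smooth_field A -> smooth_field (fun q => s q *: A q).
Proof. by apply: sf_Z => p; exact: ss. Qed.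

Lemma sf_te w A : smooth_field A -> smooth_field (tilde_eps_at w A).
Proof. by move=> hA; apply: sf_B; [apply: sf_cZ; exact: sf_N|apply: sf_sZ; exact: sf_ed]. Qed.

Lemma sf_ti x A : smooth_field A -> smooth_field (tilde_iota_at x A).
Proof. by move=> hA; apply: sf_B; [apply: sf_cZ; exact: sf_I|apply: sf_sZ; exact: sf_del]. Qed.

Lemma sf_J2P A : smooth_field A -> smooth_field (J2P_at A).
Proof.
move=> hA; apply: sf_B; first by apply: sf_Z => // p dp; exact: (sm_schouten_trace hM hc).
apply: sf_cZ => p dp; apply: smx_sum => i _; apply: smx_sum => j _; apply: smxZ.
  apply: (@sm_eq _ _ _ _ _ (fun q => \sum_k invmx (g a q) i k * schouten g a q k j)).
    by move=> q _; rewrite [RHS]mxE.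
  apply: sm_sum => k _; apply: smM; last exact: (sm_schouten hM hc).
  by apply: smm_inv_metric => //; exact: hg.
apply: (@smx_lin _ _ _ (ext_basis j)); apply: (@smx_lin _ _ _ (int_basis i)); exact: hA.
Qed.

Lemma sf_rho A : smooth_field A -> smooth_field (fun q => rho sigma g a q *: A q).
Proof. by apply: sf_Z => p dp; exact: (sm_rho hM hc hs). Qed.

Lemma sf_dfx A p : smooth_field A -> dom a p -> dfx a p A.
Proof. by move=> hA dp; apply: smx_dfx; exact: hA. Qed.

Lemma sf_cancel A : smooth_field A -> (forall p, dom a p -> s p *: A p = 0) -> forall p, dom a p -> A p = 0.
Proof.
move=> hA H p dp; apply/ffunP => S; rewrite [RHS]ffunE.
apply: (sigma_cancel_sm hM hs cg (f := fun q => A q S)) dp.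
  by move=> q dq; exact: hA.
by move=> q dq; have /ffunP/(_ S) := H q dq; rewrite !ffunE.
Qed.

Lemma sf_eq A B : (forall p, dom a p -> A p = B p) -> smooth_field A -> smooth_field B.
Proof. by move=> AB hA p dp; apply: smx_eq (hA p dp). Qed.

Lemma ed_eq A B p : dom a p -> (forall q, dom a q -> A q = B q) -> ed g a A p = ed g a B p.
Proof. by move=> dp AB; apply: ed_near_eq => //; exact: near_ptT. Qed.

Lemma del_eq A B p : dom a p -> (forall q, dom a q -> A q = B q) -> del g a A p = del g a B p.
Proof. by move=> dp AB; apply: del_near_eq => //; exact: near_ptT. Qed.

Lemma ed0 p : dom a p -> ed g a (fun=> 0) p = 0.
Proof. by move=> dp; rewrite /ed big1 // => i _; rewrite /nab dx_cst // linear0 subr0 linear0. Qed.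

Lemma del0 p : dom a p -> del g a (fun=> 0) p = 0.
Proof.
move=> dp; rewrite /del big1 // => i _; rewrite big1 // => j _.
by rewrite /nab dx_cst // linear0 subr0 linear0 scaler0.
Qed.

Lemma ed_cZ (x : R) A p : smooth_field A -> dom a p -> ed g a (fun q => x *: A q) p = x *: ed g a A p.
Proof.
move=> hA dp; rewrite edZ //; [|exact: dfr_cst|exact: sf_dfx].
rewrite (_ : ext_mul _ _ = 0) ?add0r // /ext_mul big1 // => i _.
by rewrite pd_cst // scale0r.
Qed.

Lemma del_cZ (x : R) A p : smooth_field A -> dom a p -> del g a (fun q => x *: A q) p = x *: del g a A p.
Proof.
move=> hA dp; rewrite delZ //; [|exact: dfr_cst|exact: sf_dfx].
rewrite (_ : int_mul _ _ _ = 0) ?add0r // /int_mul big1 // => i _; rewrite big1 // => j _.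
by rewrite pd_cst // mulr0 scale0r.
Qed.

Lemma ed_N A p : smooth_field A -> dom a p -> ed g a (fun q => - A q) p = - ed g a A p.
Proof.
move=> hA dp; rewrite -[RHS]scaleN1r -(ed_cZ (-1) hA dp).
by apply: (ed_eq dp) => q _; rewrite scaleN1r.
Qed.

Lemma del_N A p : smooth_field A -> dom a p -> del g a (fun q => - A q) p = - del g a A p.
Proof.
move=> hA dp; rewrite -[RHS]scaleN1r -(del_cZ (-1) hA dp).
by apply: (del_eq dp) => q _; rewrite scaleN1r.
Qed.

Lemma ed_sZ A p : smooth_field A -> dom a p -> ed g a (fun q => s q *: A q) p = ext_nu_at A p + s p *: ed g a A p.
Proof. by move=> hA dp; rewrite edZ //; [exact/sm_dfr/ss|exact: sf_dfx]. Qed.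

Lemma del_sZ A p : smooth_field A -> dom a p -> del g a (fun q => s q *: A q) p = int_nu_at A p + s p *: del g a A p.
Proof. by move=> hA dp; rewrite delZ //; [exact/sm_dfr/ss|exact: sf_dfx]. Qed.

Lemma ext_nu_at_Z f A q : ext_nu_at (fun q => f q *: A q) q = f q *: ext_nu_at A q.
Proof. exact: ext_mulZ. Qed.
Lemma int_nu_at_Z f A q : int_nu_at (fun q => f q *: A q) q = f q *: int_nu_at A q.
Proof. exact: int_mulZ. Qed.
Lemma int_nu_at_B A B q : int_nu_at (fun q => A q - B q) q = int_nu_at A q - int_nu_at B q.
Proof. by rewrite /int_nu_at linearB. Qed.
Lemma int_nu_at_I A q : int_nu_at (int_nu_at A) q = 0.
Proof. exact: int_mul_sqr. Qed.

Lemma del_I A p : smooth_field A -> dom a p -> del g a (int_nu_at A) p = - int_nu_at (del g a A) p.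
Proof.
move=> hA dp; apply: (@del_int_mul _ _ _ hM _ _ _ dp (hg dp) (grad sigma g a)).
- by move=> j; exact/sm_dfr/snu.
- exact: sf_dfx.
- by move=> i j; exact: (hess_sym hM hc hs).
Qed.

(** Differentiating sigma yields one more nu, which accounts for the shift of the weight by one. *)
Lemma tilde_eps_sigma w A p : smooth_field A -> dom a p ->
  tilde_eps_at (w + 1) (fun q => s q *: A q) p = s p *: tilde_eps_at w A p.
Proof.
move=> hA dp; rewrite /tilde_eps_at ext_nu_at_Z ed_sZ //.
move: (ext_nu_at A p) (ed g a A p) (s p) => x y z.
by apply/ffunP => S; rewrite !ffunE /GRing.scale /=; ring.
Qed.

Lemma tilde_iota_sigma x A p : smooth_field A -> dom a p ->
  tilde_iota_at (x + 1) (fun q => s q *: A q) p = s p *: tilde_iota_at x A p.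
Proof.
move=> hA dp; rewrite /tilde_iota_at int_nu_at_Z del_sZ //.
move: (int_nu_at A p) (del g a A p) (s p) => u y z.
by apply/ffunP => S; rewrite !ffunE /GRing.scale /=; ring.
Qed.

Lemma del_del0 A p : smooth_field A -> dom a p -> del g a (del g a A) p = 0.
Proof. by move=> hA dp; apply: del_del => //; [exact: hg|exact: hA]. Qed.

(** Lowering both k and w' by one raises d + w' - 2k by one. With this shift the mixed terms cancel,
    delta anticommuting with iota(nu) because the Hessian of sigma is symmetric. *)
Lemma tilde_iota_sqr x A p : smooth_field A -> dom a p -> tilde_iota_at (x + 1) (tilde_iota_at x A) p = 0.
Proof.
move=> hA dp; have hI := sf_I hA; have hD := sf_del hA.
rewrite {1}/tilde_iota_at /tilde_iota_at int_nu_at_B int_nu_at_Z (int_nu_at_Z s) int_nu_at_I delD; first last.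
- by apply: dfx_eq (sf_dfx (sf_N1 (sf_sZ hD)) dp).
- exact: sf_dfx (sf_cZ x hI) dp.
- exact: dp.
- exact: hM.
rewrite del_N //; last exact: sf_sZ.
rewrite del_cZ // del_I // del_sZ // del_del0 //.
move: (int_nu_at (del g a A) p) (s p) => u z.
by apply/ffunP => S; rewrite !ffunE /GRing.scale /=; ring.
Qed.

Lemma int_nu_at_N_anti A q : dom a q ->
  int_nu_at (ext_nu_at A) q = (1 - 2 * rho sigma g a q * s q) *: A q - ext_nu_at (int_nu_at A) q.
Proof.
by move=> dq; rewrite /int_nu_at int_mul_ext -(nu_sqE hM hn hc hs cg dq).
Qed.

Lemma derv_hess (kk : int) A p : dom a p -> homogeneous kk (A p) ->
  derv (fun k e => \sum_j invmx (g a p) k j * cov g a j (grad sigma g a) p e) (A p) =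
  - (s p *: schouten_at A p) - (kk%:~R * rho sigma g a p) *: A p.
Proof.
move=> dp hA; have [_ gu _] := hg dp; have gpu := near_pt_at dp gu.
have -> : derv (fun k e => \sum_j invmx (g a p) k j * cov g a j (grad sigma g a) p e) (A p) =
  derv (fun k e => - s p * (invmx (g a p) *m schouten g a p) k e
                   + - rho sigma g a p * (k == e)%:R) (A p).
  apply: eq_derv => k e.
  have -> : (k == e)%:R = (invmx (g a p) *m g a p) k e by rewrite mulVmx // mxE.
  rewrite mxE [X in _ + _ * X]mxE !mulr_sumr -big_split; apply: eq_bigr => j _ /=.
  rewrite (hessE hM hn hc hs j e cg dp).
  by move: (schouten g a p j e) (g a p j e) (invmx (g a p) k j) (rho sigma g a p) => *; ring.
rewrite dervDl !dervZl; congr (_ + _).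
  rewrite scaleNr; congr (- (_ *: _)).
  by rewrite /derv /schouten_at exchange_big.
have -> : derv (fun k e => (k == e)%:R) (A p) = kk%:~R *: A p.
  rewrite -(ext_int_euler hA) /derv; apply: eq_bigr => e _.
  rewrite (bigD1 e) //= eqxx scale1r big1 ?addr0 // => k ke.
  by rewrite (negbTE ke) scale0r.
by rewrite scalerA mulNr scaleNr mulrC.
Qed.

Lemma hess_trace p : dom a p ->
  \sum_j \sum_i invmx (g a p) i j * cov g a j (grad sigma g a) p i =
  - m * rho sigma g a p - schouten_trace g a p * s p.
Proof.
move=> dp.
have E : rho sigma g a p = - m^-1 * (\sum_i \sum_j invmx (g a p) i j *
   cov g a i (grad sigma g a) p j + schouten_trace g a p * s p) by [].
rewrite exchange_big /=.
have -> : \sum_i \sum_j invmx (g a p) i j * cov g a j (grad sigma g a) p i =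
  \sum_i \sum_j invmx (g a p) i j * cov g a i (grad sigma g a) p j.
  by apply: eq_bigr => i _; apply: eq_bigr => j _; rewrite (hess_sym hM hc hs i j cg dp).
rewrite E; set x := \sum_i _; set y := schouten_trace g a p * s p.
have m0 : m != 0 by rewrite pnatr_eq0.
by move: m x y m0 => m' x y m0; field.
Qed.

(** The derivative along nu is eliminated between [del_ext_mul] and [ed_int_mul]. Each of them
    contributes the Hessian of sigma acting as a derivation, and the first also its trace; by the
    Einstein equation the trace gives J once and the two derivations give P twice. This is the
    origin of the combination J - 2P. *)
Lemma del_N_formula (kk : int) A p : smooth_field A -> dom a p -> homogeneous kk (A p) ->
  del g a (ext_nu_at A) p = - ext_nu_at (del g a A) p
   + (2 * kk%:~R - m) * rho sigma g a p *: A p - s p *: J2P_at A p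
   + ed g a (int_nu_at A) p + int_nu_at (ed g a A) p.
Proof.
move=> hA dp hk.
have H1 := del_ext_mul hM g dp (u := grad sigma g a) (fun j => sm_dfr (snu dp j)) (sf_dfx hA dp).
have H2 := ed_int_mul hM dp (hg dp) (u := grad sigma g a) (fun j => sm_dfr (snu dp j)) (sf_dfx hA dp).
have D1 := derv_hess dp hk.
have D2 : derv (fun k e => \sum_j invmx (g a p) k j * cov g a e (grad sigma g a) p j) (A p) =
  derv (fun k e => \sum_j invmx (g a p) k j * cov g a j (grad sigma g a) p e) (A p).
  apply: eq_derv => k e; apply: eq_bigr => j _.
  by rewrite (hess_sym hM hc hs e j cg dp).
move: H2; rewrite D2 D1 => H2.
move: H1; rewrite D1 hess_trace // => H1.
have E : \sum_j (\sum_i invmx (g a p) i j * grad sigma g a i p) *: nab g a j A p =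
  \sum_i (\sum_j invmx (g a p) i j * grad sigma g a j p) *: nab g a i A p.
  apply: eq_bigr => j _; congr (_ *: _); apply: eq_bigr => i _; congr (_ * _).
  have [gs _ _] := hg dp; exact: (inv_metric_sym dp (hg dp)).
move: H1; rewrite E.
have -> : \sum_i (\sum_j invmx (g a p) i j * grad sigma g a j p) *: nab g a i A p =
   ed g a (int_nu_at A) p + int_nu_at (ed g a A) p - (- (s p *: schouten_at A p) - (kk%:~R * rho sigma g a p) *: A p).
  by rewrite -[ed g a (int_nu_at A) p + _]/(ed g a (fun q => int_mul (g a q) ((grad sigma g a)^~ q) (A q)) p
      + int_mul (g a p) ((grad sigma g a)^~ p) (ed g a A p)) H2 addrAC addrN add0r.
move=> H1.
have -> : del g a (ext_nu_at A) p = del g a (fun q => ext_mul ((grad sigma g a)^~ q) (A q)) p +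
   ext_mul ((grad sigma g a)^~ p) (del g a A p) - ext_nu_at (del g a A) p by rewrite addrK.
rewrite H1 /J2P_at.
move: (ext_nu_at (del g a A) p) (ed g a (int_nu_at A) p) (int_nu_at (ed g a A) p) (schouten_at A p) (A p) (s p)
  (schouten_trace g a p) (rho sigma g a p) => x1 x2 x3 x4 x5 y1 y2 y3.
by apply/ffunP => S; rewrite !ffunE /GRing.scale /=; ring.
Qed.

End Local.

Section Linearity.
Context {R : realType} {m : nat}.
Implicit Types (A B : exterior R m) (u : 'I_m -> R) (G : 'M[R]_m).
Lemma int_mulB G u A B : int_mul G u (A - B) = int_mul G u A - int_mul G u B.
Proof. exact: linearB. Qed.
Lemma int_mulD G u A B : int_mul G u (A + B) = int_mul G u A + int_mul G u B.
Proof. exact: linearD. Qed.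
Lemma int_mulN G u A : int_mul G u (- A) = - int_mul G u A.
Proof. exact: linearN. Qed.
Lemma ext_mulN u A : ext_mul u (- A) = - ext_mul u A.
Proof. exact: linearN. Qed.
End Linearity.

(** * The operator y on western insertions *)

Section WesternPairs.
Context {R : realType} {n : nat} {M : chart_space R n.+1}.
Hypothesis hM : manifold_with_boundary M.
Hypothesis hn : (2 <= n)%N.
Variables (c : set (metric M)) (sigma : metric M -> M -> R).
Hypotheses (hc : conformal_class c) (hs : poincare_einstein c sigma).
Variables (g : metric M) (a : chart M).
Hypothesis cg : c g.
Local Notation ext := (exterior R n.+1).
Implicit Types (p q : M) (i j k l : 'I_n.+1) (f : M -> R) (A B C ph : M -> ext).
Local Notation s := (sigma g).
Local Notation m := (n.+1%:R : R).
Local Notation SF := (smooth_field a).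
Local Notation lI := (int_nu_at sigma g a).
Local Notation lN := (ext_nu_at sigma g a).
Local Notation lte := (tilde_eps_at sigma g a).
Local Notation lti := (tilde_iota_at sigma g a).
Local Notation lJ2P := (J2P_at g a).
Local Notation ed := (ed g a).
Local Notation del := (del g a).
Local Notation rho := (rho sigma g a).
Variable kk : int.

(* [C] and [ph] are the west and south slots of a tractor annihilated by I^* and
   hat D^*. *)
Record western_pair (X : R) C ph : Prop := {
  wp_C : SF C;
  wp_ph : SF ph;
  wp_deg : forall p, dom a p -> homogeneous kk (C p);
  wp_I : forall p, dom a p -> lI C p + s p *: ph p = 0;
  wp_del : forall p, dom a p -> del C p + (X + 1) *: ph p = 0
}.

(* The slots of D on (0, C, 0, ph) and the two nonzero slots of y, written with
   [X + w = d + 2 w0 - 1]. *)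
Definition D_north (w X : R) C q : ext := (X + w - 1) *: (w *: C q).
Definition D_west (w X : R) C q : ext := (X + w - 1) *: ed C q.
Definition D_east (w X : R) C ph q : ext := (X + w + 1) *: ((w - 2) *: ph q) - 2 *: del C q.
Definition D_south (w X : R) C ph q : ext :=
  - (ed (del C) q + del (ed C) q + w *: lJ2P C q) - (X + w + 1) *: ed ph q.
Definition y_west (w X : R) C ph q : ext :=
  - (rho q *: D_north w X C q + lI (D_west w X C) q + s q *: D_south w X C ph q).
Definition y_south (w X : R) C ph q : ext := - (rho q *: D_east w X C ph q - lI (D_south w X C ph) q).

Section Step.
Variables (w X : R) (C ph : M -> ext).
Hypotheses (hX : X = m + w - 2 * kk%:~R - 1) (hN : western_pair X C ph).
Let hC := wp_C hN.
Let hph := wp_ph hN.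

Lemma wp_IE p : dom a p -> lI C p = - (s p *: ph p).
Proof. by move=> dp; apply/eqP; rewrite -addr_eq0 (wp_I hN dp). Qed.

Lemma wp_delE p : dom a p -> del C p = - ((X + 1) *: ph p).
Proof. by move=> dp; apply/eqP; rewrite -addr_eq0 (wp_del hN dp). Qed.

(** After multiplication by sigma it becomes iota(nu) iota(nu) C = 0, up to sign. *)
Lemma wp_Iph p : dom a p -> lI ph p = 0.
Proof.
move: p; apply: (sf_cancel hM hs cg) => [|p dp]; first exact: (sf_I hM hc hs cg).
rewrite -(int_nu_at_Z sigma g a s ph p).
have -> : lI (fun q => s q *: ph q) p = - lI (lI C) p.
  by rewrite /int_nu_at -int_mulN; congr int_mul; rewrite -/(lI C p) wp_IE // opprK.
by rewrite int_nu_at_I oppr0.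
Qed.

Lemma smooth_D_south : SF (D_south w X C ph).
Proof.
apply: sf_B; last by apply: sf_cZ; exact: (sf_ed hM hc cg).
apply: sf_N1; apply: sf_D; last by apply: sf_cZ; exact: (sf_J2P hM hc cg).
by apply: sf_D; [apply: (sf_ed hM hc cg); exact: (sf_del hM hc cg)|apply: (sf_del hM hc cg); exact: (sf_ed hM hc cg)].
Qed.

Lemma smooth_y_west : SF (y_west w X C ph).
Proof.
apply: sf_N1; apply: sf_D; last by apply: (sf_sZ hs cg); exact: smooth_D_south.
apply: sf_D; last by apply: (sf_I hM hc hs cg); apply: sf_cZ; exact: (sf_ed hM hc cg).
by apply: (sf_rho hM hc hs cg); apply: sf_cZ; apply: sf_cZ.
Qed.

Lemma smooth_y_south : SF (y_south w X C ph).
Proof.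
apply: sf_N1; apply: sf_B; last by apply: (sf_I hM hc hs cg); exact: smooth_D_south.
apply: (sf_rho hM hc hs cg); apply: sf_B; first by apply: sf_cZ; exact: sf_cZ.
by apply: sf_cZ; exact: (sf_del hM hc cg).
Qed.

(** The only contribution without a factor sigma comes from the length 1 - 2 rho sigma of nu and is
    [w X C]. The two equations of a western pair replace iota(nu) C and delta C by multiples of phi,
    whose products with nu then cancel; the rest is evaluated by [del_N_formula] and matches the
    western slot of y term by term. *)
Lemma key_formula p : dom a p ->
  lti X (lte w C) p = (w * X) *: C p + s p *: y_west w X C ph p.
Proof.
move=> dp.
have hed := sf_ed hM hc cg hC.
have hNC := sf_N hM hs cg hC.
have E1 : lI (lte w C) p = w *: lI (lN C) p - s p *: lI (ed C) p.
  by rewrite /int_nu_at /tilde_eps_at int_mulB !int_mulZ.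
have E2 : lI (lN C) p = (1 - 2 * rho p * s p) *: C p + s p *: lN ph p.
  rewrite (int_nu_at_N_anti hM hn hc hs cg C dp); congr (_ + _).
  have -> : lN (lI C) p = lN (fun q => - (s q *: ph q)) p.
    by rewrite /ext_nu_at wp_IE.
  by rewrite /ext_nu_at ext_mulN ext_mulZ opprK.
have E3 : del (lte w C) p = w *: del (lN C) p - (lI (ed C) p + s p *: del (ed C) p).
  rewrite /tilde_eps_at (delD hM g dp); first last.
  - by apply: sf_dfx dp; apply: sf_N1; exact: (sf_sZ hs cg).
  - by apply: sf_dfx dp; exact: sf_cZ.
  rewrite (del_cZ hM g w hNC dp); congr (_ + _).
  by rewrite (del_N hM g (sf_sZ hs cg hed) dp) (del_sZ hM hs cg hed dp).
have E4 : lN (del C) p = - ((X + 1) *: lN ph p).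
  by rewrite /ext_nu_at wp_delE // ext_mulN ext_mulZ.
have E5 : ed (lI C) p = - (lN ph p + s p *: ed ph p).
  rewrite -(ed_sZ hM hs cg hph dp) -(ed_N hM g (sf_sZ hs cg hph) dp).
  by apply: (ed_eq hM g dp) => q dq; rewrite wp_IE.
have E6 : ed (del C) p = - ((X + 1) *: ed ph p).
  rewrite -(ed_cZ hM g (X + 1) hph dp) -(ed_N hM g (sf_cZ (X + 1) hph) dp).
  by apply: (ed_eq hM g dp) => q dq; rewrite wp_delE.
have E7 : lI (D_west w X C) p = (X + w - 1) *: lI (ed C) p by rewrite /int_nu_at int_mulZ.
rewrite /tilde_iota_at E1 E2 E3 (del_N_formula hM hn hc hs cg hC dp (wp_deg hN dp)) E4 E5.
rewrite /y_west E7 /D_south /D_north E6 hX.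
move: (lN ph p) (ed ph p) (lI (ed C) p) (del (ed C) p) (lJ2P C p) (C p) (s p) (rho p).
move=> x1 x2 x3 x4 x5 x6 y1 y2.
apply/ffunP => S; rewrite !ffunE /GRing.scale /=.
move: (x1 S) (x2 S) (x3 S) (x4 S) (x5 S) (x6 S) => z1 z2 z3 z4 z5 z6.
move: m (kk%:~R : R) => m' k'; ring.
Qed.

Lemma step_north p : dom a p -> lI (D_north w X C) p + s p *: D_east w X C ph p = 0.
Proof.
move=> dp.
have -> : lI (D_north w X C) p = (X + w - 1) *: (w *: lI C p) by rewrite /int_nu_at /D_north !int_mulZ.
rewrite wp_IE // /D_east wp_delE //.
move: (ph p) (s p) => x y; apply/ffunP => S; rewrite !ffunE /GRing.scale /=; ring.
Qed.

Lemma step_east p : dom a p -> lI (D_east w X C ph) p = 0.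
Proof.
move=> dp.
rewrite /int_nu_at /D_east wp_delE // int_mulB !int_mulZ int_mulN int_mulZ.
by rewrite -/(lI ph p) wp_Iph // !scaler0 oppr0 scaler0 subr0.
Qed.

Lemma step_I p : dom a p -> lI (y_west w X C ph) p + s p *: y_south w X C ph p = 0.
Proof.
move=> dp; rewrite /y_south.
have -> : lI (y_west w X C ph) p = - (rho p *: lI (D_north w X C) p + s p *: lI (D_south w X C ph) p).
  have G1 (x y z : ext) r t : int_mul (g a p) (nu sigma g a p) (- (r *: x + y + t *: z)) =
    - (r *: int_mul (g a p) (nu sigma g a p) x + int_mul (g a p) (nu sigma g a p) y
       + t *: int_mul (g a p) (nu sigma g a p) z).
    by rewrite int_mulN !int_mulD !int_mulZ.
  rewrite [LHS]G1 -[int_mul _ _ (lI (D_west w X C) p)]/(lI (lI (D_west w X C)) p) int_nu_at_I addr0.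
  by [].
have -> : lI (D_north w X C) p = - (s p *: D_east w X C ph p).
  by apply/eqP; rewrite -addr_eq0 step_north.
move: (D_east w X C ph p) (lI (D_south w X C ph) p) (s p) (rho p) => x y z t.
by apply/ffunP => S; rewrite !ffunE /GRing.scale /=; ring.
Qed.

Lemma step_sW p : dom a p -> s p *: y_west w X C ph p = lti X (lte w C) p - (w * X) *: C p.
Proof. by move=> dp; rewrite key_formula // addrC addKr. Qed.

(** Two cancellations. By the intertwining, sigma times iota~ of [y_west] is iota~ of (T - w X) C,
    which vanishes since iota~ iota~ = 0 and iota~ C = 0. Once iota~ of [y_west] is zero, [step_I]
    exhibits it as - sigma times the expression claimed to vanish. *)
Lemma step_del p : dom a p -> del (y_west w X C ph) p + X *: y_south w X C ph p = 0.
Proof.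
have hW := smooth_y_west; have hS := smooth_y_south.
have tW p' : dom a p' -> lti X (y_west w X C ph) p' = 0.
  move: p'; apply: (sf_cancel hM hs cg); first exact: (sf_ti hM hc hs cg).
  move=> q dq; rewrite -(tilde_iota_sigma hM hs cg X hW dq).
  have hte := sf_te hM hc hs cg w hC.
  have htt := sf_ti hM hc hs cg X hte.
  have -> : lti (X + 1) (fun q => s q *: y_west w X C ph q) q =
     lti (X + 1) (lti X (lte w C)) q - (w * X) *: lti (X + 1) C q.
    rewrite /tilde_iota_at.
    have -> : del (fun q => s q *: y_west w X C ph q) q =
      del (lti X (lte w C)) q - (w * X) *: del C q.
      rewrite -(del_cZ hM g (w * X) hC dq) -(del_N hM g (sf_cZ (w * X) hC) dq).
      rewrite -(delD hM g dq (sf_dfx htt dq)); last exact: sf_dfx (sf_N1 (sf_cZ (w * X) hC)) dq.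
      by apply: (del_eq hM g dq) => r dr; rewrite step_sW.
    have -> : lI (fun q => s q *: y_west w X C ph q) q =
      lI (lti X (lte w C)) q - (w * X) *: lI C q.
      by rewrite /int_nu_at step_sW // int_mulB int_mulZ.
    rewrite -/(lti X (lte w C)).
    move: (lI (lti X (lte w C)) q) (del (lti X (lte w C)) q) (lI C q) (del C q) (s q) => x y z t u.
    by apply/ffunP => S; rewrite !ffunE /GRing.scale /=; ring.
  rewrite (tilde_iota_sqr hM hc hs cg X hte dq) /tilde_iota_at wp_IE // wp_delE //.
  move: (ph q) (s q) => x y.
  by apply/ffunP => S; rewrite !ffunE /GRing.scale /=; ring.
move: p; apply: (sf_cancel hM hs cg).
  by apply: sf_D; [exact: (sf_del hM hc cg)|exact: sf_cZ].
move=> p dp; have := tW p dp; rewrite /tilde_iota_at.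
have -> : lI (y_west w X C ph) p = - (s p *: y_south w X C ph p).
  by apply/eqP; rewrite -addr_eq0 step_I.
move: (y_south w X C ph p) (del (y_west w X C ph) p) (s p) => x y z H.
apply/ffunP => S; have /ffunP/(_ S) := H; rewrite !ffunE /GRing.scale /= => E.
by rewrite -[RHS]oppr0 -E; ring.
Qed.

(** Inherited by cancellation from sigma [y_west], a combination of [C] and T C, both of degree
    [kk]. *)
Lemma step_deg p : dom a p -> homogeneous kk (y_west w X C ph p).
Proof.
move=> dp S WS; apply: contrapT => Sk; move: WS.
suff -> : y_west w X C ph p S = 0 by rewrite eqxx.
move: p dp; apply: (sigma_cancel_sm hM hs cg) => p dp; first exact: smooth_y_west.
have h0 : homogeneous kk (s p *: y_west w X C ph p).
  rewrite step_sW //; apply: homogeneousB; last by apply: homogeneousZ; exact: (wp_deg hN).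
  have hte q : dom a q -> homogeneous (kk + 1) (lte w C q).
    move=> dq; apply: homogeneousB; apply: homogeneousZ.
      by apply: homogeneous_ext_mul; exact: (wp_deg hN).
    apply: homogeneous_sum => i _; apply: homogeneous_ext_basis.
    apply: homogeneousB; last by apply: homogeneous_derv; exact: (wp_deg hN).
    move=> T; rewrite ffunE => nz; apply: contrapT => Tk; move/eqP: nz; apply.
    rewrite -[RHS](pd_cst hM i 0 dq); apply: pd_eq => // r dr.
    by apply: contrapT => /eqP /(wp_deg hN dr).
  rewrite -[kk](addrK 1); apply: homogeneousB; apply: homogeneousZ.
    by apply: homogeneous_int_mul; exact: hte.
  apply: homogeneous_sum => i _; apply: homogeneous_sum => j _; apply: homogeneousZ.
  apply: homogeneous_int_basis.
  apply: homogeneousB; last by apply: homogeneous_derv; exact: hte.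
  move=> T; rewrite ffunE => nz; apply: contrapT => Tk; move/eqP: nz; apply.
  rewrite -[RHS](pd_cst hM j 0 dp); apply: pd_eq => // r dr.
  by apply: contrapT => /eqP /(hte r dr).
have := h0 S; rewrite ffunE /GRing.scale /=.
by have [-> //|nz /(_ isT) /Sk] := eqVneq (s p * _) 0.
Qed.

Lemma wp_step : western_pair (X - 1) (y_west w X C ph) (y_south w X C ph).
Proof.
split; [exact: smooth_y_west|exact: smooth_y_south|exact: step_deg|exact: step_I|].
by move=> p dp; rewrite subrK; exact: step_del.
Qed.

End Step.
End WesternPairs.

(** * Invariance of the tilde operators and of western insertions *)

Section Density.
Context {R : realType} {n : nat} {M : chart_space R n.+1}.
Hypothesis hM : manifold_with_boundary M.
Hypothesis hn : (2 <= n)%N.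
Variables (c : set (metric M)) (sigma : metric M -> M -> R).
Hypotheses (hc : conformal_class c) (hs : poincare_einstein c sigma).
Local Notation ext := (exterior R n.+1).
Implicit Types (g : metric M) (a b : chart M) (p q : M) (i j l : 'I_n.+1) (f : M -> R)
  (A B C ph : dform M) (k : int) (w x : R).
Local Notation m := (n.+1%:R : R).
Local Notation J := (jacobian).

(** Smoothness in every chart and scale, without the transformation laws: known for the slots of y
    from their formulas before they are shown to be invariant. *)
Definition sform A := forall g a, c g -> smooth_field a (A g a).

Lemma density_sform k w A : density_form c k w A -> sform A.
Proof. by move=> [H _] g a cg p dp S; exact: (form_smooth (H g cg)). Qed.

Lemma homogeneous_field k (F : M -> ext) a i p : dom a p ->
  (forall q, dom a q -> homogeneous k (F q)) -> homogeneous k (dx a i F p).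
Proof.
move=> dp hF T; rewrite ffunE => nz; apply: contrapT => Tk; move/eqP: nz; apply.
rewrite -[RHS](pd_cst hM i 0 dp); apply: pd_eq => // r dr.
by apply: contrapT => /eqP /(hF r dr).
Qed.

Lemma homogeneous_ed k g a (F : M -> ext) p : dom a p ->
  (forall q, dom a q -> homogeneous k (F q)) -> homogeneous (k + 1) (ed g a F p).
Proof.
move=> dp hF; apply: homogeneous_sum => i _; apply: homogeneous_ext_basis.
by apply: homogeneousB; [exact: homogeneous_field|apply: homogeneous_derv; exact: hF].
Qed.

Lemma homogeneous_del k g a (F : M -> ext) p : dom a p ->
  (forall q, dom a q -> homogeneous k (F q)) -> homogeneous (k - 1) (del g a F p).
Proof.
move=> dp hF; apply: homogeneous_sum => i _; apply: homogeneous_sum => j _.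
apply: homogeneousZ; apply: homogeneous_int_basis.
by apply: homogeneousB; [exact: homogeneous_field|apply: homogeneous_derv; exact: hF].
Qed.

Section Chart.
Variables (g : metric M) (a b : chart M) (p : M).
Hypotheses (cg : c g) (da : dom a p) (db : dom b p).
Let hga : metric_at g a p := metric_at_c hc cg da.
Let hgb : metric_at g b p := metric_at_c hc cg db.
Let ht q : dom a q -> dom b q -> g a q = (J a b q)^T *m g b q *m J a b q.
Proof. by move=> dq dq'; exact: (tensor_c hc cg). Qed.
Variables (Fa Fb : M -> ext).
Hypotheses (hFb : dfx b p Fb)
  (hF : forall q, dom a q -> dom b q -> Fa q = ext_pullback (J a b q) (Fb q)).

Lemma near_pullback : near_pt a p (fun q => Fa q = ext_pullback (J a b q) (Fb q)).
Proof. by apply: near_ptS (near_dom hM da db) => q dq dq'; exact: hF. Qed.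

Lemma nu_chart i : nu sigma g a p i = \sum_j J a b p j i * nu sigma g b p j.
Proof. by have [_ H] := dfr_chart hM da db (sm_dfr (sm_sigma hs cg db)); exact: H. Qed.

Lemma ext_nu_at_chart : ext_nu_at sigma g a Fa p = ext_pullback (J a b p) (ext_nu_at sigma g b Fb p).
Proof.
rewrite /ext_nu_at hF // -(ext_mul_chart p (J a b)).
by apply: eq_ext_mul => i; exact: nu_chart.
Qed.

Lemma int_nu_at_chart : int_nu_at sigma g a Fa p = ext_pullback (J a b p) (int_nu_at sigma g b Fb p).
Proof.
rewrite /int_nu_at hF // -(int_mul_chart da db hga hgb ht).
by apply: eq_int_mul => i; exact: nu_chart.
Qed.

Lemma tilde_eps_at_chart w : tilde_eps_at sigma g a w Fa p = ext_pullback (J a b p) (tilde_eps_at sigma g b w Fb p).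
Proof.
rewrite /tilde_eps_at ext_nu_at_chart (ed_chart hM da db hga hgb (erefl (J a b)) ht hFb near_pullback).
by rewrite -!linearZ_pullback -(linearB (ext_pullback (J a b p))).
Qed.

Lemma tilde_iota_at_chart x : tilde_iota_at sigma g a x Fa p = ext_pullback (J a b p) (tilde_iota_at sigma g b x Fb p).
Proof.
rewrite /tilde_iota_at int_nu_at_chart (del_chart hM da db hga hgb (erefl (J a b)) ht hFb near_pullback).
by rewrite -!linearZ_pullback -(linearB (ext_pullback (J a b p))).
Qed.

End Chart.

Section Rescale.
Variables (g g' : metric M) (Om : M -> R) (a : chart M) (p : M).
Hypotheses (cg : c g) (cg' : c g') (hr : rescaled Om g g') (dp : dom a p).
Let hg : metric_at g a p := metric_at_c hc cg dp.
Let hg' : metric_at g' a p := metric_at_c hc cg' dp.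
Let sOm : sm a p Om. Proof. by case: hr => H _ _; exact: H. Qed.
Let Op : 0 < Om p := rescaled_pos hr dp.
Let hcf : near_pt a p (fun q => g' a q = Om q ^+ 2 *: g a q).
Proof. by case: hr => _ _ H; apply: near_ptT => q dq; exact: H. Qed.
Local Notation U := (Up a p Om).
Variables (w : R) (F F' : M -> ext) (k : int).
Hypotheses (hF : dfx a p F) (hk : forall q, dom a q -> homogeneous k (F q)) 
  (hFF : forall q, dom a q -> F' q = Om q `^ w *: F q).

Lemma nu_conf i : nu sigma g' a p i = Om p * (nu sigma g a p i + sigma g p * U i).
Proof.
have -> : nu sigma g' a p i = pd a i (fun q => Om q * sigma g q) p.
  by apply: pd_eq => // q dq; exact: (sigma_conf hs cg cg' hr dq).
rewrite (pdM hM i dp (sm_dfr sOm) (sm_dfr (sm_sigma hs cg dp))).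
rewrite -/(nu sigma g a p i) /Up.
have O0 : Om p != 0 by rewrite gt_eqF.
by move: (pd a i Om p) (nu sigma g a p i) (sigma g p) (Om p) O0 => x y z t t0; field.
Qed.

Lemma ext_nu_at_conf : ext_nu_at sigma g' a F' p = (Om p * Om p `^ w) *:
  (ext_nu_at sigma g a F p + sigma g p *: ext_mul U (F p)).
Proof.
rewrite /ext_nu_at hFF // ext_mulZ (eq_ext_mul _ nu_conf) ext_mulZl ext_mulDl ext_mulZl scalerA.
by rewrite mulrC.
Qed.

Lemma int_mul_conf (u : 'I_n.+1 -> R) (X : ext) :
  int_mul (g' a p) u X = Om p ^- 2 *: int_mul (g a p) u X.
Proof.
have [_ gu _] := hg; have gpu := near_pt_at dp gu.
rewrite !int_mulE -int_vecZl; apply: eq_int_vec => i.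
rewrite mulr_sumr; apply: eq_bigr => j _.
rewrite (near_pt_at dp hcf) invmxZ ?mxE ?mulrA // unitmxZ // unitfE expf_neq0 // gt_eqF //.
Qed.

Lemma int_nu_at_conf : int_nu_at sigma g' a F' p = (Om p ^- 1 * Om p `^ w) *:
  (int_nu_at sigma g a F p + sigma g p *: int_mul (g a p) U (F p)).
Proof.
have O0 : Om p != 0 by rewrite gt_eqF.
rewrite /int_nu_at hFF // int_mulZ int_mul_conf (eq_int_mul _ _ nu_conf) int_mulZl int_mulDl int_mulZl.
rewrite !scalerA; congr (_ *: _).
by move: (Om p) (Om p `^ w) O0 => x y x0; field.
Qed.

Lemma ed_conf : ed g' a F' p = Om p `^ w *: (ed g a F p + w *: ext_mul U (F p)).
Proof.
rewrite (ed_eq hM g' dp hFF) (edE hM dp hg') -(edE hM dp hg).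
rewrite edZ //; last exact: dfr_powR.
rewrite (eq_ext_mul _ (pd_powR hM dp sOm Op w)) ext_mulZl ext_mulZl -scalerDr addrC.
by [].
Qed.

Lemma del_conf_w : del g' a F' p = (Om p ^- 2 * Om p `^ w) *:
  (del g a F p + (w + m - 2 * k%:~R) *: int_mul (g a p) U (F p)).
Proof.
have O0 : Om p != 0 by rewrite gt_eqF.
rewrite (del_eq hM g' dp hFF).
rewrite (del_conf hM dp hg sOm O0 hcf (kk := k)); last by apply: homogeneousZ; exact: hk.
rewrite delZ //; last exact: dfr_powR.
rewrite (eq_int_mul _ _ (pd_powR hM dp sOm Op w)) !int_mulZl int_mulZ.
move: (int_mul _ _ _) (del g a F p) => x y; rewrite -[RHS]scalerA; congr (_ *: _).
by apply/ffunP => S; rewrite !ffunE /GRing.scale /=; ring.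
Qed.

Lemma powR_D1 : Om p `^ (w + 1) = Om p * Om p `^ w.
Proof.
rewrite powRD ?powRr1 ?ltW // 1?mulrC //.
by apply/implyP => _; rewrite (gt_eqF Op).
Qed.

Lemma powR_B1 : Om p `^ (w - 1) = Om p ^- 1 * Om p `^ w.
Proof.
rewrite powRD ?powR_inv1 ?ltW // 1?mulrC //.
by apply/implyP => _; rewrite (gt_eqF Op).
Qed.

Lemma powR_B2 : Om p `^ (w - 2) = Om p ^- 2 * Om p `^ w.
Proof.
rewrite powRD ?powR_invn ?ltW // 1?mulrC //.
by apply/implyP => _; rewrite (gt_eqF Op).
Qed.

(** The gradient nu changes by a multiple of sigma Upsilon and d of a form of weight [w] by [w]
    Upsilon; the coefficient in eps~ is chosen so that these contributions cancel. *)
Lemma tilde_eps_at_conf : tilde_eps_at sigma g' a w F' p = Om p `^ (w + 1) *: tilde_eps_at sigma g a w F p.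
Proof.
rewrite /tilde_eps_at ext_nu_at_conf ed_conf powR_D1 (sigma_conf hs cg cg' hr dp).
move: (ext_nu_at _ _ _ _ _) (ed g a F p) (ext_mul _ _) (Om p) (Om p `^ w) (sigma g p) => x1 x2 x3 y1 y2 y3.
by apply/ffunP => S; rewrite !ffunE /GRing.scale /=; ring.
Qed.

(** As for eps~, with the coefficient of iota(Upsilon) in the transformation of delta on weighted
    forms, see [del_conf_w]. *)
Lemma tilde_iota_at_conf : tilde_iota_at sigma g' a (m + w - 2 * k%:~R) F' p =
  Om p `^ (w - 1) *: tilde_iota_at sigma g a (m + w - 2 * k%:~R) F p.
Proof.
have O0 : Om p != 0 by rewrite gt_eqF.
rewrite /tilde_iota_at int_nu_at_conf del_conf_w powR_B1 (sigma_conf hs cg cg' hr dp) [w + m]addrC.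
move: (int_nu_at _ _ _ _ _) (del g a F p) (int_mul _ _ _) (m + w - 2 * k%:~R) (Om p) (Om p `^ w) (sigma g p) O0.
move=> x1 x2 x3 y0 y1 y2 y3 O0.
by apply/ffunP => S; rewrite !ffunE /GRing.scale /=; field.
Qed.

End Rescale.

Lemma density_eps k w A : density_form c k w A ->
  density_form c (k + 1) (w + 1) (tilde_eps sigma w A).
Proof.
move=> hA; have sA := density_sform hA; have [fA cA] := hA; split.
  move=> g cg; have fg := fA g cg; split.
  - by move=> a S p dp; exact: (sf_te hM hc hs cg w (sA g a cg) dp S).
  - move=> a p dp; apply: homogeneousB; apply: homogeneousZ.
      by apply: homogeneous_ext_mul; exact: (form_degree fg).
    apply: (@homogeneous_ed k g a (A g a) p dp) => q dq; exact: (form_degree fg).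
  move=> a b p da db.
  apply: (tilde_eps_at_chart cg da db (sf_dfx (sA g b cg) db)) => q dq dq'.
  exact: (form_tensor fg).
move=> g g' Om cg cg' hr a p dp.
by apply: (tilde_eps_at_conf cg cg' hr dp (sf_dfx (sA g a cg) dp)) => q dq; exact: (cA g g').
Qed.

Lemma density_iota k w A : density_form c k w A ->
  density_form c (k - 1) (w - 1) (tilde_iota sigma k w A).
Proof.
move=> hA; have sA := density_sform hA; have [fA cA] := hA; split.
  move=> g cg; have fg := fA g cg; split.
  - by move=> a S p dp; exact: (sf_ti hM hc hs cg (m + w - 2 * k%:~R) (sA g a cg) dp S).
  - move=> a p dp; apply: homogeneousB; apply: homogeneousZ.
      by apply: homogeneous_int_mul; exact: (form_degree fg).
    apply: (@homogeneous_del k g a (A g a) p dp) => q dq; exact: (form_degree fg).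
  move=> a b p da db.
  apply: (tilde_iota_at_chart cg da db (sf_dfx (sA g b cg) db)) => q dq dq'.
  exact: (form_tensor fg).
move=> g g' Om cg cg' hr a p dp.
apply: (tilde_iota_at_conf cg cg' hr dp (sf_dfx (sA g a cg) dp)) => q dq.
  exact: (form_degree (fA g cg)).
exact: (cA g g').
Qed.

Lemma density_iota_eps k w A : density_form c k w A ->
  density_form c k w (tilde_iota_eps sigma k w A).
Proof.
move=> hA; have := density_iota (density_eps hA).
by rewrite !addrK.
Qed.

Lemma density_lin k w x A B : density_form c k w A -> density_form c k w B ->
  density_form c k w (x *: A + B).
Proof.
move=> hA hB; have [fA cA] := hA; have [fB cB] := hB; split.
  move=> g cg; have fg := fA g cg; have fg' := fB g cg; split.
  - move=> a S p dp; have sA := density_sform hA cg dp; have sB := density_sform hB cg dp.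
    exact: (smxD (smxZ (sm_cst a p x) sA) sB S).
  - move=> a p dp; apply: homogeneousD; last exact: (form_degree fg').
    by apply: homogeneousZ; exact: (form_degree fg).
  move=> a b p da db.
  have EA := form_tensor fg da db; have EB := form_tensor fg' da db.
  have -> : (x *: A + B) g a p = x *: A g a p + B g a p by [].
  have -> : (x *: A + B) g b p = x *: A g b p + B g b p by [].
  by rewrite EA EB (linearP (ext_pullback (J a b p))).
move=> g g' Om cg cg' hr a p dp.
have -> : (x *: A + B) g' a p = x *: A g' a p + B g' a p by [].
have -> : (x *: A + B) g a p = x *: A g a p + B g a p by [].
by rewrite (cA g g' Om) // (cB g g' Om) // scalerDr !scalerA mulrC.
Qed.

Lemma density0 k w : density_form c k w 0.
Proof.
split.
  move=> g cg; split.
  - by move=> a S p dp; exact: (smx_cst a p 0 S).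
  - by move=> a p _; exact: homogeneous0.
  move=> a b p _ _; have -> : (0 : dform M) g a p = 0 by [].
  by have -> : (0 : dform M) g b p = 0 by []; exact/esym/(linear0 (ext_pullback (J a b p))).
by move=> g g' Om _ _ _ a p _; rewrite [RHS]scaler0.
Qed.

Lemma densityZ k w x A : density_form c k w A -> density_form c k w (x *: A).
Proof. by move=> hA; rewrite -[_ *: _]addr0; apply: density_lin => //; exact: density0. Qed.

Lemma sigma_cancel_ext g a p (E : M -> ext) : c g -> dom a p -> dfx a p E ->
  near_pt a p (fun q => sigma g q *: E q = 0) -> E p = 0.
Proof.
move=> cg dp hE H; apply/ffunP => S; rewrite [RHS]ffunE.
apply: (sigma_cancel hM hs cg dp (hE S)).
by apply: near_ptS H => q _ /ffunP/(_ S); rewrite !ffunE.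
Qed.

(** The defect of the transformation law is smooth in the chart [a], the Jacobian being smooth, and
    sigma times it vanishes on the overlap. *)
Lemma tensor_cancel g (B : chart M -> M -> ext) : c g -> (forall a, smooth_field a (B a)) ->
  (forall a b p, dom a p -> dom b p ->
     sigma g p *: B a p = ext_pullback (J a b p) (sigma g p *: B b p)) ->
  forall a b p, dom a p -> dom b p -> B a p = ext_pullback (J a b p) (B b p).
Proof.
move=> cg sB H a b p da db; apply/eqP; rewrite -subr_eq0; apply/eqP.
pose E q := B a q + -1 *: ext_pullback (J a b q) (B b q).
have hE : dfx a p E.
  apply: dfxD; first exact: sf_dfx.
  apply: dfxZ; first exact: dfr_cst.
  have hJ : J a b p \in unitmx.
    by apply: (jacobian_unit da db (metric_at_c hc cg da)) => q dq dq'; exact: (tensor_c hc cg).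
  apply: dfx_pullback => //; first by move=> s t; exact/sm_dfr/sm_jacobian.
  by apply: (dfx_chart hM da db); exact: sf_dfx.
have -> : B a p - ext_pullback (J a b p) (B b p) = E p by rewrite /E scaleN1r.
apply: (sigma_cancel_ext cg da hE).
apply: near_ptS (near_dom hM da db) => q dq dq'.
by rewrite /E scalerDr (H a b q) // linearZ_pullback scaleN1r scalerN addrN.
Qed.

Lemma degree_cancel g a k (F : M -> ext) : c g -> smooth_field a F ->
  (forall p, dom a p -> homogeneous k (sigma g p *: F p)) ->
  forall p, dom a p -> homogeneous k (F p).
Proof.
move=> cg sF H p dp S FS; apply: contrapT => Sk; move: FS.
suff -> : F p S = 0 by rewrite eqxx.
move: p dp; apply: (sigma_cancel_sm hM hs cg) => p dp; first exact: sF.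
have := H p dp S; rewrite ffunE /GRing.scale /=.
by have [-> //|nz /(_ isT) /Sk] := eqVneq (sigma g p * _) 0.
Qed.

(** Smoothness of the quotient is an assumption, supplied by its formula; degree, change of chart
    and weight are inherited from the product by cancelling sigma, which itself has weight 1. *)
Lemma density_div k w A B : density_form c k w A -> sform B ->
  (forall g a p, c g -> dom a p -> A g a p = sigma g p *: B g a p) ->
  density_form c k (w - 1) B.
Proof.
move=> hA sB AB; have [fA cA] := hA; split.
  move=> g cg; have fg := fA g cg; split.
  - by move=> a S p dp; exact: sB.
  - move=> a; apply: (degree_cancel cg (sB g a cg)) => p dp; rewrite -AB //.
    exact: (form_degree fg).
  apply: (tensor_cancel cg (fun a => sB g a cg)) => a b p da db.
  by rewrite -!AB //; exact: (form_tensor fg).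
move=> g g' Om cg cg' hr a p dp.
have O0 q : dom a q -> Om q != 0 by move=> dq; rewrite gt_eqF // (rescaled_pos hr dq).
have sOm : sm a p Om by case: hr => H _ _; exact: H.
pose E1 q := Om q *: B g' a q + - Om q `^ w *: B g a q.
have E10 : E1 p = 0.
  apply: (sigma_cancel_ext cg dp).
    apply: dfxD; first by apply: dfxZ; [exact: sm_dfr|apply: sf_dfx => //; exact: sB].
    apply: dfxZ; last by apply: sf_dfx => //; exact: sB.
    by apply: dfrN; apply: dfr_powR => //; exact: rescaled_pos hr dp.
  apply: near_ptT => q dq.
  rewrite /E1 scalerDr scalerA [_ * Om q]mulrC -(sigma_conf hs cg cg' hr dq) -AB //.
  by rewrite (cA g g' Om) // scaleNr scalerN scalerA mulrC -scalerA -AB // addrN.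
rewrite (powR_B1 hr dp) -scalerA; apply: (scalerI (O0 p dp)).
rewrite [RHS]scalerA divff ?O0 // scale1r.
by apply/eqP; rewrite -subr_eq0 -scaleNr; apply/eqP.
Qed.

Lemma form_section0 k (g : metric M) : form_section k ((0 : dform M) g).
Proof.
split.
- by move=> a S p dp; exact: (smx_cst a p 0 S).
- by move=> a p _; exact: homogeneous0.
move=> a b p _ _; have -> : (0 : dform M) g a p = 0 by [].
by have -> : (0 : dform M) g b p = 0 by []; exact/esym/(linear0 (ext_pullback (J a b p))).
Qed.

(** The southern slot is determined by sigma phi = - iota(nu) C, so its transformation laws follow
    from those of [C] and nu by cancellation. No relation between phi and delta C enters, hence the
    lemma serves for all weights of the iteration. *)
Lemma tractor_section_wp k w C ph : density_form c k (w + k%:~R) C -> sform ph ->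
  (forall g a p, c g -> dom a p -> int_nu_at sigma g a (C g a) p + sigma g p *: ph g a p = 0) ->
  tractor_section c k w (Tractor 0 C 0 ph).
Proof.
move=> hC sph HI; have [fC cC] := hC; have sC := density_sform hC.
have HI' g a p : c g -> dom a p -> sigma g p *: ph g a p = - int_nu_at sigma g a (C g a) p.
  by move=> cg dp; apply/eqP; rewrite -addr_eq0 addrC HI.
split.
  move=> g cg; have fg := fC g cg; split => /=; [exact: form_section0|exact: fg|exact: form_section0|].
  split.
  - by move=> a S p dp; exact: sph.
  - move=> a; apply: (degree_cancel cg (sph g a cg)) => p dp; rewrite HI' //.
    by apply: homogeneousN; apply: homogeneous_int_mul; exact: (form_degree fg).
  apply: (tensor_cancel cg (fun a => sph g a cg)) => a b p da db.
  rewrite !HI' // (linearN (ext_pullback (J a b p))) /=; congr (- _).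
  by apply: (int_nu_at_chart cg da db) => q dq dq'; exact: (form_tensor fg).
move=> g g' Om cg cg' hr a p dp /=.
have O0 q : dom a q -> Om q != 0 by move=> dq; rewrite gt_eqF // (rescaled_pos hr dq).
have z1 (h : metric M) : (0 : dform M) h a p = 0 by [].
rewrite !z1.
set v := fun i => pd a i _ p.
have eu : ext_mul v 0 = 0 by exact: linear0.
have iu : int_mul (g a p) v 0 = 0 by exact: linear0.
rewrite !(eu, iu) !(subr0, addr0, scaler0).
split => //; first exact: (cC g g').
have sOm : sm a p Om by case: hr => H _ _; exact: H.
set W := w + k%:~R.
have -> : ph g a p - int_mul (g a p) v (C g a p) =
   ph g a p - int_mul (g a p) (Up a p Om) (C g a p).
  by congr (_ - _); apply: eq_int_mul => i; apply: pd_ln => //; exact: rescaled_pos hr dp.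
pose u q i := Up a q Om i.
have su i : sm a p (fun q => u q i).
  apply: smM; last by apply: sm_pd.
  by apply: smV => //; exact: O0.
(* The defect of the southern transformation law, cleared of negative powers of [Om]. It vanishes
   after multiplication by sigma because nu changes to [Om] (nu + sigma Upsilon). *)
pose E q := (Om q ^+ 2) *: ph g' a q + - Om q `^ W *: (ph g a q - int_mul (g a q) (u q) (C g a q)).
have E0 : E p = 0.
  apply: (sigma_cancel_ext cg dp).
    apply: dfxD.
      apply: dfxZ; [exact/sm_dfr/smX|apply: sf_dfx => //; exact: sph].
    apply: dfxZ; first by apply: dfrN; apply: dfr_powR => //; exact: rescaled_pos hr dp.
    apply: smx_dfx; apply: smxB; first exact: sph.
    apply: (@smx_int_mul _ _ _ _ _ _ _ _ (fun i q => u q i)) => //; last exact: sC.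
    exact: (metric_at_c hc cg dp).
  apply: near_ptT => q dq.
  have H := HI' g' a q cg' dq; move: H; rewrite (sigma_conf hs cg cg' hr dq).
  rewrite (int_nu_at_conf cg cg' hr dq (w := W) (F := C g a)); last by move=> r dr; exact: (cC g g').
  have := HI' g a q cg dq; rewrite /E -/(u q).
  move: (ph g' a q) (ph g a q) (int_nu_at _ _ _ _ _) (int_mul _ _ _) (Om q) (O0 q dq) (Om q `^ W) (sigma g q).
  move=> x1 x2 x3 x4 y1 y10 y2 y3 H1 H2.
  apply/ffunP => S.
  have /ffunP/(_ S) := H2; have /ffunP/(_ S) := H1; rewrite !ffunE /GRing.scale /= => {}H1 {}H2.
  have : y1 * (y1 * y3 * x1 S) = - (y2 * (x3 S + y3 * x4 S)).
    by rewrite H2; field.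
  have -> : x3 S = - (y3 * x2 S) by rewrite H1 opprK.
  by move=> H3; transitivity (y1 * (y1 * y3 * x1 S) - y2 * (y3 * x2 S - y3 * x4 S)); [ring|rewrite H3; ring].
rewrite (powR_B2 hr dp).
apply: (scalerI (expf_neq0 2 (O0 p dp))).
rewrite [RHS]scalerA mulrA divff ?expf_neq0 ?O0 // mul1r.
by apply/eqP; rewrite -subr_eq0 -scaleNr; apply/eqP.
Qed.

End Density.

(** * The boundary *)

Section Pullback.
Context {R : realType} {n : nat}.
Local Notation ext := (exterior R n.+1).
Local Notation lft := (lift ord0).
Implicit Types (A : ext) (S : {set 'I_n}) (i : 'I_n).

Lemma pullback_linear : linear (pullback : ext -> exterior R n).
Proof. by move=> x A B; apply/ffunP => S; rewrite !ffunE. Qed.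

HB.instance Definition _ := GRing.isLinear.Build R ext (exterior R n) _
  pullback pullback_linear.

Let lft_inj : injective (lft : 'I_n -> 'I_n.+1) := @lift_inj _ _.

Lemma pullbackZ x A : pullback (x *: A) = x *: pullback A.
Proof. exact: linearZ. Qed.

Lemma ext_sign_lift i S : ext_sign (lft i) (lft @: S) = ext_sign i S :> R.
Proof.
rewrite /ext_sign; congr (_ ^+ _); rewrite -[RHS](card_imset _ lft_inj).
apply: eq_card => j; rewrite !inE; apply/andP/imsetP.
  move=> [/imsetP[k kS ->] ki]; exists k => //; rewrite !inE kS.
  by move: ki; rewrite /= /bump /= !add1n ltnS.
move=> [k]; rewrite !inE => /andP[kS ki] ->; split; first exact: imset_f.
by rewrite /= /bump /= !add1n ltnS.
Qed.

Lemma pullback_ext i A : pullback (ext_basis (lft i) A) = ext_basis i (pullback A).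
Proof.
apply/ffunP => S; rewrite !ffunE (mem_imset _ _ lft_inj); case: ifP => // iS.
rewrite -[LHS]/(ext_sign (lft i) (lft @: S) * A ((lft @: S) :\ lft i)) ext_sign_lift.
congr (_ * A _); apply/setP => j; rewrite !inE.
apply/andP/imsetP => [[ji /imsetP[k kS jk]]|[k]].
  by exists k => //; rewrite !inE kS andbT; apply: contra ji => /eqP <-; rewrite jk.
by rewrite !inE => /andP[ki kS] ->; rewrite (inj_eq lft_inj) ki imset_f.
Qed.

Lemma pullback_int i A : pullback (int_basis (lft i) A) = int_basis i (pullback A).
Proof.
apply/ffunP => S; rewrite !ffunE (mem_imset _ _ lft_inj); case: ifP => // iS.
rewrite -[LHS]/(ext_sign (lft i) (lft @: S) * A (lft i |: (lft @: S))) ext_sign_lift.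
by rewrite -[_ |: S]/([set i] :|: S)%SET imsetU imset_set1.
Qed.

Lemma pullback_ext0 A : pullback (ext_basis ord0 A) = 0.
Proof.
apply/ffunP => S; rewrite !ffunE; case: ifP => // /imsetP[k _ /eqP].
by rewrite (negbTE (neq_lift _ _)).
Qed.

End Pullback.

Section Boundary.
Context {R : realType} {n : nat} {M : chart_space R n.+1}.
Hypothesis hM : manifold_with_boundary M.
Hypothesis hn : (2 <= n)%N.
Variables (c : set (metric M)) (sigma : metric M -> M -> R).
Hypotheses (hc : conformal_class c) (hs : poincare_einstein c sigma).
Variables (g : metric M) (a : chart M) (p : M).
Hypotheses (cg : c g) (dp : dom a p) (p0 : crd a p ord0 ord0 = 0).
Local Notation ext := (exterior R n.+1).
Local Notation lft := (lift ord0).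
Local Notation N i := (\sum_j invmx (g a p) i j * nu sigma g a p j).
Local Notation s := (sigma g).
Local Notation m := (n.+1%:R : R).
Let hg : metric_at g a p := metric_at_c hc cg dp.
Let gu : g a p \in unitmx. Proof. by case: hg => _ H _; exact: near_pt_at dp H. Qed.

Lemma pd_boundary (j : 'I_n) (f : M -> R) :
  pd (X := boundary_space M) a j f p = pd a (lft j) f p.
Proof.
have E (h : R) : par (c := boundary_space M) a
    (crd (c := boundary_space M) a p + h *: delta_mx ord0 j) =
    par a (crd a p + h *: delta_mx ord0 (lft j)).
  congr (par a _); apply/rowP => i; rewrite !mxE eqxx /=; case: unliftP => [k|] ->.
    by rewrite !mxE eqxx /= (inj_eq (@lift_inj _ _)).
  by rewrite p0 (negbTE (neq_lift _ _)) mulr0 addr0.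
rewrite /pd (_ : (fun h : R => _) = (fun h : R => h^-1 *
  (f (par a (crd a p + h *: delta_mx ord0 (lft j))) - f p))) //.
by apply: funext => h; rewrite E.
Qed.

(** The points in the difference quotients of a tangential direction stay on the boundary. *)
Lemma pd_tangent (j : 'I_n) (f f' : M -> R) :
  (forall q, dom a q -> crd a q ord0 ord0 = 0 -> f q = f' q) ->
  pd a (lft j) f p = pd a (lft j) f' p.
Proof.
move=> ff; rewrite /pd; congr (lim _).
rewrite eqEsubset; split; apply: near_eq_cvg;
  have := near_par hM (lft j) dp (@near_ptT _ _ _ a p (fun=> True) (fun _ _ => I));
  apply: filterS => h [dq qE _]; rewrite (ff p) // ff //;
  by rewrite qE !mxE p0 eqxx (negbTE (neq_lift _ _)) mulr0 addr0.
Qed.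

Lemma sigma0 q : dom a q -> crd a q ord0 ord0 = 0 -> s q = 0.
Proof. by move=> dq q0; apply: (pe_zero hs cg); exists a. Qed.

Lemma nu_tangent (j : 'I_n) : nu sigma g a p (lft j) = 0.
Proof.
by rewrite /nu (@pd_tangent j _ (fun=> 0)) ?pd_cst // => q dq q0; exact: sigma0.
Qed.

Lemma normalE i : N i = invmx (g a p) i ord0 * nu sigma g a p ord0.
Proof.
rewrite big_ord_recl big1 ?addr0 // => j _.
by have := nu_tangent j; rewrite /lft => ->; rewrite mulr0.
Qed.

Lemma normal_unit : N ord0 * nu sigma g a p ord0 = 1.
Proof.
have := nu_sqE hM hn hc hs cg dp; rewrite (sigma0 dp p0) mulr0 subr0 => <-.
rewrite /nu_sq [RHS]big_ord_recl [X in _ = _ + X]big1 ?addr0 => [|i _].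
  by rewrite mulr_suml; apply: eq_bigr => j _; rewrite mulrC mulrA.
by rewrite big1 // => j _; rewrite nu_tangent !mul0r.
Qed.

Definition tang i j : R := invmx (g a p) i j - N i * N j.

Lemma tang0 i : tang i ord0 = 0.
Proof.
have N0 : nu sigma g a p ord0 != 0.
  by apply/eqP => n0; have := normal_unit; rewrite n0 mulr0 => /eqP; rewrite eq_sym oner_eq0.
apply: (mulIf N0); rewrite mul0r /tang mulrBl -mulrA normal_unit mulr1.
by rewrite normalE subrr.
Qed.

Lemma tangC i j : tang i j = tang j i.
Proof. by rewrite /tang (inv_metric_sym dp hg i j) mulrC. Qed.

(* [tang] is the projection of the inverse metric to the boundary: [nu] has unit
   length there by the Einstein equation. *)
Lemma restrict_metric_inv i j :
  invmx (restrict_metric g a p) i j = tang (lft i) (lft j).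
Proof.
pose K : 'M[R]_n := \matrix_(i, j) tang (lft i) (lft j).
suff E : K *m restrict_metric g a p = 1%:M.
  have [_ hu] := mulmx1_unit E.
  have -> : invmx (restrict_metric g a p) = K by rewrite -[K]mulmx1 -(mulmxV hu) mulmxA E mul1mx.
  by rewrite mxE.
apply/matrixP => {}i {}j; rewrite !mxE.
transitivity (\sum_k tang (lft i) k * g a p k (lft j)).
  rewrite big_ord_recl tang0 mul0r add0r; apply: eq_bigr => k _.
  by rewrite !mxE.
rewrite /tang; under eq_bigr do rewrite mulrBl.
rewrite sumrB.
have -> : \sum_k invmx (g a p) (lft i) k * g a p k (lft j) = (i == j)%:R.
  transitivity ((invmx (g a p) *m g a p) (lft i) (lft j)); first by rewrite mxE.
  by rewrite mulVmx // mxE (inj_eq (@lift_inj _ _)).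
have -> : \sum_k N (lft i) * N k * g a p k (lft j) = N (lft i) * nu sigma g a p (lft j).
  under eq_bigr do rewrite -mulrA; rewrite -mulr_sumr; congr (_ * _).
  under eq_bigr do rewrite mulr_suml; rewrite exchange_big /=.
  rewrite -[RHS](sum_delta (nu sigma g a p)); apply: eq_bigr => k _.
  have -> : (k == lft j)%:R = (invmx (g a p) *m g a p) k (lft j) by rewrite mulVmx // mxE.
  rewrite mxE mulr_sumr; apply: eq_bigr => l _.
  by rewrite (inv_metric_sym dp hg l k); ring.
by rewrite nu_tangent mulr0 subr0.
Qed.

(** The Gauss formula: the lowered symbols with tangential indices are those of the ambient metric,
    and raising with the projected inverse metric removes the normal component. *)
Lemma restrict_christoffel k i j :
  christoffel (restrict_metric g) a k i j p =
  christoffel g a (lft k) (lft i) (lft j) p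
  - N (lft k) * nu sigma g a p ord0 * christoffel g a ord0 (lft i) (lft j) p.
Proof.
pose L l := pd a (lft i) (fun q => g a q l (lft j)) p + pd a (lft j) (fun q => g a q l (lft i)) p
     - pd a l (fun q => g a q (lft i) (lft j)) p.
have E0 r u v : pd a r (fun q => restrict_metric g a q u v) p =
    pd a r (fun q => g a q (lft u) (lft v)) p.
  by apply: pd_eq => // q _; rewrite mxE.
have E1 : christoffel (restrict_metric g) a k i j p =
   2^-1 * \sum_l tang (lft k) l * L l.
  rewrite big_ord_recl tang0 mul0r add0r /christoffel; congr (_ * _).
  apply: eq_bigr => l _; rewrite restrict_metric_inv !pd_boundary; congr (_ * _).
  by rewrite !E0.
have E2 l : christoffel g a l (lft i) (lft j) p = 2^-1 * \sum_r invmx (g a p) l r * L r by [].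
have EN l : N l = invmx (g a p) l ord0 * nu sigma g a p ord0 := normalE l.
rewrite E1 !E2 {1}/tang; set x := N (lft k); set y := nu _ _ _ _ ord0.
rewrite mulrCA -mulrBr; congr (_ * _); rewrite [X in _ = _ - X]mulr_sumr -sumrB.
apply: eq_bigr => l _; rewrite EN -/y (inv_metric_sym dp hg l ord0).
by move: x y (L l) (invmx (g a p) _ l) (invmx (g a p) _ l) => *; ring.
Qed.

(** Where sigma vanishes both tilde operators are algebraic, and nu has length 1 there. *)
Lemma iota_eps_boundary x w (C : M -> ext) : int_nu_at sigma g a C p = 0 ->
  tilde_iota_at sigma g a x (tilde_eps_at sigma g a w C) p = (x * w) *: C p.
Proof.
move=> C0; have s0 := sigma0 dp p0.
have E : int_nu_at sigma g a (tilde_eps_at sigma g a w C) p = w *: C p.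
  have H := int_nu_at_N_anti hM hn hc hs cg C dp; move: H.
  rewrite s0 mulr0 subr0 scale1r => H.
  have L0 : ext_nu_at sigma g a (int_nu_at sigma g a C) p = 0 by rewrite /ext_nu_at C0; exact: linear0.
  rewrite L0 subr0 in H.
  by rewrite /int_nu_at /tilde_eps_at s0 scale0r subr0 int_mulZ; congr (_ *: _).
by rewrite /tilde_iota_at E s0 scale0r subr0 scalerA.
Qed.

(** * The codifferential of the boundary *)

Section Gauss.
Variables (C ph : M -> ext) (AS : dform (boundary_space M)).
Hypotheses (hC : smooth_field a C) (hph : smooth_field a ph)
  (HI : forall q, dom a q -> int_nu_at sigma g a C q + s q *: ph q = 0)
  (HB : forall q, dom a q -> crd a q ord0 ord0 = 0 ->
     AS (restrict_metric g) a q = pullback (C q)).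

Lemma int_nu_boundary : int_nu_at sigma g a C p = 0.
Proof. by have := HI dp; rewrite (sigma0 dp p0) scale0r addr0. Qed.

(** The coordinate direction transversal to the boundary need not be normal to it; iota(nu) C = 0
    expresses the contraction with it through tangential ones. *)
Lemma int_basis0 : int_basis ord0 (C p) =
  - \sum_k (N (lft k) * nu sigma g a p ord0) *: int_basis (lft k) (C p).
Proof.
apply/eqP; rewrite -addr_eq0 -[int_basis ord0 _]scale1r -normal_unit; apply/eqP.
transitivity (nu sigma g a p ord0 *: int_nu_at sigma g a C p); last by rewrite int_nu_boundary scaler0.
rewrite /int_nu_at int_mulE /int_vec [in RHS]big_ord_recl scalerDr scalerA [in RHS]mulrC.
congr (_ + _); rewrite scaler_sumr; apply: eq_bigr => k _.
by rewrite scalerA mulrC.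
Qed.

(** The contraction with the transversal direction in the ambient connection term is rewritten by
    [int_basis0], and the result is exactly the correction in [restrict_christoffel]. *)
Lemma nabla_boundary j : nabla AS (restrict_metric g) a j p = pullback (nab g a (lft j) C p).
Proof.
rewrite /nabla /nab (linearB pullback) /=; congr (_ - _).
  apply/ffunP => S; rewrite !ffunE pd_boundary; apply: pd_tangent => q dq q0.
  by rewrite HB // ffunE.
rewrite /derv big_ord_recl (linearD pullback) /= (linear_sum pullback) /= [X in _ = X + _]big1 ?add0r; last first.
  by move=> i _; rewrite pullbackZ pullback_ext0 scaler0.
rewrite (linear_sum pullback); apply: eq_bigr => e _ /=.
rewrite big_ord_recl (linearD pullback) /= (linear_sum pullback) /= pullbackZ pullback_ext int_basis0.
rewrite (linearN pullback) /= (linear_sum pullback) /= linearN linear_sum scalerN scaler_sumr -sumrN.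
rewrite -big_split; apply: eq_bigr => k _ /=.
rewrite !pullbackZ pullback_ext ext_basisZ !pullback_int HB // restrict_christoffel.
by rewrite scalerBl [RHS]addrC scalerA [in RHS]mulrC.
Qed.

(** The equation iota(nu) C = - sigma phi is differentiated along the normal. On the boundary the
    Hessian of sigma is - rho g, so its contribution is a multiple of iota(nu) C = 0, while the
    normal derivative of sigma is 1. *)
Lemma int_nb_normal : int_mul (g a p) (nu sigma g a p)
   (\sum_j N j *: nab g a j C p) = - ph p.
Proof.
have hnu i : dfr a p (grad sigma g a i) by exact/sm_dfr/(sm_nu hM hs i cg dp).
have E j : int_mul (g a p) (nu sigma g a p) (nab g a j C p) =
    rho sigma g a p *: int_basis j (C p) - nu sigma g a p j *: ph p.
  have := nab_int_mul hM dp hg (u := grad sigma g a) j hnu (sf_dfx hC dp).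
  have -> : nab g a j (fun q => int_mul (g a q) (fun i => grad sigma g a i q) (C q)) p =
    nab g a j (fun q => - s q *: ph q) p.
    apply: nab_near_eq => //; apply: near_ptT => q dq.
    by rewrite scaleNr; apply/eqP; rewrite -addr_eq0; apply/eqP; exact: HI.
  rewrite (nabZ hM g dp j (dfrN (sm_dfr (sm_sigma hs cg dp))) (sf_dfx hph dp)).
  rewrite (sigma0 dp p0) oppr0 scale0r addr0 (pdN hM j dp (sm_dfr (sm_sigma hs cg dp))).
  have -> : int_mul (g a p) (cov g a j (grad sigma g a) p) (C p) =
     - rho sigma g a p *: int_basis j (C p).
    rewrite -int_vec_delta -int_vecZl int_mulE; apply: eq_int_vec => i.
    have -> : (i == j)%:R = (invmx (g a p) *m g a p) i j by rewrite mulVmx // mxE.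
    rewrite mxE mulr_sumr; apply: eq_bigr => l _; rewrite (hessE hM hn hc hs j l cg dp).
    have [gs _ _] := hg; have gps := near_pt_at dp gs.
    have -> : g a p j l = g a p l j by rewrite -{1}gps mxE.
    rewrite (sigma0 dp p0) mul0r oppr0 sub0r.
    by move: (g a p l j) (invmx (g a p) i l) (rho sigma g a p) => *; ring.
  rewrite !scaleNr => H; rewrite -/(nu sigma g a p j) in H.
  by rewrite H addrA addrN add0r.
rewrite (linear_sum (int_mul (g a p) (nu sigma g a p))) /=.
under eq_bigr do rewrite int_mulZ E scalerBr scalerA mulrC -scalerA [X in _ - X]scalerA.
rewrite sumrB -scaler_sumr -/(int_vec (fun i => N i) (C p)) -int_mulE -/(int_nu_at sigma g a C p) int_nu_boundary.
rewrite scaler0 sub0r -scaler_suml big_ord_recl normal_unit big1 ?addr0 ?scale1r // => i _.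
by rewrite nu_tangent mulr0.
Qed.

(** The inverse metric splits into [tang] and the square of the unit normal. The tangential part of
    delta is the codifferential of the boundary by [nabla_boundary], and the normal part is
    [int_nb_normal]. *)
Lemma codiff_boundary :
  codiff AS (restrict_metric g) a p = pullback (del g a C p) + pullback (ph p).
Proof.
have -> : pullback (ph p) = - pullback (int_mul (g a p) (nu sigma g a p) (\sum_j N j *: nab g a j C p)).
  by rewrite int_nb_normal (linearN pullback) opprK.
rewrite -(linearB pullback) /= /codiff.
have -> : del g a C p - int_mul (g a p) (nu sigma g a p) (\sum_j N j *: nab g a j C p) =
  \sum_i \sum_j tang i j *: int_basis i (nab g a j C p).
  rewrite /del int_mulE /int_vec -sumrB; apply: eq_bigr => i _.
  rewrite linear_sum scaler_sumr -sumrB; apply: eq_bigr => j _.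
  by rewrite /= int_basisZ scalerA -scalerBl.
rewrite big_ord_recl [X in _ = pullback (X + _)]big1 ?add0r => [|j _]; last by rewrite tangC tang0 scale0r.
rewrite (linear_sum pullback); apply: eq_bigr => i _ /=.
rewrite big_ord_recl tang0 scale0r add0r (linear_sum pullback); apply: eq_bigr => j _ /=.
by rewrite pullbackZ pullback_int -nabla_boundary -restrict_metric_inv.
Qed.

End Gauss.

End Boundary.

(** * Iteration *)

Section Recursion.
Context {R : realType} {n : nat} {M : chart_space R n.+1}.
Hypothesis hM : manifold_with_boundary M.
Hypothesis hn : (2 <= n)%N.
Variables (c : set (metric M)) (sigma : metric M -> M -> R).
Hypotheses (hc : conformal_class c) (hs : poincare_einstein c sigma).
Variables (g : metric M) (a : chart M).
Hypothesis cg : c g.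
Local Notation ext := (exterior R n.+1).
Local Notation s := (sigma g).
Local Notation SF := (smooth_field a).
Local Notation lI := (int_nu_at sigma g a).
Local Notation lte := (tilde_eps_at sigma g a).
Local Notation lti := (tilde_iota_at sigma g a).
Implicit Types (A B C ph : M -> ext) (w x y X : R) (p q : M).

Definition dom_eq A B := forall q, dom a q -> A q = B q.

Definition iota_eps_at w X A q : ext := lti X (lte w A) q.
Definition iota_eps_sub w X y A q : ext := iota_eps_at w X A q - y *: A q.

Lemma tilde_eps_at_eq w A B : dom_eq A B -> dom_eq (lte w A) (lte w B).
Proof. by move=> AB q dq; rewrite /tilde_eps_at /ext_nu_at (ed_eq hM g dq AB) (AB q dq). Qed.

Lemma tilde_iota_at_eq x A B : dom_eq A B -> dom_eq (lti x A) (lti x B).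
Proof. by move=> AB q dq; rewrite /tilde_iota_at /int_nu_at (del_eq hM g dq AB) (AB q dq). Qed.

Lemma iota_eps_eq w X A B : dom_eq A B -> dom_eq (iota_eps_at w X A) (iota_eps_at w X B).
Proof. by move=> AB; apply: tilde_iota_at_eq; exact: tilde_eps_at_eq. Qed.

Lemma iota_eps_sub_eq w X y A B : dom_eq A B -> dom_eq (iota_eps_sub w X y A) (iota_eps_sub w X y B).
Proof. by move=> AB q dq; rewrite /iota_eps_sub (iota_eps_eq w X AB dq) (AB q dq). Qed.

Lemma smooth_iota_eps w X A : SF A -> SF (iota_eps_at w X A).
Proof. by move=> hA; apply: (sf_ti hM hc hs cg); exact: (sf_te hM hc hs cg). Qed.

Lemma smooth_iota_eps_sub w X y A : SF A -> SF (iota_eps_sub w X y A).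
Proof. by move=> hA; apply: sf_B; [exact: smooth_iota_eps|exact: sf_cZ]. Qed.

Lemma tilde_eps_lin w x A B : SF A -> SF B ->
  dom_eq (lte w (fun q => A q + x *: B q)) (fun q => lte w A q + x *: lte w B q).
Proof.
move=> hA hB q dq; rewrite /tilde_eps_at /ext_nu_at.
rewrite (edD hM g dq (sf_dfx hA dq) (sf_dfx (sf_cZ x hB) dq)) (ed_cZ hM g x hB dq).
rewrite (linearD (ext_mul _)) /= ext_mulZ.
move: (ext_mul _ _) (ext_mul _ _) (ed g a A q) (ed g a B q) (s q) => x1 x2 x3 x4 y.
by apply/ffunP => S; rewrite !ffunE /GRing.scale /=; ring.
Qed.

Lemma tilde_iota_lin x' x A B : SF A -> SF B ->
  dom_eq (lti x' (fun q => A q + x *: B q)) (fun q => lti x' A q + x *: lti x' B q).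
Proof.
move=> hA hB q dq; rewrite /tilde_iota_at /int_nu_at.
rewrite (delD hM g dq (sf_dfx hA dq) (sf_dfx (sf_cZ x hB) dq)) (del_cZ hM g x hB dq).
rewrite int_mulD int_mulZ.
move: (int_mul _ _ _) (int_mul _ _ _) (del g a A q) (del g a B q) (s q) => x1 x2 x3 x4 y.
by apply/ffunP => S; rewrite !ffunE /GRing.scale /=; ring.
Qed.

Lemma iota_eps_lin w X x A B : SF A -> SF B ->
  dom_eq (iota_eps_at w X (fun q => A q + x *: B q)) (fun q => iota_eps_at w X A q + x *: iota_eps_at w X B q).
Proof.
move=> hA hB q dq; apply: (etrans (tilde_iota_at_eq X (tilde_eps_lin w x hA hB) dq)).
exact: (tilde_iota_lin X x (sf_te hM hc hs cg w hA) (sf_te hM hc hs cg w hB) dq).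
Qed.

Lemma SF0 : SF (fun=> 0).
Proof. by move=> p dp; exact: smx_cst. Qed.

Lemma iota_eps0 w X : dom_eq (iota_eps_at w X (fun=> 0)) (fun=> 0).
Proof.
move=> q dq; have H := iota_eps_lin w X (-1) SF0 SF0 dq; move: H.
rewrite (_ : (fun q => _) = (fun=> 0)) => [->|]; first by rewrite scaleN1r addrN.
by apply: funext => r; rewrite scaleN1r addrN.
Qed.

Lemma iota_epsZ w X x A : SF A -> dom_eq (iota_eps_at w X (fun q => x *: A q)) (fun q => x *: iota_eps_at w X A q).
Proof.
move=> hA q dq; have H := iota_eps_lin w X x SF0 hA dq; move: H; rewrite iota_eps0 // add0r => <-.
by apply: iota_eps_eq dq => r _; rewrite add0r.
Qed.

Lemma iota_eps_subZ w X y x A : SF A -> dom_eq (iota_eps_sub w X y (fun q => x *: A q)) (fun q => x *: iota_eps_sub w X y A q).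
Proof. move=> hA q dq; rewrite /iota_eps_sub (iota_epsZ w X x hA dq).
by rewrite [RHS]scalerBr !scalerA [y * x]mulrC. Qed.

Lemma iota_eps_subC w X y z A : SF A -> dom_eq (iota_eps_sub w X y (iota_eps_sub w X z A)) (iota_eps_sub w X z (iota_eps_sub w X y A)).
Proof.
have G t u B : SF B -> dom_eq (iota_eps_sub w X t (iota_eps_sub w X u B))
    (fun q => (iota_eps_at w X (iota_eps_at w X B) q - u *: iota_eps_at w X B q) - t *: (iota_eps_at w X B q - u *: B q)).
  move=> hB q dq; rewrite {1}/iota_eps_sub; congr (_ - _).
  have := iota_eps_lin w X (- u) (smooth_iota_eps w X hB) hB dq; rewrite scaleNr => <-.
  by apply: iota_eps_eq dq => r _; rewrite /iota_eps_sub scaleNr.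
move=> hA q dq; rewrite !G //.
by move: (iota_eps_at w X (iota_eps_at w X A) q) (iota_eps_at w X A q) (A q) => a1 a2 a3;
  apply/ffunP => S; rewrite !ffunE /GRing.scale /=; ring.
Qed.

Lemma iota_eps_sigma w X A : SF A ->
  dom_eq (iota_eps_at w X (fun q => s q *: A q)) (fun q => s q *: iota_eps_at (w - 1) (X - 1) A q).
Proof.
move=> hA q dq; have hte := sf_te hM hc hs cg (w - 1) hA.
have E : dom_eq (lte w (fun q => s q *: A q)) (fun q => s q *: lte (w - 1) A q).
  by move=> r dr; have := tilde_eps_sigma hM hs cg (w - 1) hA dr; rewrite subrK.
by rewrite /iota_eps_at (tilde_iota_at_eq X E dq); have := tilde_iota_sigma hM hs cg (X - 1) hte dq; rewrite subrK.
Qed.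

Lemma sf_sX j A : SF A -> SF (fun q => s q ^+ j *: A q).
Proof.
move=> hA; elim: j => [|j IH]; first by apply: sf_eq hA => p _; rewrite expr0 scale1r.
by apply: sf_eq (sf_sZ hs cg IH) => p _; rewrite scalerA -exprS.
Qed.

Lemma iota_eps_sigmaX j w X A : SF A ->
  dom_eq (iota_eps_at w X (fun q => s q ^+ j *: A q)) (fun q => s q ^+ j *: iota_eps_at (w - j%:R) (X - j%:R) A q).
Proof.
elim: j w X => [|j IH] w X hA q dq.
  rewrite expr0 scale1r !subr0; apply: iota_eps_eq dq => r _; by rewrite expr0 scale1r.
rewrite exprS -scalerA.
have -> : w - j.+1%:R = (w - 1) - j%:R by rewrite -natr1; ring.
have -> : X - j.+1%:R = (X - 1) - j%:R by rewrite -natr1; ring.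
rewrite -(IH (w - 1) (X - 1) hA q dq) -(iota_eps_sigma w X (sf_sX j hA) dq).
by apply: (iota_eps_eq w X _ dq) => r _; rewrite exprS scalerA.
Qed.

Section Iteration.
Variables (w X : R).
Definition bd_eigenvalue (j : nat) : R := (w - j%:R) * (X - j%:R).

(* The shift by 0 makes T itself one of the commuting factors. *)
Definition iota_eps_iter (j : nat) A : M -> ext :=
  iteri j (fun i => iota_eps_sub w X (bd_eigenvalue i)) (iota_eps_sub w X 0 A).

Lemma smooth_iota_eps_iter j A : SF A -> SF (iota_eps_iter j A).
Proof. by move=> hA; elim: j => [|j IH]; exact: smooth_iota_eps_sub. Qed.

Lemma iota_eps_iterC j y A : SF A -> dom_eq (iota_eps_iter j (iota_eps_sub w X y A)) (iota_eps_sub w X y (iota_eps_iter j A)).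
Proof.
move=> hA; elim: j => [|j IH] q dq; first exact: (iota_eps_subC w X 0 y hA dq).
rewrite /iota_eps_iter !iteriS -!/(iota_eps_iter j _) (iota_eps_sub_eq w X _ IH dq).
exact: (iota_eps_subC w X _ _ (smooth_iota_eps_iter j hA) dq).
Qed.

Lemma smooth_foldr (js : seq nat) A : SF A -> SF (foldr (fun j => iota_eps_sub w X (bd_eigenvalue j)) A js).
Proof. by move=> hA; elim: js => // j js IH; exact: smooth_iota_eps_sub. Qed.

(** The solution applies the factor of index [l] first and T last, whereas the iteration of y
    applies T first and then the indices upwards from 0. The two products agree since all factors
    are polynomials in one operator. *)
Lemma iota_eps_iter_foldr l A : SF A -> dom_eq (iota_eps_iter l.+1 A)
  (iota_eps_sub w X (bd_eigenvalue 0) (iota_eps_sub w X 0 (foldr (fun j => iota_eps_sub w X (bd_eigenvalue j)) A (iota 1 l)))).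
Proof.
elim: l A => [|l IH] A hA q dq; first by [].
have -> : iota 1 l.+1 = iota 1 l ++ [:: l.+1] by rewrite -[X in iota _ X]addn1 iotaD add1n.
rewrite foldr_cat -(IH (iota_eps_sub w X (bd_eigenvalue l.+1) A) (smooth_iota_eps_sub w X _ hA) q dq).
by rewrite (iota_eps_iterC l.+1 _ hA dq).
Qed.

End Iteration.

Section Sequence.
Variables (kk : int) (w X : R) (C ph : M -> ext).
Hypotheses (hX : X = n.+1%:R + w - 2 * kk%:~R - 1) (hN : western_pair sigma g a kk X C ph).

(** The iterates are slots of y, hence smooth by construction; only [sigma_y_seq] identifies them as
    quotients by powers of sigma. *)
Definition y_seq (j : nat) : (M -> ext) * (M -> ext) :=
  iteri j (fun i F => (y_west sigma g a (w - i%:R) (X - i%:R) F.1 F.2,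
                       y_south sigma g a (w - i%:R) (X - i%:R) F.1 F.2)) (C, ph).

Lemma wp_y_seq j : western_pair sigma g a kk (X - j%:R) (y_seq j).1 (y_seq j).2.
Proof.
elim: j => [|j IH]; first by rewrite subr0.
have -> : X - j.+1%:R = X - j%:R - 1 by rewrite -natr1; ring.
have hX' : X - j%:R = n.+1%:R + (w - j%:R) - 2 * kk%:~R - 1 by rewrite hX; ring.
exact: (wp_step hM hn hc hs cg hX' IH).
Qed.

(** Moving [s ^+ j] out through T lowers both weights by [j]. There the [j]-th iterate is a western
    pair, so [step_sW] supplies the next factor sigma. *)
Lemma sigma_y_seq j : dom_eq (fun q => s q ^+ j *: (y_seq j).1 q)
  (iteri j (fun i => iota_eps_sub w X (bd_eigenvalue w X i)) C).
Proof.
elim: j => [|j IH] q dq; first by rewrite expr0 scale1r.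
have hX' : X - j%:R = n.+1%:R + (w - j%:R) - 2 * kk%:~R - 1 by rewrite hX; ring.
have hj := wp_y_seq j; have hC := wp_C hj.
rewrite iteriS -(iota_eps_sub_eq w X _ IH dq) /iota_eps_sub iota_eps_sigmaX //.
rewrite exprSr -scalerA /y_seq iteriS -/(y_seq j) /=.
rewrite (step_sW hM hn hc hs cg hX' hj dq) scalerBr; congr (_ - _).
by rewrite !scalerA mulrC.
Qed.

End Sequence.

End Recursion.

(** * The tractor Proca solution *)

Section Vanishing.
Context {R : realType} {n : nat} {M : chart_space R n.+1}.
Hypothesis hM : manifold_with_boundary M.
Variables (c : set (metric M)) (sigma : metric M -> M -> R).
Implicit Types (A B : dform M) (F G : tractor M).

(** Fields are constrained only on chart domains and in scales of the class, so I^* F = 0 is an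
    equality in this sense and every operator has to be shown to respect it. *)
Definition vanishes A := forall g a p, c g -> dom a p -> A g a p = 0.

Lemma vanishes_lin x A B : vanishes A -> vanishes B -> vanishes (A + x *: B).
Proof.
move=> hA hB g a p cg dp; have -> : (A + x *: B) g a p = A g a p + x *: B g a p by [].
by rewrite hA // hB // scaler0 addr0.
Qed.

Lemma vanishesZ x A : vanishes A -> vanishes (x *: A).
Proof.
move=> hA g a p cg dp; have -> : (x *: A) g a p = x *: A g a p by [].
by rewrite hA // scaler0.
Qed.

Lemma vanishesD A B : vanishes A -> vanishes B -> vanishes (A + B).
Proof. by move=> hA hB; have := vanishes_lin 1 hA hB; rewrite scale1r. Qed.

Lemma vanishesB A B : vanishes A -> vanishes B -> vanishes (A - B).
Proof. by move=> hA hB; have := vanishes_lin (-1) hA hB; rewrite scaleN1r. Qed.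

Lemma vanishes_fscale f A : vanishes A -> vanishes (fscale f A).
Proof.
move=> hA g a p cg dp; have -> : fscale f A g a p = f g a p *: A g a p by [].
by rewrite hA // scaler0.
Qed.

Lemma vanishes_ext_d A : vanishes A -> vanishes (ext_d A).
Proof.
move=> hA g a p cg dp; apply: (etrans _ (ed0 hM g dp)).
by apply: (ed_eq hM g dp) => q dq; exact: hA.
Qed.

Lemma vanishes_codiff A : vanishes A -> vanishes (codiff A).
Proof.
move=> hA g a p cg dp; apply: (etrans _ (del0 hM g dp)).
by apply: (del_eq hM g dp) => q dq; exact: hA.
Qed.

Lemma vanishes_laplacian A : vanishes A -> vanishes (form_laplacian A).
Proof.
move=> hA; apply: vanishesD.
  by apply: vanishes_ext_d; exact: vanishes_codiff.
by apply: vanishes_codiff; exact: vanishes_ext_d.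
Qed.

Lemma vanishes_J2P A : vanishes A -> vanishes (J2P A).
Proof.
move=> hA; apply: vanishesB; first exact: vanishes_fscale.
apply: vanishesZ => g a p cg dp; rewrite /schouten_action big1 // => i _; rewrite big1 // => j _.
by rewrite hA // (linear0 (int_basis i)) (linear0 (ext_basis j)) scaler0.
Qed.

(** Disposes of the summand D I^* of y on tractors annihilated by I^*. *)
Lemma tractor_D_vanishes k w F : tractor_eq c F (tractor0 M) ->
  tractor_eq c (tractor_D k w F) (tractor0 M).
Proof.
move=> [h1 h2 h3 h4]; split; rewrite /tractor_D /=.
- apply: vanishesZ; apply: vanishesB; [exact: vanishesZ|exact: vanishes_ext_d].
- by apply: vanishesZ; exact: vanishes_ext_d.
- apply: vanishesD; [apply: vanishesB; [apply: vanishesD|]|].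
  + exact: vanishes_laplacian.
  + by apply: vanishesZ; exact: vanishes_J2P.
  + by apply: vanishesZ; exact: vanishes_codiff.
  by apply: vanishesZ; apply: vanishesD; [exact: vanishes_ext_d|exact: vanishesZ].
apply: vanishesB; [apply: vanishesB; [apply: vanishesB|apply: vanishesD]|].
- by apply: vanishes_J2P; exact: vanishes_ext_d.
- by apply: vanishes_ext_d; exact: vanishes_J2P.
- exact: vanishes_laplacian.
- by apply: vanishesZ; exact: vanishes_J2P.
by apply: vanishesZ; exact: vanishes_ext_d.
Qed.

End Vanishing.

(** * Western pairs as tractors: the operators I^*, hat D^* and y on them *)

Section Solution.
Context {R : realType} {n : nat} {M : chart_space R n.+1}.
Hypothesis hM : manifold_with_boundary M.
Hypothesis hn : (2 <= n)%N.
Variables (c : set (metric M)) (sigma : metric M -> M -> R).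
Hypotheses (hc : conformal_class c) (hs : poincare_einstein c sigma).
Implicit Types (g : metric M) (a : chart M) (p : M) (A C ph : dform M).
Local Notation m := (n.+1%:R : R).
Variable k : nat.
Local Notation kk := (k%:Z).
Local Notation ext := (exterior R n.+1).

Lemma tilde_iota_epsE w X A g a : X = m + w - 2 * kk%:~R - 1 ->
  tilde_iota_eps sigma kk w A g a = iota_eps_at sigma g a w X (A g a).
Proof.
move=> ->; have -> : m + w - 2 * kk%:~R - 1 = m + (w + 1) - 2 * (kk + 1)%:~R by rewrite intrD; ring.
by [].
Qed.

(** iota~ C = 0 reads (X + 1) iota(nu) C = sigma delta C, so dividing - delta C by X + 1 satisfies
    both equations of a western pair. *)
Lemma wp_ker g a (X : R) (C : M -> exterior R n.+1) : c g -> smooth_field a C ->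
  (forall p, dom a p -> homogeneous kk (C p)) -> X + 1 != 0 ->
  (forall p, dom a p -> tilde_iota_at sigma g a (X + 1) C p = 0) ->
  western_pair sigma g a kk X C (fun q => - (X + 1)^-1 *: del g a C q).
Proof.
move=> cg hC dC X0 tC; split => //.
- by apply: sf_cZ; exact: (sf_del hM hc cg).
- move=> p dp; have := tC p dp; rewrite /tilde_iota_at => /eqP; rewrite subr_eq0 => /eqP E.
  apply: (scalerI X0); rewrite scaler0 scalerDr E.
  move: (sigma g p) (del g a C p) X0 => x y X0; apply/ffunP => S.
  by rewrite !ffunE /GRing.scale /=; field.
move=> p dp; rewrite scaleNr scalerN scalerA divff // scale1r addrN; by [].
Qed.

Section WestSouth.
Variables (w0 : R) (C ph : dform M).
Let w : R := w0 + k%:R.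
Let X : R := n%:R + w0 - k%:R.
Hypothesis hN : forall g a, c g -> western_pair sigma g a kk X (C g a) (ph g a).
Let F := Tractor 0 C 0 ph.
Let hX : X = m + w - 2 * kk%:~R - 1.
Proof. by rewrite /X /w -(natr1 n) -[kk%:~R]/(k%:R); ring. Qed.

Lemma wp_Istar : tractor_eq c (tractor_Istar sigma F) (tractor0 M).
Proof.
split => g a p cg dp.
- have -> : north (tractor_Istar sigma F) g a p =
    - int_mul (g a p) (nu sigma g a p) 0 - sigma g p *: 0 by [].
  by rewrite scaler0 subr0 (linear0 (int_mul _ _)) oppr0.
- have -> : west (tractor_Istar sigma F) g a p =
    rho sigma g a p *: 0 + int_nu_at sigma g a (C g a) p + sigma g p *: ph g a p by [].
  by rewrite scaler0 add0r (wp_I (hN a cg) dp).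
- have -> : east (tractor_Istar sigma F) g a p =
    int_mul (g a p) (nu sigma g a p) 0 by [].
  exact: (linear0 (int_mul _ _)).
have -> : south (tractor_Istar sigma F) g a p =
    rho sigma g a p *: 0 - int_nu_at sigma g a (ph g a) p by [].
by rewrite scaler0 sub0r (wp_Iph hM hc hs cg (hN a cg) dp) oppr0.
Qed.

(** The western slot is the second equation of a western pair. For the southern one, phi is a
    multiple of delta C and delta delta = 0. *)
Lemma wp_hatDstar : X + 1 != 0 ->
  tractor_eq c (tractor_hatDstar kk w0 F) (tractor0 M).
Proof.
move=> X1; split => // g a p cg dp.
  have -> : west (tractor_hatDstar kk w0 F) g a p =
    del g a (C g a) p + (m + w0 - k%:R) *: ph g a p by [].
  have -> : m + w0 - k%:R = X + 1 by rewrite /X -(natr1 n); ring.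
  exact: (wp_del (hN a cg) dp).
have -> : south (tractor_hatDstar kk w0 F) g a p = - del g a (ph g a) p by [].
have hC := wp_C (hN a cg); have hph := wp_ph (hN a cg).
have D0 : del g a (ph g a) p = 0.
  apply: (scalerI X1); rewrite scaler0 -(del_cZ hM g (X + 1) hph dp).
  have E q : dom a q -> (X + 1) *: ph g a q = - del g a (C g a) q.
    by move=> dq; rewrite (wp_delE (hN a cg) dq) opprK.
  rewrite (del_eq hM g dp E) (del_N hM g (sf_del hM hc cg hC) dp).
  by rewrite (del_del0 hM hc cg hC dp) oppr0.
by rewrite D0 oppr0.
Qed.

(** Since I^* F = 0, only I^* D contributes. The constants in D match through X + w = d + 2 w0 - 1,
    and the northern and eastern slots vanish by [step_north] and [step_east]. *)
Lemma wp_y : tractor_eq c (tractor_y sigma kk w0 F)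
  (Tractor 0 (fun g a => y_west sigma g a w X (C g a) (ph g a)) 0
             (fun g a => y_south sigma g a w X (C g a) (ph g a))).
Proof.
have [z1 z2 z3 z4] := tractor_D_vanishes hM (kk - 1) w0 wp_Istar.
have Zd g a p : dom a p -> c g -> ext_d (0 : dform M) g a p = 0.
  by move=> dp cg; apply: (vanishes_ext_d hM (c := c)).
have E1 g a : c g -> forall q, dom a q ->
    north (tractor_D kk w0 F) g a q = D_north w X (C g a) q.
  move=> cg q dq; have -> : north (tractor_D kk w0 F) g a q =
    (m + 2 * w0 - 2) *: (w *: C g a q - ext_d (0 : dform M) g a q) by [].
  rewrite Zd // subr0 /D_north; congr (_ *: _).
  by rewrite /X /w -(natr1 n); ring.
have E2 g a : c g -> forall q, dom a q ->
    west (tractor_D kk w0 F) g a q = D_west g a w X (C g a) q.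
  move=> cg q dq; have -> : west (tractor_D kk w0 F) g a q =
    (m + 2 * w0 - 2) *: ed g a (C g a) q by [].
  by rewrite /D_west; congr (_ *: _); rewrite /X /w -(natr1 n); ring.
have E3 g a : c g -> forall q, dom a q ->
    east (tractor_D kk w0 F) g a q = D_east g a w X (C g a) (ph g a) q.
  move=> cg q dq; have -> : east (tractor_D kk w0 F) g a q =
    form_laplacian (0 : dform M) g a q + (w - 2) *: J2P (0 : dform M) g a q
    - 2 *: del g a (C g a) q
    + (m + 2 * w0) *: (ext_d (0 : dform M) g a q + (w - 2) *: ph g a q) by [].
  rewrite Zd // (_ : form_laplacian _ g a q = 0); last exact: (vanishes_laplacian hM (c := c)).
  rewrite (_ : J2P _ g a q = 0); last exact: (vanishes_J2P (c := c)).
  rewrite scaler0 !add0r addrC /D_east; congr (_ *: _ - _).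
  by rewrite /X /w -(natr1 n); ring.
have E4 g a : c g -> forall q, dom a q ->
    south (tractor_D kk w0 F) g a q = D_south g a w X (C g a) (ph g a) q.
  move=> cg q dq; have -> : south (tractor_D kk w0 F) g a q =
    J2P (ext_d (0 : dform M)) g a q - ext_d (J2P (0 : dform M)) g a q
    - (ed g a (del g a (C g a)) q + del g a (ed g a (C g a)) q + w *: J2P_at g a (C g a) q)
    - (m + 2 * w0) *: ed g a (ph g a) q by [].
  rewrite (_ : J2P _ g a q = 0); last first.
    by apply: (vanishes_J2P (c := c)) => //; exact: vanishes_ext_d.
  rewrite (_ : ext_d (J2P _) g a q = 0); last first.
    by apply: (vanishes_ext_d hM (c := c)) => //; exact: vanishes_J2P.
  rewrite subr0 sub0r /D_south; congr (_ - _ *: _).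
  by rewrite /X /w -(natr1 n); ring.
split => g a p cg dp;
  have e1 := E1 g a cg p dp; have e2 := E2 g a cg p dp;
  have e3 := E3 g a cg p dp; have e4 := E4 g a cg p dp.
- have G (x y z : ext) : x = D_north w X (C g a) p -> y = D_east g a w X (C g a) (ph g a) p -> z = 0 ->
      - (- int_mul (g a p) (nu sigma g a p) x - sigma g p *: y + z) = 0.
    by move=> -> -> ->; rewrite addr0 opprD !opprK; exact: (step_north w (hN a cg) dp).
  exact: (G _ _ _ e1 e3 (z1 g a p cg dp)).
- have G (x y t z : ext) : x = D_north w X (C g a) p -> y = D_west g a w X (C g a) p ->
      t = D_south g a w X (C g a) (ph g a) p -> z = 0 ->
      - (rho sigma g a p *: x + int_mul (g a p) (nu sigma g a p) y + sigma g p *: t + z) =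
      y_west sigma g a w X (C g a) (ph g a) p.
    by move=> -> -> -> ->; rewrite addr0.
  exact: (G _ _ _ _ e1 e2 e4 (z2 g a p cg dp)).
- have G (y z : ext) : y = D_east g a w X (C g a) (ph g a) p -> z = 0 ->
      - (int_mul (g a p) (nu sigma g a p) y + z) = 0.
    move=> -> ->; rewrite addr0.
    rewrite -[int_mul _ _ _]/(int_nu_at sigma g a (D_east g a w X (C g a) (ph g a)) p).
    by rewrite (step_east hM hc hs cg w (hN a cg) dp) oppr0.
  exact: (G _ _ e3 (z3 g a p cg dp)).
have G (y t z : ext) : y = D_east g a w X (C g a) (ph g a) p ->
    t = D_south g a w X (C g a) (ph g a) p -> z = 0 ->
    - (rho sigma g a p *: y - int_mul (g a p) (nu sigma g a p) t + z) =
    y_south sigma g a w X (C g a) (ph g a) p.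
  by move=> -> -> ->; rewrite addr0.
exact: (G _ _ _ e3 e4 (z4 g a p cg dp)).
Qed.

End WestSouth.

End Solution.

(** * The product formula for the solution: order of vanishing and boundary values *)

Section Proca.
Context {R : realType} {n : nat} {M : chart_space R n.+1}.
Hypothesis hM : manifold_with_boundary M.
Hypothesis hn : (2 <= n)%N.
Variables (c : set (metric M)) (sigma : metric M -> M -> R).
Hypotheses (hc : conformal_class c) (hs : poincare_einstein c sigma).
Implicit Types (g : metric M) (a : chart M) (p q : M) (A B C ph : dform M).
Local Notation m := (n.+1%:R : R).
Local Notation ext := (exterior R n.+1).
Variables (k : nat) (w0 : R).
Local Notation kk := (k%:Z).
Local Notation w := (w0 + k%:R).
Local Notation X := (n%:R + w0 - k%:R).
Local Notation T := (tilde_iota_eps sigma kk w).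

Let hX : X = m + w - 2 * kk%:~R - 1.
Proof. by rewrite -(natr1 n) -[kk%:~R]/(k%:R); ring. Qed.

Definition proca_factor (j : nat) A : dform M :=
  (j%:R * (n%:R + 2 * w0 - j%:R))^-1 *:
    (T A - ((w0 + k%:R - j%:R) * (n%:R + w0 - k%:R - j%:R)) *: A).

Definition proca_coef (js : seq nat) : R :=
  \prod_(j <- js) (j%:R * (n%:R + 2 * w0 - j%:R))^-1.

Lemma iota_epsE A g a : T A g a = iota_eps_at sigma g a w X (A g a).
Proof. exact: tilde_iota_epsE. Qed.

Lemma density_factor j A : density_form c kk w A -> density_form c kk w (proca_factor j A).
Proof.
move=> hA; apply: densityZ; rewrite [T A - _]addrC -scaleNr.
by apply: density_lin => //; exact: (density_iota_eps hM hc hs).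
Qed.

Lemma density_factors js A : density_form c kk w A ->
  density_form c kk w (foldr proca_factor A js).
Proof. by move=> hA; elim: js => // j js; exact: density_factor. Qed.

Lemma factorE j A g a q :
  proca_factor j A g a q = (j%:R * (n%:R + 2 * w0 - j%:R))^-1 *:
    iota_eps_sub sigma g a w X (bd_eigenvalue w X j) (A g a) q.
Proof.
have -> : proca_factor j A g a q = (j%:R * (n%:R + 2 * w0 - j%:R))^-1 *:
  (T A g a q - bd_eigenvalue w X j *: A g a q) by [].
by rewrite iota_epsE.
Qed.

Lemma factorsE js A g a : c g -> density_form c kk w A ->
  dom_eq a (foldr proca_factor A js g a) (fun q => proca_coef js *:
    foldr (fun j => iota_eps_sub sigma g a w X (bd_eigenvalue w X j)) (A g a) js q).
Proof.
move=> cg hA; have sA := density_sform hA cg.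
elim: js => [|j js IH] q dq; first by rewrite /proca_coef big_nil scale1r.
rewrite [LHS]factorE (iota_eps_sub_eq hM sigma g w X (bd_eigenvalue w X j) IH dq).
rewrite (iota_eps_subZ hM hc hs cg w X _ _ (smooth_foldr hM hc hs cg w X js (sA a)) dq).
by rewrite /proca_coef big_cons scalerA.
Qed.

Section Boundary.
Variables (g : metric M) (a : chart M) (p : M).
Hypotheses (cg : c g) (dp : dom a p) (p0 : crd a p ord0 ord0 = 0).

Lemma T_boundary A : int_nu_at sigma g a (A g a) p = 0 -> T A g a p = (X * w) *: A g a p.
Proof. by move=> H; rewrite iota_epsE; exact: (iota_eps_boundary hM hn hc hs cg dp p0). Qed.

Lemma factors_boundary js A : int_nu_at sigma g a (A g a) p = 0 ->
  (forall j, j \in js -> j%:R * (n%:R + 2 * w0 - j%:R) != 0 :> R) ->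
  foldr proca_factor A js g a p = A g a p.
Proof.
move=> A0; elim: js => // j js IH hj.
have E : foldr proca_factor A js g a p = A g a p.
  by apply: IH => i ij; apply: hj; rewrite inE ij orbT.
have I0 : int_nu_at sigma g a (foldr proca_factor A js g a) p = 0 by rewrite /int_nu_at E.
have nz := hj j (mem_head _ _).
have -> : foldr proca_factor A (j :: js) g a p = (j%:R * (n%:R + 2 * w0 - j%:R))^-1 *:
  (T (foldr proca_factor A js) g a p
   - ((w0 + k%:R - j%:R) * (n%:R + w0 - k%:R - j%:R)) *: foldr proca_factor A js g a p) by [].
rewrite T_boundary // E -scalerBl scalerA.
rewrite (_ : X * w - _ = j%:R * (n%:R + 2 * w0 - j%:R)); last by ring.
by rewrite mulVf // scale1r.
Qed.

End Boundary.

Hypotheses (w_neq0 : w != 0) (X_neq0 : X != 0) (X1_neq0 : X + 1 != 0).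
Variables (A0 : dform M) (l : nat).
Hypothesis hA0 : density_form c kk w A0.
Local Notation A := (proca_form sigma k w0 l A0).
Local Notation B := (foldr proca_factor A0 (iota 1 l)).
Local Notation phi := (- (m + w0 - kk%:~R)^-1 *: codiff A).

Lemma proca_formE : A = (w * X)^-1 *: T B. Proof. by []. Qed.

Let hB : density_form c kk w B := density_factors (iota 1 l) hA0.

Lemma density_proca : density_form c kk w A.
Proof.
rewrite proca_formE; apply: densityZ; exact: (density_iota_eps hM hc hs).
Qed.

Lemma weight_X1 : m + w0 - kk%:~R = X + 1.
Proof. by rewrite -(natr1 n) -[kk%:~R]/(k%:R); ring. Qed.

Lemma wp_iota_eps C x g a : c g -> density_form c kk w C ->
  western_pair sigma g a kk X ((x *: T C) g a)
    (fun q => - (X + 1)^-1 *: del g a ((x *: T C) g a) q).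
Proof.
move=> cg hC; have sC := density_sform hC cg (a := a).
have hT : density_form c kk w (x *: T C) by apply: densityZ; exact: (density_iota_eps hM hc hs).
have sT := density_sform hT cg (a := a).
apply: (wp_ker hM hc cg) => // [p dp|p dp]; first exact: (form_degree (hT.1 g cg) dp).
have E : dom_eq a ((x *: T C) g a) (fun q => x *: iota_eps_at sigma g a w X (C g a) q).
  by move=> q dq; rewrite -iota_epsE.
rewrite (tilde_iota_at_eq hM sigma g (X + 1) E dp) /tilde_iota_at /int_nu_at int_mulZ.
rewrite (del_cZ hM g x (smooth_iota_eps hM hc hs cg w X sC) dp).
have := tilde_iota_sqr hM hc hs cg X (sf_te hM hc hs cg w sC) dp.
rewrite /tilde_iota_at -/(iota_eps_at sigma g a w X (C g a)) /int_nu_at.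
move: (int_mul _ _ _) (del _ _ _ _) (sigma g p) => y1 y2 y3 H.
by rewrite [y3 *: _]scalerA [y3 * x]mulrC -scalerA [(X + 1) *: _]scalerA [(X + 1) * x]mulrC
  -scalerA -scalerBr H scaler0.
Qed.

Lemma wp_proca g a : c g -> western_pair sigma g a kk X (A g a) (phi g a).
Proof. by move=> cg; have := wp_iota_eps (w * X)^-1 a cg hB; rewrite -weight_X1. Qed.

(** The southern slot belonging to T A0, the starting pair of the iteration. The scalar 1 makes it
    an instance of [wp_iota_eps], which is also applied to the solution with the scalar
    [(w * X)^-1]. *)
Let base g a q : ext := - (X + 1)^-1 *: del g a ((1 *: T A0) g a) q.
Definition quotient j g a := y_seq sigma g a w X ((1 *: T A0) g a) (base g a) j.
Definition west_quotient j : dform M := fun g a => (quotient j g a).1.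
Definition south_quotient j : dform M := fun g a => (quotient j g a).2.

Lemma wp_quotient j g a : c g ->
  western_pair sigma g a kk (X - j%:R) (west_quotient j g a) (south_quotient j g a).
Proof. by move=> cg; exact: (wp_y_seq hM hn hc hs cg hX (wp_iota_eps 1 a cg hA0)). Qed.

(** By [step_sW], sigma times the next quotient is a combination of the present one and its image
    under T, both densities of known weight; [density_div] then lowers that weight by one. *)
Lemma density_quotient j : density_form c kk (w - j%:R) (west_quotient j).
Proof.
elim: j => [|j IH].
  by rewrite subr0; apply: densityZ; exact: (density_iota_eps hM hc hs).
have -> : w - j.+1%:R = w - j%:R - 1 by rewrite -natr1; ring.
have hX' : X - j%:R = m + (w - j%:R) - 2 * kk%:~R - 1 by rewrite hX; ring.
apply: (density_div hM hc hs (A := - bd_eigenvalue w X j *: west_quotient j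
  + tilde_iota_eps sigma kk (w - j%:R) (west_quotient j))).
- by apply: density_lin => //; exact: (density_iota_eps hM hc hs).
- by move=> g a cg; exact: (wp_C (wp_quotient j.+1 a cg)).
move=> g a p cg dp.
have W : west_quotient j.+1 g a p = y_west sigma g a (w - j%:R) (X - j%:R)
   (west_quotient j g a) (south_quotient j g a) p by [].
rewrite W (step_sW hM hn hc hs cg hX' (wp_quotient j a cg) dp).
have G (y : R) (D E : dform M) : (- y *: D + E) g a p = E g a p - y *: D g a p.
  by rewrite -scaleNr -[E g a p + _]addrC.
by rewrite G (tilde_iota_epsE sigma _ g a hX').
Qed.

Lemma iteri_iota_eps_sub_eq j g a (C D : M -> ext) : dom_eq a C D ->
  dom_eq a (iteri j (fun i => iota_eps_sub sigma g a w X (bd_eigenvalue w X i)) C)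
           (iteri j (fun i => iota_eps_sub sigma g a w X (bd_eigenvalue w X i)) D).
Proof. by move=> CD; elim: j => // j IH; exact: iota_eps_sub_eq. Qed.

Lemma sigma_west g a q : c g -> dom a q ->
  sigma g q *: y_west sigma g a w X (A g a) (phi g a) q =
  ((w * X)^-1 * proca_coef (iota 1 l)) *: (sigma g q ^+ l.+1 *: west_quotient l.+1 g a q).
Proof.
move=> cg dq; have sA0 := density_sform hA0 cg (a := a).
rewrite (step_sW hM hn hc hs cg hX (wp_proca a cg) dq).
have sF := smooth_foldr hM hc hs cg w X (iota 1 l) sA0.
set Fd := foldr _ _ _ in sF.
have E : dom_eq a (A g a) (fun q => ((w * X)^-1 * proca_coef (iota 1 l)) *: iota_eps_sub sigma g a w X 0 Fd q).
  move=> r dr; have -> : A g a r = (w * X)^-1 *: T B g a r by [].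
  rewrite iota_epsE (iota_eps_eq hM sigma g w X (factorsE (iota 1 l) cg hA0) dr).
  by rewrite (iota_epsZ hM hc hs cg w X _ sF dr) scalerA /iota_eps_sub scale0r subr0.
(* Subtracting [w X] is the factor of index 0, absent from the solution; with it the product becomes
   the one of [sigma_y_seq] for [l.+1]. *)
transitivity (iota_eps_sub sigma g a w X (bd_eigenvalue w X 0) (A g a) q); first by rewrite /iota_eps_sub /bd_eigenvalue !subr0.
rewrite (iota_eps_sub_eq hM sigma g w X (bd_eigenvalue w X 0) E dq) (iota_eps_subZ hM hc hs cg w X _ _ (smooth_iota_eps_sub hM hc hs cg w X 0 sF) dq).
rewrite -(iota_eps_iter_foldr hM hc hs cg w X l sA0 dq); congr (_ *: _).
rewrite (sigma_y_seq hM hn hc hs cg hX (wp_iota_eps 1 a cg hA0) l.+1 dq).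
apply: iteri_iota_eps_sub_eq dq => r dr.
by rewrite /iota_eps_sub -iota_epsE scale0r subr0; exact/esym/scale1r.
Qed.

Let coef : R := (w * X)^-1 * proca_coef (iota 1 l).

Lemma y_west_proca g a q : c g -> dom a q -> y_west sigma g a w X (A g a) (phi g a) q =
  sigma g q ^+ l *: (coef *: west_quotient l.+1 g a q).
Proof.
move=> cg dq; apply/eqP; rewrite -subr_eq0; apply/eqP; move: q dq.
have hq := wp_C (wp_quotient l.+1 a cg).
apply: (sf_cancel hM hs cg).
  apply: sf_B; first exact: (smooth_y_west hM hc hs cg w (wp_proca a cg)).
  by apply: (sf_sX hs cg); exact: sf_cZ.
move=> q dq; rewrite scalerBr sigma_west //.
apply/eqP; rewrite subr_eq0; apply/eqP; rewrite -/coef !scalerA; congr (_ *: _).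
by rewrite exprS; move: coef (sigma g q) (_ ^+ l) => x y z; ring.
Qed.

(** On both sides the southern slot is determined by iota(nu) of the western one through the first
    equation of a western pair, so the formula follows from [y_west_proca] by cancelling sigma. *)
Lemma y_south_proca g a q : c g -> dom a q -> y_south sigma g a w X (A g a) (phi g a) q =
  sigma g q ^+ l *: (coef *: south_quotient l.+1 g a q).
Proof.
move=> cg dq; apply/eqP; rewrite -subr_eq0; apply/eqP; move: q dq.
have hN := wp_quotient l.+1 a cg; have hA := wp_proca a cg.
apply: (sf_cancel hM hs cg).
  apply: sf_B; first exact: (smooth_y_south hM hc hs cg w hA).
  by apply: (sf_sX hs cg); apply: sf_cZ; exact: (wp_ph hN).
move=> q dq; rewrite scalerBr; apply/eqP; rewrite subr_eq0; apply/eqP.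
have N (x y : ext) : x + y = 0 -> y = - x by move/eqP; rewrite addrC addr_eq0 => /eqP.
rewrite (N _ _ (step_I w hA dq)).
have E : int_nu_at sigma g a (west_quotient l.+1 g a) q = - (sigma g q *: south_quotient l.+1 g a q).
  by apply: N; rewrite addrC; exact: (wp_I hN dq).
have -> : int_nu_at sigma g a (y_west sigma g a w X (A g a) (phi g a)) q =
    sigma g q ^+ l *: (coef *: int_nu_at sigma g a (west_quotient l.+1 g a) q).
  by rewrite {1}/int_nu_at (y_west_proca cg dq) !int_mulZ.
rewrite E.
move: (south_quotient l.+1 g a q) coef (sigma g q) => z x y.
by rewrite !scalerN opprK !scalerA; congr (_ *: _); ring.
Qed.

Lemma proca_bigO : tractor_bigO sigma c kk (w0 - 1) l (tractor_y sigma kk w0 (western kk w0 A)).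
Proof.
(* What is left of y after removing [sigma ^+ l]. It satisfies the first equation of a western pair,
   which makes it a tractor section; the [l.+1] steps lower the weight [w] by [l.+1], one of them
   for y itself and [l] for the power of sigma. *)
exists (Tractor 0 (coef *: west_quotient l.+1) 0 (coef *: south_quotient l.+1)); split.
  apply: (tractor_section_wp hM hc hs).
  - have -> : w0 - 1 - l%:R + kk%:~R = w - l.+1%:R by rewrite -[kk%:~R]/(k%:R) -natr1; ring.
    by apply: densityZ; exact: density_quotient.
  - move=> g a cg; apply: sf_cZ; exact: (wp_ph (wp_quotient l.+1 a cg)).
  move=> g a p cg dp; have := wp_I (wp_quotient l.+1 a cg) dp.
  move=> H; have -> : forall x : R, forall D E : dform M, int_nu_at sigma g a ((x *: D) g a) p +
    sigma g p *: (x *: E) g a p = x *: (int_nu_at sigma g a (D g a) p + sigma g p *: E g a p).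
    move=> x D E.
    have L : int_nu_at sigma g a ((x *: D) g a) p = x *: int_nu_at sigma g a (D g a) p by exact: int_mulZ.
    have S : (x *: E) g a p = x *: E g a p by [].
    rewrite L S; move: (int_nu_at _ _ _ _ _) (E g a p) (sigma g p) => y z t.
    by rewrite scalerDr !scalerA mulrC.
  by rewrite H scaler0.
have [y1 y2 y3 y4] := wp_y hM hc hs (fun g a cg => wp_proca (g := g) a cg).
split => g a p cg dp.
- by apply: (etrans (y1 g a p cg dp)); apply/esym; exact: scaler0.
- by apply: (etrans (y2 g a p cg dp)); exact: y_west_proca.
- by apply: (etrans (y3 g a p cg dp)); apply/esym; exact: scaler0.
by apply: (etrans (y4 g a p cg dp)); exact: y_south_proca.
Qed.

Lemma proca_section : tractor_section c kk w0 (western kk w0 A).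
Proof.
apply: (tractor_section_wp hM hc hs); first exact: density_proca.
- by move=> g a cg; exact: (wp_ph (wp_proca a cg)).
by move=> g a p cg dp; exact: (wp_I (wp_proca a cg) dp).
Qed.

Hypothesis coef_neq0 : forall j, j \in iota 1 l -> j%:R * (n%:R + 2 * w0 - j%:R) != 0 :> R.
Variable AS : dform (boundary_space M).
Hypothesis hext : restricts_to c sigma A0 AS.

Lemma proca_boundary g a p : c g -> dom a p -> crd a p ord0 ord0 = 0 -> A g a p = A0 g a p.
Proof.
move=> cg dp p0; have [I0 _] := hext cg (conj dp p0 : dom (c := boundary_space M) a p).
have E := factors_boundary cg dp p0 I0 coef_neq0.
have -> : A g a p = (w * X)^-1 *: T B g a p by [].
rewrite (T_boundary cg dp p0); last by rewrite /int_nu_at E.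
by rewrite E scalerA [X * w]mulrC mulVf ?scale1r // mulf_neq0.
Qed.

(** With delta A = - (X + 1) phi, [codiff_boundary] gives - (X + 1) phi + phi = - X phi for the
    codifferential of the boundary value. This is how the denominator of the insertion drops by one,
    from dimension n + 1 to dimension n. *)
Lemma proca_south_boundary g a p : c g -> dom a p -> crd a p ord0 ord0 = 0 ->
  pullback (phi g a p) = - (n%:R + w0 - kk%:~R)^-1 *: codiff AS (restrict_metric g) a p.
Proof.
move=> cg dp p0; have hN := wp_proca a cg.
have HB q : dom a q -> crd a q ord0 ord0 = 0 -> AS (restrict_metric g) a q = pullback (A g a q).
  move=> dq q0; have [_ <-] := hext cg (conj dq q0 : dom (c := boundary_space M) a q).
  by rewrite (proca_boundary cg dq q0).
have H := codiff_boundary hM hn hc hs cg dp p0 (wp_C hN) (wp_ph hN) (wp_I hN) HB.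
rewrite H (wp_delE hN dp) (linearN pullback) /= pullbackZ -[kk%:~R]/(k%:R).
move: (pullback (phi g a p)) => Y; move: X X_neq0 => x x0.
by apply/ffunP => S; rewrite !ffunE /GRing.scale /=; field.
Qed.

Lemma proca_restricts : tractor_restricts_to c sigma (western kk w0 A) (western kk w0 AS).
Proof.
split => //.
  move=> g a p cg bp; have [dp p0] := bp; have [I0 P0] := hext cg bp.
  have E := proca_boundary cg dp p0.
  by split; [rewrite /int_nu /= E|rewrite [west _]/= E].
move=> g a p cg [dp p0]; split; last exact: (proca_south_boundary cg dp p0).
exact: (wp_Iph hM hc hs cg (wp_proca a cg) dp).
Qed.

End Proca.

Theorem proposition5p31 (R : realType) (n : nat) (hn : (2 <= n)%N)
  (M : chart_space R n.+1) (hM : manifold_with_boundary M)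
  (c : set (metric M)) (hc : conformal_class c)
  (sigma : metric M -> M -> R) (hsigma : poincare_einstein c sigma)
  (k : nat) (w0 : R)
  (hw1 : w0 <> - k%:R) (hw2 : w0 <> k%:R - n.+1%:R) (hw3 : w0 <> k%:R - n%:R)
  (A0 : dform M) (hA0 : density_form c k%:Z (w0 + k%:R) A0)
  (ASigma : dform (boundary_space M))
  (hASigma : density_form (boundary_class c) k%:Z (w0 + k%:R) ASigma)
  (hext : restricts_to c sigma A0 ASigma)
  (l : nat) (hl : proca_order (n.+1%:R + 2 * w0) l) :
  let A : tractor M := western k%:Z w0 (proca_form sigma k w0 l A0) in
  [/\ tractor_section c k%:Z w0 A,
      tractor_restricts_to c sigma A (western k%:Z w0 ASigma),
      tractor_bigO sigma c k%:Z (w0 - 1) l (tractor_y sigma k%:Z w0 A) &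
      [/\ tractor_eq c (tractor_Istar sigma A) (tractor0 M),
          tractor_eq c (tractor_hatDstar k%:Z w0 A) (tractor0 M) &
          tractor_eq c (tractor_Xstar A) (tractor0 M)]].
Proof.
have w_neq0 : w0 + k%:R != 0 by rewrite addr_eq0; exact/eqP.
have X_neq0 : n%:R + w0 - k%:R != 0.
  by apply/eqP => H; apply: hw3; rewrite -[LHS]subr0 -H; ring.
have X1_neq0 : n%:R + w0 - k%:R + 1 != 0.
  by apply/eqP => H; apply: hw2; rewrite -[LHS]subr0 -H -natr1; ring.
(* A zero denominator would mean h0 = j + 1. If h0 = l + 2 then j = l + 1 lies outside the range; in
   the other case j + 1 is at least 2, a value that h0 does not take. *)
have cN j : j \in iota 1 l -> j%:R * (n%:R + 2 * w0 - j%:R) != 0 :> R.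
  rewrite mem_iota => /andP[j0 jl]; rewrite mulf_neq0 // ?pnatr_eq0 -?lt0n //.
  apply/eqP => /eqP; rewrite subr_eq0 => /eqP H.
  have {}H : n.+1%:R + 2 * w0 = j.+1%:R by rewrite -!natr1 -H; ring.
  case: hl => [|/(_ j.-1)]; rewrite H; last by rewrite prednK.
  by move=> /eqP; rewrite eqr_nat => /eqP [E]; rewrite E addSn add0n ltnn in jl.
have hN g a (cg : c g) := wp_proca hM hc hsigma X1_neq0 l hA0 a cg.
split.
- exact: proca_section.
- exact: proca_restricts.
- exact: proca_bigO.
split.
- exact: (wp_Istar hM hc hsigma hN).
- exact: (wp_hatDstar hM hc hN).
by [].
Qed.
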